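(* Let $n>2$, let $\alpha$ be an Einstein metric with Ricci constant $\mu$ on an $n$-dimensional manifold, and let $\beta$ be a Killing form of $\alpha$ with non-constant length satisfying the two conditions $$t_{00}+(a^2-\mu b^2)\alpha^2+\mu(b^2\alpha^2-\beta^2)-\frac{\mu}{a^2-\mu b^2}s_0^2=0,\qquad R_{bb}=\mu(b^2\alpha^2-\beta^2),$$ where $a\neq0$ is a constant. Let $\bar\alpha=e^{\rho(b^2)}\sqrt{\alpha^2-\kappa(b^2)\beta^2}$ and $\Delta:=1-b^2\kappa$. Then $\bar\alpha$ is an Einstein metric with Ricci constant $\bar\mu$ if and only if $X=Y=Z=0$, where $$\begin{aligned}X=\frac{1}{b^2\Delta}\Big\{&a^2\Delta(n-2\Delta)+b^2[\mu\Delta-(a^2-\mu b^2)\Delta'](1+2b^2\rho')-(n-2)(a^2-\mu b^2)\Delta(1+2b^2\rho')^2\\&-2(a^2-\mu b^2)b^2\Delta(1+2b^2\rho')'-(n-1)\bar\mu b^2\Delta e^{2\rho}\Big\},\end{aligned}$$ $$\begin{aligned}Y=-\frac{1}{b^4\Delta}\Big\{&a^2\Delta(1-\Delta)[n+(n-2)\Delta]+(2a^2-3\mu b^2)b^2\Delta\Delta'-(a^2-\mu b^2)b^4\Delta'^2+2(a^2-\mu b^2)b^4\Delta\Delta''\\&+\mu b^2\Delta(1-\Delta)(1+2b^2\rho')-(a^2-\mu b^2)b^2[1-(n-1)\Delta]\Delta'(1+2b^2\rho')\\&-(n-2)(a^2-\mu b^2)\Delta(1-\Delta)(1+2b^2\rho')^2-2(a^2-\mu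 b^2)b^2\Delta(1-\Delta)(1+2b^2\rho')'\\&-(n-1)\bar\mu b^2\Delta(1-\Delta)e^{2\rho}\Big\},\end{aligned}$$ $$\begin{aligned}Z=-\frac{1}{(a^2-\mu b^2)b^4\Delta^2}\Big\{&a^2\Delta^2(n-2\Delta)+(2a^2-3\mu b^2)b^2\Delta\Delta'-(a^2-\mu b^2)b^4\Delta'^2+2(a^2-\mu b^2)b^4\Delta\Delta''\\&-(n-2)\mu b^2\Delta^2(1+2b^2\rho')-(n-2)(a^2-\mu b^2)\Delta^2(1+2b^2\rho')^2\\&+2(n-2)(a^2-\mu b^2)b^2\Delta^2(1+2b^2\rho')'\Big\}.\end{aligned}$$
   Context: Setting: $M$ is a smooth connected $n$-manifold, $\alpha=\sqrt{a_{ij}(x)y^iy^j}$ is a Riemannian metric on $M$ (viewed as a function of tangent vectors $y$), $\beta=b_i(x)y^i$ is a 1-form, $b:=\|\beta\|_\alpha$. A bar ''$|$'' denotes covariant derivative with respect to the Levi-Civita connection of $\alpha$; indices are raised and lowered with $a_{ij}$. A 1-form is a Killing form if its dual vector field is Killing, i.e. $b_{i|j}+b_{j|i}=0$. Put $s_{ij}:=\frac12(b_{i|j}-b_{j|i})$, $s_i:=b^ms_{mi}$, $s_0:=s_iy^i$, $t_{ij}:=s_{im}s^m{}_j$, $t_{00}:=t_{ij}y^iy^j$. At points where $a^2-\mu b^2=0$ the term $s_0^2/(a^2-\mu b^2)$ is understood as its limit. Curvature: $R^i{}_k=R^i{}_k(y)$ denotes the Riemann curvature of $\alpha$, quadratic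 in $y$, normalized so that constant sectional curvature $\mu$ means $R^i{}_k=\mu(\alpha^2\delta^i{}_k-y^iy_k)$ with $y_k=a_{kl}y^l$; $R_{bb}:=R^i{}_kb_ib^k$. A Riemannian metric $\alpha$ is Einstein with Ricci constant $\mu$ if $Ric_{ij}y^iy^j=R^k{}_k=(n-1)\mu\alpha^2$ with $\mu$ constant. Deformation: $\rho,\kappa$ are smooth functions of the single variable $b^2$, a prime denotes $d/d(b^2)$ (so $(1+2b^2\rho')'=2\rho'+2b^2\rho''$), and $\Delta=1-b^2\kappa$ is assumed positive (so that $\bar\alpha$ is a Riemannian metric). Formulas with $b$ in the denominator are read where $\beta\neq0$. *)

(* Defs.v *)
From HB Require Import structures.
From mathcomp Require Import all_boot all_order all_algebra.
From mathcomp Require Import all_classical all_reals all_analysis.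
Set Implicit Arguments.
Unset Strict Implicit.
Unset Printing Implicit Defensive.
Import Order.TTheory GRing.Theory Num.Theory.
Import numFieldNormedType.Exports.
Local Open Scope classical_set_scope.
Local Open Scope ring_scope.

Section Smoothness.
Context {R : realType} {n : nat} {W : normedModType R}.

Definition partial (j : 'I_n) (f : 'rV[R]_n -> W) : 'rV[R]_n -> W :=
  'D_(delta_mx 0 j) f.

(* Only used for open U, so that continuity and derivability at the points of U
   do not depend on the values of the total function f outside U. *)
Fixpoint Ck_on (k : nat) (U : set 'rV[R]_n) (f : 'rV[R]_n -> W) : Prop :=
  (forall x, U x -> {for x, continuous f}) /\
  if k is k'.+1 then
    forall j : 'I_n, (forall x, U x -> derivable f x (delta_mx 0 j)) /\
                     Ck_on k' U (partial j f)
  else True.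

Definition smooth_on (U : set 'rV[R]_n) (f : 'rV[R]_n -> W) : Prop :=
  forall k, Ck_on k U f.

End Smoothness.

Definition smooth1_on (R : realType) (D : set R) (f : R -> R) : Prop :=
  forall k t, D t -> derivable (derive1n k f) t 1.

(* The maps chart i and chart_inv i are total; they are only meaningful on
   dom i and on its image under chart i, respectively. *)
Record manifold (R : realType) (n : nat) := Manifold {
  points :> topologicalType;
  chart_index : Type;
  dom : chart_index -> set points;
  chart : chart_index -> points -> 'rV[R]_n;
  chart_inv : chart_index -> 'rV[R]_n -> points;
  points_hausdorff : hausdorff_space points;
  points_second_countable : @second_countable points;
  dom_open : forall i, open (dom i);
  dom_cover : forall p, exists i, dom i p;
  image_open : forall i, open (chart i @` dom i);
  chartK : forall i p, dom i p -> chart_inv i (chart i p) = p;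
  chart_continuous : forall i p, dom i p -> {for p, continuous (chart i)};
  chart_inv_continuous : forall i x, (chart i @` dom i) x ->
    {for x, continuous (chart_inv i)};
  transition_smooth : forall i j,
    smooth_on ((chart i @` dom i) `&` (chart_inv i @^-1` dom j))
              (chart j \o chart_inv i)
}.

Section Tensors.
Context {R : realType} {n : nat}.
Implicit Types M : manifold R n.

Definition img M (i : chart_index M) : set 'rV[R]_n := chart i @` dom i.

Definition overlap M (i j : chart_index M) : set 'rV[R]_n :=
  img i `&` (chart_inv i @^-1` dom j).

Definition transition M (i j : chart_index M) : 'rV[R]_n -> 'rV[R]_n :=
  chart j \o chart_inv i.

(* Tensor fields are given by their components in each chart.  The library's
   Jacobian acts on row vectors: ('J f x) k l is the derivative of the l-th
   component of f in the k-th direction. *)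
Record metric M := Metric {
  metric_comp :> chart_index M -> 'rV[R]_n -> 'M[R]_n;
  metric_smooth : forall i, smooth_on (img i) (metric_comp i);
  metric_sym : forall i x, img i x -> (metric_comp i x)^T = metric_comp i x;
  metric_pos : forall i x (y : 'rV[R]_n), img i x -> y != 0 ->
    0 < (y *m metric_comp i x *m y^T) 0 0;
  metric_transform : forall i j x, overlap i j x ->
    metric_comp i x = 'J (transition i j) x *m metric_comp j (transition i j x)
                      *m ('J (transition i j) x)^T
}.

Record oneform M := Oneform {
  oneform_comp :> chart_index M -> 'rV[R]_n -> 'rV[R]_n;
  oneform_smooth : forall i, smooth_on (img i) (oneform_comp i);
  oneform_transform : forall i j x, overlap i j x ->
    oneform_comp i x =
    oneform_comp j (transition i j x) *m ('J (transition i j) x)^T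
}.

End Tensors.

(* Component formulas in one chart, for the components g of a metric and b of
   a 1-form; x is the coordinate vector of a point, y a tangent vector at x. *)
Section LocalFormulas.
Context {R : realType} {n : nat}.
Variables (g : 'rV[R]_n -> 'M[R]_n) (b : 'rV[R]_n -> 'rV[R]_n).
Implicit Types (x y : 'rV[R]_n) (i j k l m : 'I_n).

Definition ginv x : 'M[R]_n := invmx (g x).

Definition alpha x y : R :=
  Num.sqrt (\sum_i \sum_j g x i j * y 0 i * y 0 j).

Definition christoffel k i j x : R :=
  2^-1 * \sum_l ginv x k l *
    (partial i (fun z => g z j l : R^o) x + partial j (fun z => g z i l : R^o) x
     - partial l (fun z => g z i j : R^o) x).

(* R_j^i_{kl}, with the sign for which R_j^i_{kl} y^j y^l equals
   mu (alpha^2 delta^i_k - y^i y_k) in constant sectional curvature mu *)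
Definition riemann i j k l x : R :=
  partial k (christoffel i j l : _ -> R^o) x
  - partial l (christoffel i j k : _ -> R^o) x
  + \sum_m (christoffel i k m x * christoffel m j l x
            - christoffel i l m x * christoffel m j k x).

(* R^i_k(y) *)
Definition riem i k x y : R :=
  \sum_j \sum_l riemann i j k l x * y 0 j * y 0 l.

Definition ricci x y : R := \sum_k riem k k x y.

Definition beta x y : R := \sum_i b x 0 i * y 0 i.

Definition bup i x : R := \sum_j ginv x i j * b x 0 j.

(* b = ||beta||_alpha *)
Definition blen x : R := Num.sqrt (\sum_i bup i x * b x 0 i).

(* b_{i|j} *)
Definition cov i j x : R :=
  partial j (fun z => b z 0 i : R^o) x - \sum_k christoffel k i j x * b x 0 k.

Definition s_ij i j x : R := 2^-1 * (cov i j x - cov j i x).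

Definition s_i i x : R := \sum_m bup m x * s_ij m i x.

Definition s0 x y : R := \sum_i s_i i x * y 0 i.

(* s^m_j *)
Definition s_up m j x : R := \sum_k ginv x m k * s_ij k j x.

Definition t_ij i j x : R := \sum_m s_ij i m x * s_up m j x.

Definition t00 x y : R := \sum_i \sum_j t_ij i j x * y 0 i * y 0 j.

Definition Rbb x y : R := \sum_i \sum_k riem i k x y * b x 0 i * bup k x.

(* L is the value at (x, y) of s_0^2 / (a^2 - mu b^2).  Where the denominator
   vanishes this is the limit through points where it does not; x must then be
   an accumulation point of such points, since otherwise every L would be a
   limit. *)
Definition s0_term (a mu : R) x y (L : R) : Prop :=
  let den z := a ^+ 2 - mu * blen z ^+ 2 in
  let q z := s0 z y ^+ 2 / den z in
  if den x != 0 then L = q x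
  else closure [set z | den z != 0] x /\
       q z @[z --> within [set z | den z != 0] (nbhs x)] --> L.

End LocalFormulas.

Section GlobalNotions.
Context {R : realType} {n : nat} {M : manifold R n}.
Implicit Types (al : metric M) (be : oneform M).

Definition einstein al (mu : R) : Prop :=
  forall i x y, img i x ->
    ricci (al i) x y = (n%:R - 1) * mu * alpha (al i) x y ^+ 2.

Definition killing al be : Prop :=
  forall c x (i j : 'I_n), img c x ->
    cov (al c) (be c) i j x + cov (al c) (be c) j i x = 0.

Definition constant_length al be : Prop :=
  exists l : R, forall i x, img i x -> blen (al i) (be i) x = l.

End GlobalNotions.

(* In X_fun, Y_fun and Z_fun the variable t stands for b^2. *)
Section XYZ.
Context {R : realType}.
Variables (n : nat) (a mu mubar : R) (rho kappa : R -> R).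

Definition Delta (t : R) : R := 1 - t * kappa t.

(* 1 + 2 b^2 rho' *)
Definition P_fun (t : R) : R := 1 + 2 * t * derive1 rho t.

Definition X_fun (t : R) : R :=
  let N : R := n%:R in
  let w := a ^+ 2 - mu * t in
  let d := Delta t in let d1 := derive1 Delta t in
  let p := P_fun t in let p1 := derive1 P_fun t in
  (t * d)^-1 *
  (a ^+ 2 * d * (N - 2 * d)
   + t * (mu * d - w * d1) * p
   - (N - 2) * w * d * p ^+ 2
   - 2 * w * t * d * p1
   - (N - 1) * mubar * t * d * expR (2 * rho t)).

Definition Y_fun (t : R) : R :=
  let N : R := n%:R in
  let w := a ^+ 2 - mu * t in
  let d := Delta t in let d1 := derive1 Delta t in let d2 := derive1n 2 Delta t in
  let p := P_fun t in let p1 := derive1 P_fun t in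
  - (t ^+ 2 * d)^-1 *
  (a ^+ 2 * d * (1 - d) * (N + (N - 2) * d)
   + (2 * a ^+ 2 - 3 * mu * t) * t * d * d1
   - w * t ^+ 2 * d1 ^+ 2
   + 2 * w * t ^+ 2 * d * d2
   + mu * t * d * (1 - d) * p
   - w * t * (1 - (N - 1) * d) * d1 * p
   - (N - 2) * w * d * (1 - d) * p ^+ 2
   - 2 * w * t * d * (1 - d) * p1
   - (N - 1) * mubar * t * d * (1 - d) * expR (2 * rho t)).

Definition Z_fun (t : R) : R :=
  let N : R := n%:R in
  let w := a ^+ 2 - mu * t in
  let d := Delta t in let d1 := derive1 Delta t in let d2 := derive1n 2 Delta t in
  let p := P_fun t in let p1 := derive1 P_fun t in
  - (w * t ^+ 2 * d ^+ 2)^-1 *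
  (a ^+ 2 * d ^+ 2 * (N - 2 * d)
   + (2 * a ^+ 2 - 3 * mu * t) * t * d * d1
   - w * t ^+ 2 * d1 ^+ 2
   + 2 * w * t ^+ 2 * d * d2
   - (N - 2) * mu * t * d ^+ 2 * p
   - (N - 2) * w * d ^+ 2 * p ^+ 2
   + 2 * (N - 2) * w * t * d ^+ 2 * p1).

End XYZ.

(* Main.v *)
(* In index-free terms, g' = e^{2 rho} (g - kappa beta^2) with rho, kappa functions
   of t = |beta|^2, and dt = 2 s since beta is Killing.  The difference C of the
   two Levi-Civita connections is an explicit tensor in g, beta, s and s_ij, and
     Ric'(y,y) = Ric(y,y) + div C(y,y) - nabla_y (tr C)(y) + (tr C)(C(y,y)) - tr (C_y^2).
   Evaluating the right-hand side takes three facts: the Killing identity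
   nabla_k s_ij = - b_p R^p_kij turns the hypothesis on R_bb into
   nabla_y s (y) = w alpha^2 - mu s_0^2 / w with w = a^2 - mu t; the Einstein
   condition turns the divergence of s_ij into (n - 1) mu beta; and the hypothesis on
   t_00 computes the square of the endomorphism s_ij, hence every contraction of
   beta, s and s_ij.  Where t and w do not vanish this gives
     Ric' - (n - 1) mu' alpha'^2 = X alpha^2 + Y beta^2 + Z s_0^2,
   and the three squares are independent because n > 2 and |s|^2 = t w <> 0.
   Points with t w <> 0 are dense, so the remaining points follow by continuity. *)
Require Import Defs.
From HB Require Import structures.
From mathcomp Require Import all_boot all_order all_algebra.
From mathcomp Require Import all_classical all_reals all_analysis.
From mathcomp Require Import perm ring lra.
Import Order.TTheory GRing.Theory Num.Theory.
Import numFieldNormedType.Exports.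
Local Open Scope classical_set_scope.
Local Open Scope ring_scope.
Set Implicit Arguments.
Unset Strict Implicit.
Unset Printing Implicit Defensive.

(** All tensor calculus takes place in the coordinates of one chart. A vector y at x is extended to
    an affine field parallel at x; the partial derivatives at x of scalars such as beta(Y), s(Y) and
    g(Y,Y) are then covariant derivatives, and the Christoffel terms cancel once and for all in
    general lemmas. The tensor C is not obtained by inverting the deformed metric: it is written
    down and recognised by the uniqueness of the Levi-Civita connection. Its coefficient r = -
    (kappa' + kappa^2) / Delta solves the linear equation that metric compatibility leaves for the
    component along beta with raised index; this brings Delta into the denominators. The trace of
    C_y^2 is computable because y, s, beta and s_ij y, with indices raised, span a space stable
    under the endomorphism s_ij, whose square is known. Once every contraction is evaluated, what
    remains is an identity between rational functions of finitely many scalars. Density has two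
    sources: where w = 0, the very meaning of the limit of s_0^2 / w supplies nearby points with w
    <> 0; and beta vanishes on no open set because a <> 0. *)

(** * Directional derivatives and the symmetry of mixed second derivatives *)

Section DirectionalDerivatives.
Context {R : realType} {V : normedModType R}.
Implicit Types (f g : V -> R) (x v : V).

Lemma is_derive_add f g x v a b : is_derive x v f a -> is_derive x v g b ->
  is_derive x v (fun z => f z + g z) (a + b).
Proof. exact: is_deriveD. Qed.

Lemma is_derive_opp f x v a : is_derive x v f a ->
  is_derive x v (fun z => - f z) (- a).
Proof. exact: is_deriveN. Qed.

Lemma is_derive_mul f g x v a b : is_derive x v f a -> is_derive x v g b ->
  is_derive x v (fun z => f z * g z) (a * g x + f x * b).
Proof.
move=> fa gb; apply: (is_derive_eq (is_deriveM fa gb)).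
by rewrite addrC [a * _]mulrC.
Qed.

Lemma is_derive_const (c : R) x v : is_derive x v (fun=> c) 0.
Proof. exact: is_derive_cst. Qed.

Lemma is_derive_bigsum (I : Type) (r : seq I) (P : pred I) (h : I -> V -> R)
    (dh : I -> R) x v :
  (forall i, P i -> is_derive x v (h i) (dh i)) ->
  is_derive x v (fun z => \sum_(i <- r | P i) h i z)
                (\sum_(i <- r | P i) dh i).
Proof.
move=> hd; elim: r => [|i r IH].
  rewrite big_nil (_ : (fun _ => _) = cst 0); first exact: is_derive_cst.
  by apply/funext => z; rewrite big_nil.
rewrite big_cons (_ : (fun _ => _) = (fun z => if P i then
  h i z + \sum_(i <- r | P i) h i z else \sum_(i <- r | P i) h i z)); last first.
  by apply/funext => z; rewrite big_cons.
by case: ifPn => // Pi; apply: is_derive_add => //; exact: hd.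
Qed.

Lemma derivable_bigprod (I : Type) (r : seq I) (P : pred I) (h : I -> V -> R)
    x v :
  (forall i, P i -> derivable (h i) x v) ->
  derivable (fun z => \prod_(i <- r | P i) h i z) x v.
Proof.
move=> hd; elim: r => [|i r IH].
  rewrite (_ : (fun _ => _) = cst 1); first exact: derivable_cst.
  by apply/funext => z; rewrite big_nil.
rewrite (_ : (fun _ => _) = (fun z => if P i then
  h i z * \prod_(i <- r | P i) h i z else \prod_(i <- r | P i) h i z)); last first.
  by apply/funext => z; rewrite big_cons.
case: (boolP (P i)) => // Pi; by have [] := is_derive_mul (derivableP (hd _ Pi)) (derivableP IH).
Qed.

(** Only derivability of [f] along [v] is available, so [f] is restricted to the line through [x] in
    the direction [v] and the one-variable chain rule is applied there. *)
Lemma is_derive_comp1 (phi : R -> R) f x v a b :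
  is_derive (f x) 1 phi a -> is_derive x v f b ->
  is_derive x v (fun z => phi (f z)) (a * b).
Proof.
move=> phia fb.
have df : derivable (fun h : R => f (h *: v + x)) 0 1.
  by have [/derivable1P] := fb.
have dphi : derivable phi (f (0 *: v + x)) 1 by rewrite scale0r add0r; have [] := phia.
have E (g : V -> R) : 'D_v g x = derive1 (fun h : R => g (h *: v + x)) 0.
  rewrite derive1E /derive.
  set u := fun h => h^-1 *: _; set w := fun h => h^-1 *: _.
  suff -> : u = w by [].
  by apply/funext => h; rewrite /u /w /= addr0 scale0r add0r [_%:A]mulr1.
have dc : derivable (fun h : R => phi (f (h *: v + x))) 0 1.
  apply/derivable1_diffP; apply: (@differentiable_comp _ _ _ _ (fun h : R => f (h *: v + x)) phi).
    exact/derivable1_diffP.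
  exact/derivable1_diffP.
apply: DeriveDef; first exact/derivable1P.
rewrite E (derive1_comp df dphi) -E !derive_val scale0r add0r derive1E.
by rewrite derive_val.
Qed.

Lemma is_derive_inv f x v a : f x != 0 -> is_derive x v f a ->
  is_derive x v (fun z => (f z)^-1) (- a / f x ^+ 2).
Proof.
move=> fx0 fa; apply: DeriveDef; first exact: derivableV.
by rewrite deriveV // derive_val /GRing.scale /= mulNr mulrC mulNr.
Qed.

(* The two mixed derivatives are both limits of
   (f (x + hu + hv) - f (x + hu) - f (x + hv) + f x) / h ^ 2. *)
Lemma second_difference f (W : set V) x u v (h : R) : 0 < h ->
  (forall z, W z -> derivable f z u /\ derivable ('D_u f : V -> R) z v) ->
  (forall s t, 0 <= s <= h -> 0 <= t <= h -> W (s *: u + (t *: v + x))) ->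
  exists s t, [/\ 0 <= s <= h, 0 <= t <= h &
    f (h *: u + (h *: v + x)) - f (h *: u + x) - f (h *: v + x) + f x
    = h ^+ 2 * 'D_v ('D_u f : V -> R) (s *: u + (t *: v + x))].
Proof.
move=> h0 dW hW.
have line (g : V -> R) (w y : V) (s : R) : derivable g (s *: w + y) w ->
    is_derive s 1 (fun s : R => g (s *: w + y)) ('D_w g (s *: w + y)).
  move=> dg.
  have E : (fun h0 : R => h0^-1 *: ((fun s : R => g (s *: w + y)) (h0 *: (1) + s)
      - g (s *: w + y))) = (fun h0 => h0^-1 *: (g (h0 *: w + (s *: w + y)) - g (s *: w + y))).
    by apply/funext => k; rewrite [k *: 1]mulr1 scalerDl addrA.
  by apply: DeriveDef; rewrite /derivable /derive E.
have h0' : 0 <= h <= h by rewrite (ltW h0) lexx.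
have z0' : 0 <= (0:R) <= h by rewrite (ltW h0) lexx.
have lineu s t : 0 <= s <= h -> 0 <= t <= h ->
    is_derive s 1 (fun s : R => f (s *: u + (t *: v + x)))
      ('D_u f (s *: u + (t *: v + x))).
  by move=> hs ht; apply: line; exact: (dW _ (hW _ _ hs ht)).1.
pose F := fun s : R => f (s *: u + (h *: v + x)) - f (s *: u + (0 *: v + x)).
have dF s : 0 <= s <= h -> is_derive s 1 F
    ('D_u f (s *: u + (h *: v + x)) - 'D_u f (s *: u + (0 *: v + x))).
  move=> hs; apply: is_deriveB; exact: lineu.
have [|s sh E1] := MVT h0 (fun s hs => dF s (ltac:(by move: hs; rewrite in_itv /= => /andP[/ltW-> /ltW->]))).
  apply: derivable_within_continuous => s; rewrite in_itv /= => hs.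
  by have [] := dF s hs.
have hs : 0 <= s <= h by move: sh; rewrite in_itv /= => /andP[/ltW-> /ltW->].
pose G := fun t : R => 'D_u f (t *: v + (s *: u + x)).
have dG t : 0 <= t <= h -> is_derive t 1 G
    ('D_v ('D_u f : V -> R) (t *: v + (s *: u + x))).
  by move=> ht; apply: line; rewrite addrCA; exact: (dW _ (hW _ _ hs ht)).2.
have [|t th E2] := MVT h0 (fun s hs => dG s (ltac:(by move: hs; rewrite in_itv /= => /andP[/ltW-> /ltW->]))).
  apply: derivable_within_continuous => t; rewrite in_itv /= => ht.
  by have [] := dG t ht.
have ht : 0 <= t <= h by move: th; rewrite in_itv /= => /andP[/ltW-> /ltW->].
exists s, t; split => //.
move: E1 E2; rewrite /F /G !subr0 !scale0r !add0r => E1 E2.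
rewrite -[f x]opprK opprK.
have -> : forall A B C D : R, A - B - C + D = A - B - (C - D) by move=> *; ring.
by rewrite E1 addrCA E2 addrCA; ring.
Qed.

Lemma derive_swap f (W : set V) x u v : open W -> W x ->
  (forall z, W z -> derivable f z u /\ derivable ('D_u f : V -> R) z v) ->
  (forall z, W z -> derivable f z v /\ derivable ('D_v f : V -> R) z u) ->
  {for x, continuous ('D_v ('D_u f : V -> R) : V -> R)} ->
  {for x, continuous ('D_u ('D_v f : V -> R) : V -> R)} ->
  'D_v ('D_u f : V -> R) x = 'D_u ('D_v f : V -> R) x.
Proof.
move=> oW Wx dW dW' c1 c2.
apply/eqP; rewrite -subr_eq0 -normr_le0; apply/ler_addgt0Pr => e e0; rewrite add0r.
have e20 : 0 < e / 2 by rewrite divr_gt0.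
have n1 : \forall z \near x, `|'D_v ('D_u f : V -> R) x - 'D_v ('D_u f : V -> R) z| < e / 2.
  by move/cvgrPdist_lt : c1; apply.
have n2 : \forall z \near x, `|'D_u ('D_v f : V -> R) x - 'D_u ('D_v f : V -> R) z| < e / 2.
  by move/cvgrPdist_lt : c2; apply.
have nW : \forall z \near x, W z by exact: open_nbhs_nbhs.
have [r /= r0 Hr] := (nbhs_ballP _ _).1 (filterI nW (filterI n1 n2)).
(* With this [h] the whole parallelogram spanned by h u and h v at [x] lies in the ball of radius
   [r]; the summand 1 keeps the denominator positive when u = v = 0. *)
pose h := r / (2 * (`|u| + `|v| + 1)).
have den0 : 0 < 2 * (`|u| + `|v| + 1).
  by rewrite mulr_gt0 // ltr_wpDl // addr_ge0.
have h0 : 0 < h by rewrite divr_gt0.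
have near s t : 0 <= s <= h -> 0 <= t <= h -> ball x r (s *: u + (t *: v + x)).
  move=> /andP[s0 sh] /andP[t0 th].
  rewrite -ball_normE /ball_ /= addrA opprD addrCA subrr addr0 normrN.
  apply: le_lt_trans (ler_normD _ _) _; rewrite !normrZ !ger0_norm //.
  apply: (@le_lt_trans _ _ (h * (`|u| + `|v| + 1))).
    rewrite mulrDr mulr1 mulrDr -[X in X <= _]addr0 lerD ?(ltW h0) //.
    by rewrite lerD // ler_wpM2r.
  rewrite /h invfM mulrA -mulrA mulVf ?mulr1; last first.
    by rewrite gt_eqF // ltr_wpDl // addr_ge0.
  by rewrite ltr_pdivrMr // mulr2n mulrDr mulr1 ltrDl.
have hW s t hs ht := (Hr _ (near s t hs ht)).1.
have hW' s t : 0 <= s <= h -> 0 <= t <= h -> W (s *: v + (t *: u + x)).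
  by move=> hs ht; rewrite addrCA; exact: hW.
have [s [t [hs ht E1]]] := second_difference h0 dW hW.
have [s' [t' [hs' ht' E2]]] := second_difference h0 dW' hW'.
have {E1 E2} : 'D_v ('D_u f : V -> R) (s *: u + (t *: v + x))
    = 'D_u ('D_v f : V -> R) (s' *: v + (t' *: u + x)).
  move: E1 E2; rewrite (addrCA (h *: v)).
  move: ('D_v _ (s *: u + _)) ('D_u _ (s' *: v + _)) (f _) (f _) (f _) => A B a b c.
  have h20 : h ^+ 2 != 0 by rewrite expf_neq0 // gt_eqF.
  by rewrite [X in X + _ = _ * B]addrAC => -> /(mulfI h20).
move=> E3.
have [_ [b1 _]] := Hr _ (near s t hs ht).
have [_ [_ ]] := Hr _ (near t' s' ht' hs').
rewrite (addrCA (t' *: u)) -E3 => b2.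
move: b1 b2; move: ('D_v _ (s *: u + _)) ('D_v _ x) ('D_u ('D_v f) x) => A B C.
clear -e0; move=> b1 b2; rewrite -(subrKA A) (le_trans (ler_normD _ _)) //.
by rewrite [leRHS]splitr lerD // ltW // distrC.
Qed.

End DirectionalDerivatives.

(** * Smooth functions of several variables *)

Section FiniteSums.
Context {R : comRingType} {n : nat}.
Implicit Types (T : 'I_n -> R).

Lemma sum_delta q T : \sum_l (q == l)%:R * T l = T q.
Proof.
rewrite (bigD1 q) //= eqxx mul1r big1 ?addr0 // => l /negPf.
by rewrite eq_sym => ->; rewrite mul0r.
Qed.

(** In index form: lowering an index undoes raising it, and conversely. *)
Lemma sum_mulmx1 (A B : 'M[R]_n) q T : A *m B = 1%:M ->
  \sum_k A q k * (\sum_l B k l * T l) = T q.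
Proof.
move=> AB; under eq_bigr do rewrite big_distrr /=.
rewrite exchange_big /= -[RHS]sum_delta; apply: eq_bigr => l _.
under eq_bigr do rewrite mulrA.
by rewrite -big_distrl /=; have /matrixP/(_ q l) := AB; rewrite !mxE => <-.
Qed.

End FiniteSums.

Section SmoothCalculus.
Context {R : realType} {n : nat}.

Notation dv j f := (@partial R n R j f).
Notation ev j := (delta_mx 0 j : 'rV[R]_n).
Implicit Types (U : set 'rV[R]_n) (x : 'rV[R]_n).

Lemma near_open_eq (W : Type) U x (f g : 'rV[R]_n -> W) :
  open U -> U x -> (forall z, U z -> f z = g z) -> {near x, f =1 g}.
Proof.
move=> oU Ux fg; have : \forall z \near x, U z by exact: open_nbhs_nbhs.
by apply: filterS => z; exact: fg.
Qed.

Lemma continuous_near_eq (W : normedModType R) x (f g : 'rV[R]_n -> W) :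
  {near x, f =1 g} -> {for x, continuous f} -> {for x, continuous g}.
Proof.
move=> fg; rewrite /prop_for /continuous_at -(nbhs_singleton fg) => fc.
exact: cvg_trans (near_eq_cvg fg) fc.
Qed.

Lemma Ck_eq (W : normedModType R) k U (f g : 'rV[R]_n -> W) :
  open U -> (forall z, U z -> f z = g z) -> Ck_on k U f -> Ck_on k U g.
Proof.
move=> oU; elim: k f g => [|k IH] f g fg /= [fc fd]; split.
- move=> x Ux; apply: continuous_near_eq (fc x Ux).
  exact: near_open_eq oU Ux fg.
- by [].
- move=> x Ux; apply: continuous_near_eq (fc x Ux).
  exact: near_open_eq oU Ux fg.
- move=> j; have [fj fj'] := fd j; split => [x Ux|].
    apply: near_eq_derivable (fj x Ux); exact: near_open_eq oU Ux fg.
  apply: IH fj' => z Uz; apply: near_eq_derive; exact: near_open_eq oU Uz fg.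
Qed.

Lemma Ck_entry p q k U (F : 'rV[R]_n -> 'M[R]_(p, q)) i j : open U ->
  Ck_on k U F -> Ck_on k U (fun z => F z i j : R).
Proof.
move=> oU; elim: k F => [|k IH] F /= [Fc Fd].
  split=> // x Ux; exact: (@continuous_comp _ _ _ F (fun A : 'M[R]_(p, q) => A i j) x (Fc x Ux) (@coord_continuous _ _ _ i j _)).
split=> [x Ux|l].
  exact: (@continuous_comp _ _ _ F (fun A : 'M[R]_(p, q) => A i j) x (Fc x Ux) (@coord_continuous _ _ _ i j _)).
have [Fl Fl'] := Fd l; split => [x Ux|].
  exact: ((derivable_mxP F x _).1 (Fl x Ux) i j).
apply: Ck_eq oU _ (IH _ Fl') => z Uz.
by rewrite /partial (derive_mx (Fl z Uz)) mxE.
Qed.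

Lemma Ck_continuous k U (f : 'rV[R]_n -> R) x :
  Ck_on k U f -> U x -> {for x, continuous f}.
Proof. by case: k => [|k] [fc _]; exact: fc. Qed.

Lemma Ck_derive k U (f : 'rV[R]_n -> R) j x :
  Ck_on k.+1 U f -> U x -> is_derive x (ev j) f (dv j f x).
Proof. by move=> [_ /(_ j)[fd _]] Ux; apply: derivableP; exact: fd. Qed.

Lemma Ck_partial k U (f : 'rV[R]_n -> R) j : Ck_on k.+1 U f -> Ck_on k U (dv j f).
Proof. by move=> [_ /(_ j)[]]. Qed.

Lemma partial_swap U (f : 'rV[R]_n -> R) i j x : open U -> U x ->
  Ck_on 2 U f -> dv i (dv j f) x = dv j (dv i f) x.
Proof.
move=> oU Ux f2; apply: (derive_swap oU Ux).
- move=> z Uz; split; first by have [] := Ck_derive j f2 Uz.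
  by have [] := Ck_derive i (Ck_partial j f2) Uz.
- move=> z Uz; split; first by have [] := Ck_derive i f2 Uz.
  by have [] := Ck_derive j (Ck_partial i f2) Uz.
- exact: Ck_continuous (Ck_partial i (Ck_partial j f2)) Ux.
- exact: Ck_continuous (Ck_partial j (Ck_partial i f2)) Ux.
Qed.

Lemma partial_near_eq U (f g : 'rV[R]_n -> R) j x : open U -> U x ->
  (forall z, U z -> f z = g z) -> dv j f x = dv j g x.
Proof. by move=> oU Ux fg; apply: near_eq_derive; exact: near_open_eq oU Ux fg. Qed.

Lemma is_derive_near_eq U (f g : 'rV[R]_n -> R) v x a : open U -> U x ->
  (forall z, U z -> f z = g z) -> is_derive x v f a -> is_derive x v g a.
Proof. by move=> oU Ux fg; apply: near_eq_is_derive; exact: near_open_eq oU Ux fg. Qed.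

Lemma is_derive_unique (f : 'rV[R]_n -> R) v x a b :
  is_derive x v f a -> is_derive x v f b -> a = b.
Proof. by move=> [_ <-] [_ <-]. Qed.

Lemma partialE (f : 'rV[R]_n -> R) j x a : is_derive x (ev j) f a -> dv j f x = a.
Proof. by move=> [_ <-]. Qed.

Lemma derivable_det p (F : 'rV[R]_n -> 'M[R]_p) x v :
  (forall i j, derivable (fun z => F z i j : R) x v) ->
  derivable (fun z => \det (F z) : R) x v.
Proof.
move=> dF; have dprod (s : 'S_p) :
    derivable (fun z => (-1) ^+ s * \prod_i F z i (s i) : R) x v.
  have dp : derivable (fun z => \prod_i F z i (s i) : R) x v.
    by apply: derivable_bigprod => i _; exact: dF.
  by have [] := is_derive_mul (is_derive_const ((-1) ^+ s) x v) (derivableP dp).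
have H : is_derive x v (fun z => \det (F z) : R)
    (\sum_(s : 'S_p) 'D_v (fun z => (-1) ^+ s * \prod_i F z i (s i) : R) x).
  by apply: is_derive_bigsum => s _; exact: derivableP.
by have [] := H.
Qed.

(** By Cramer's formula, valid on the open set [U], the entries of the inverse are cofactors divided
    by the determinant. *)
Lemma derivable_invmx p U (F : 'rV[R]_n -> 'M[R]_p) x v i j : open U -> U x ->
  (forall z, U z -> F z \in unitmx) ->
  (forall i j, derivable (fun z => F z i j : R) x v) ->
  derivable (fun z => invmx (F z) i j : R) x v.
Proof.
move=> oU Ux uF dF.
apply: (@near_eq_derivable _ _ _ (fun z => (\det (F z))^-1 * cofactor (F z) j i : R)).
  apply: near_open_eq oU Ux _ => z Uz.
  by rewrite /invmx uF // !mxE.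
apply: derivableM.
  apply: derivableV; last exact: derivable_det.
  by have := uF _ Ux; rewrite unitmxE unitfE.
apply: derivableM; first exact: derivable_cst.
apply: derivable_det => k l; rewrite (_ : (fun z => _) = (fun z => F z (lift j k) (lift i l))) //.
by apply/funext => z; rewrite !mxE.
Qed.

(** Derivability being known, the value comes from differentiating F^-1 F = 1. *)
Lemma is_derive_invmx p U (F : 'rV[R]_n -> 'M[R]_p) (dF : 'M[R]_p) x v i j :
  open U -> U x -> (forall z, U z -> F z \in unitmx) ->
  (forall i j, is_derive x v (fun z => F z i j : R) (dF i j)) ->
  is_derive x v (fun z => invmx (F z) i j : R)
    (- (invmx (F x) *m dF *m invmx (F x)) i j).
Proof.
move=> oU Ux uF hF.
pose E := \matrix_(i, j) 'D_v (fun z => invmx (F z) i j : R) x.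
have hE k l : is_derive x v (fun z => invmx (F z) k l : R) (E k l).
  rewrite mxE; apply: derivableP; apply: (derivable_invmx oU Ux uF) => a b.
  by have [] := hF a b.
have : E *m F x + invmx (F x) *m dF = 0.
  apply/matrixP => k l.
  have h1 : is_derive x v (fun z => \sum_a invmx (F z) k a * F z a l : R)
      (\sum_a (E k a * F x a l + invmx (F x) k a * dF a l)).
    by apply: is_derive_bigsum => a _; exact: is_derive_mul.
  have h2 : is_derive x v (fun z => \sum_a invmx (F z) k a * F z a l : R) 0.
    apply: (@is_derive_near_eq U (fun=> (1%:M : 'M[R]_p) k l)) => //.
      by move=> z Uz; rewrite -(mulVmx (uF z Uz)) mxE.
  by have := is_derive_unique h1 h2; rewrite big_split /= !mxE.
move/eqP; rewrite addr_eq0 => /eqP/(congr1 (mulmx^~ (invmx (F x)))).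
rewrite /= (mulmxK (uF _ Ux)) mulNmx => EE.
by have := hE i j; rewrite EE mxE.
Qed.

End SmoothCalculus.

(** * Levi-Civita connection and curvature *)

Section DoubleSums.
Context {R : realFieldType} {n : nat}.

Lemma sum2_antisym (F : 'I_n -> 'I_n -> R) :
  (forall m r, F m r = - F r m) -> \sum_m \sum_r F m r = 0.
Proof.
move=> aF; have : \sum_m \sum_r F m r = - \sum_m \sum_r F m r.
  rewrite {1}exchange_big /= -sumrN; apply: eq_bigr => m _.
  by rewrite -sumrN; apply: eq_bigr => r _; exact: aF.
by move=> ?; lra.
Qed.

(** [E u v a b] is the second derivative of h_ab, in the directions v and then u, after metric
    compatibility has been used twice, and [Rm] is the curvature. The difference of the two sides
    splits into a single sum that vanishes term by term and a double sum that is antisymmetric in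
    its two indices. *)
Lemma metric_second_derivative_swap (h : 'I_n -> 'I_n -> R)
    (G : 'I_n -> 'I_n -> 'I_n -> R) (dG : 'I_n -> 'I_n -> 'I_n -> 'I_n -> R) q i j k :
  (forall a b, h a b = h b a) -> (forall m a b, G m a b = G m b a) ->
  (forall u m a b, dG u m a b = dG u m b a) ->
  let E u v a b := \sum_m (dG u m v a * h m b + dG u m v b * h a m)
    + \sum_m \sum_r (G m v a * G r u m * h r b + G m v a * G r u b * h m r
       + G m v b * G r u a * h r m + G m v b * G r u m * h a r) in
  let Rm p i j k := dG j p i k - dG k p i j
    + \sum_m (G p j m * G m i k - G p k m * G m i j) in
  \sum_p h q p * Rm p i j k + \sum_p h i p * Rm p q j k = E j k q i - E k j q i.
Proof.
move=> hs Gs dGs /=.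
under eq_bigr do rewrite mulrDr big_distrr /=.
under [X in _ + X]eq_bigr do rewrite mulrDr big_distrr /=.
rewrite 2!big_split /=.
rewrite [X in _ + X + _ = _]exchange_big [X in _ + _ + (_ + X) = _]exchange_big /=.
rewrite opprD !addrA; apply/eqP; rewrite -subr_eq0; apply/eqP.
rewrite [LHS](_ : _ =
  \sum_m (h q m * (dG j m i k - dG k m i j) + h i m * (dG j m q k - dG k m q j)
    - (dG j m k q * h m i + dG j m k i * h q m)
    + (dG k m j q * h m i + dG k m j i * h q m))
  + \sum_m \sum_r (h q r * (G r j m * G m i k - G r k m * G m i j)
     + h i r * (G r j m * G m q k - G r k m * G m q j)
     - (G m k q * G r j m * h r i + G m k q * G r j i * h m r
       + G m k i * G r j q * h r m + G m k i * G r j m * h q r)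
     + (G m j q * G r k m * h r i + G m j q * G r k i * h m r
       + G m j i * G r k q * h r m + G m j i * G r k m * h q r))); last first.
  rewrite [\sum_m \sum_r _ in RHS](eq_bigr (fun m => \sum_r h q r * (G r j m * G m i k - G r k m * G m i j)
     + \sum_r h i r * (G r j m * G m q k - G r k m * G m q j)
     - \sum_r (G m k q * G r j m * h r i + G m k q * G r j i * h m r
       + G m k i * G r j q * h r m + G m k i * G r j m * h q r)
     + \sum_r (G m j q * G r k m * h r i + G m j q * G r k i * h m r
       + G m j i * G r k q * h r m + G m j i * G r k m * h q r))); last first.
    by move=> m _; rewrite -big_split -sumrB -big_split.
  by rewrite !(big_split, sumrN) /=; ring.
rewrite big1 ?add0r; last first.
  move=> m _; rewrite (hs m i) (dGs j m i k) (dGs k m i j) (dGs j m q k) (dGs k m q j); ring.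
apply: sum2_antisym => m r.
rewrite (hs r m) (hs r i) (hs m i) (Gs m i k) (Gs m i j) (Gs m q k) (Gs m q j).
rewrite (Gs r i k) (Gs r i j) (Gs r q k) (Gs r q j); ring.
Qed.

End DoubleSums.

Section LeviCivita.
Context {R : realType} {n : nat}.
Notation dv j f := (@partial R n R j f).
Notation ev j := (delta_mx 0 j : 'rV[R]_n).
Variables (U : set 'rV[R]_n) (g : 'rV[R]_n -> 'M[R]_n).
Hypotheses (oU : open U)
  (gC : forall i j, Ck_on 2 U (fun z => g z i j : R))
  (gsym : forall x i j, U x -> g x i j = g x j i)
  (gunit : forall x, U x -> g x \in unitmx).
Implicit Types (x y : 'rV[R]_n) (i j k l m p q : 'I_n).

Lemma christoffelE k i j x : christoffel g k i j x = 2^-1 * \sum_l ginv g x k l *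
    (dv i (fun z => g z j l) x + dv j (fun z => g z i l) x
     - dv l (fun z => g z i j) x).
Proof. by []. Qed.

Lemma riemannE i j k l x : riemann g i j k l x =
  dv k (christoffel g i j l) x - dv l (christoffel g i j k) x
  + \sum_m (christoffel g i k m x * christoffel g m j l x
            - christoffel g i l m x * christoffel g m j k x).
Proof. by []. Qed.

Lemma partial_sym k i j x : U x -> dv k (fun z => g z i j) x = dv k (fun z => g z j i) x.
Proof. by move=> Ux; apply: (partial_near_eq _ oU Ux) => z Uz; exact: gsym. Qed.

Lemma christoffel_sym k i j x : U x -> christoffel g k i j x = christoffel g k j i x.
Proof.
move=> Ux; rewrite !christoffelE; congr (_ * _); apply: eq_bigr => l _.
by rewrite (partial_sym _ i j Ux); congr (_ * _); ring.
Qed.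

Lemma ginv_mul x : U x -> g x *m ginv g x = 1%:M /\ ginv g x *m g x = 1%:M.
Proof. by move=> Ux; rewrite /ginv mulmxV ?mulVmx ?gunit. Qed.

Lemma ginv_sym x i j : U x -> ginv g x i j = ginv g x j i.
Proof.
move=> Ux; have gT : (g x)^T = g x by apply/matrixP => a b; rewrite mxE gsym.
by rewrite /ginv -[in LHS]gT -trmx_inv mxE.
Qed.

Lemma christoffel_lower q i j x : U x -> \sum_k g x q k * christoffel g k i j x
  = 2^-1 * (dv i (fun z => g z j q) x + dv j (fun z => g z i q) x
            - dv q (fun z => g z i j) x).
Proof.
move=> Ux; under eq_bigr do rewrite christoffelE mulrCA.
by rewrite -big_distrr /= (sum_mulmx1 _ _ (ginv_mul Ux).1).
Qed.

Lemma partial_metric k i j x : U x -> dv k (fun z => g z i j) x =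
  \sum_m (christoffel g m k i x * g x m j + christoffel g m k j x * g x i m).
Proof.
move=> Ux; rewrite big_split /=.
under eq_bigr do rewrite mulrC (gsym _ _ Ux).
rewrite christoffel_lower //.
under eq_bigr do rewrite mulrC.
rewrite christoffel_lower //.
rewrite (partial_sym k j i Ux); by field.
Qed.

(** Koszul's argument: substituting compatibility for the three metric derivatives in the
    Christoffel symbol, the symmetry of [A] cancels all but twice one term. Compatibility is asked
    at the single point [x], which lets a guessed tensor be tested pointwise. *)
Lemma levi_civita_unique (A : 'I_n -> 'I_n -> 'I_n -> R) x : U x ->
  (forall k i j, A k i j = A k j i) ->
  (forall k i j, dv k (fun z => g z i j) x =
     \sum_m (A m k i * g x m j + A m k j * g x i m)) ->
  forall k i j, christoffel g k i j x = A k i j.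
Proof.
move=> Ux As Ag k i j; rewrite christoffelE big_distrr /=.
rewrite -[RHS](sum_mulmx1 k (fun k => A k i j) (ginv_mul Ux).2).
apply: eq_bigr => l _; rewrite mulrCA; congr (_ * _).
rewrite !Ag -big_split -sumrB big_distrr /=; apply: eq_bigr => m _.
rewrite (As m j i) (As m l i) (As m l j) (gsym l m Ux) (gsym j m Ux); by field.
Qed.

Lemma is_derive_ginv v x i j : U x -> (forall k l, derivable (fun z => g z k l : R) x v) ->
  is_derive x v (fun z => ginv g z i j : R)
   (- (ginv g x *m (\matrix_(k, l) 'D_v (fun z => g z k l : R) x) *m ginv g x) i j).
Proof.
move=> Ux dg; apply: (is_derive_invmx _ _ oU Ux gunit) => k l.
by rewrite mxE; exact: derivableP.
Qed.

Lemma is_derive_ginv_partial k x i j : U x ->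
  is_derive x (ev k) (fun z => ginv g z i j : R)
   (- \sum_l (\sum_m ginv g x i m * dv k (fun z => g z m l) x) * ginv g x l j).
Proof.
move=> Ux; have := @is_derive_ginv (ev k) x i j Ux; set d := (X in is_derive _ _ _ X).
move=> H; suff -> : - \sum_l (\sum_m ginv g x i m * dv k (fun z => g z m l) x) * ginv g x l j = d.
  by apply: H => a b; have [] := Ck_derive k (gC a b) Ux.
rewrite /d mxE; congr (- _); apply: eq_bigr => l _; rewrite mxE; congr (_ * _).
by apply: eq_bigr => m _; rewrite mxE.
Qed.

(** The inverse metric is parallel; this is what allows an index to be raised under a covariant
    derivative. *)
Lemma partial_ginv k x i j : U x ->
  is_derive x (ev k) (fun z => ginv g z i j : R)
   (- \sum_m (christoffel g i k m x * ginv g x m j + christoffel g j k m x * ginv g x i m)).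
Proof.
move=> Ux; apply: is_derive_eq; first exact: is_derive_ginv_partial.
have E l : \sum_m ginv g x i m * dv k (fun z => g z m l) x =
    christoffel g i k l x + \sum_p (\sum_m ginv g x i m * christoffel g p k m x) * g x p l.
  under eq_bigr do rewrite partial_metric // big_split /= addrC mulrDr.
  rewrite big_split /=; congr (_ + _).
    under eq_bigr do under eq_bigr do rewrite mulrC.
    exact: (sum_mulmx1 _ (fun p => christoffel g p k l x) (ginv_mul Ux).2).
  under eq_bigr do rewrite big_distrr /=.
  rewrite exchange_big /=; apply: eq_bigr => p _; rewrite big_distrl /=.
  by apply: eq_bigr => m _; rewrite mulrA.
congr (- _); under eq_bigr do rewrite E mulrDl.
rewrite !big_split /=; congr (_ + _).
have H : \sum_i0 ginv g x j i0 * (\sum_p g x i0 p * (\sum_m ginv g x i m * christoffel g p k m x)) =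
  \sum_m ginv g x i m * christoffel g j k m x.
  exact: (sum_mulmx1 j (fun p => \sum_m ginv g x i m * christoffel g p k m x) (ginv_mul Ux).2).
under [RHS]eq_bigr do rewrite mulrC.
rewrite -H; apply: eq_bigr => l _; rewrite mulrC (ginv_sym _ _ Ux); congr (_ * _).
by apply: eq_bigr => p _; rewrite mulrC (gsym _ _ Ux).
Qed.

Lemma christoffel_derive l k i j x : U x ->
  is_derive x (ev l) (christoffel g k i j) (dv l (christoffel g k i j) x).
Proof.
move=> Ux.
have D a b c : is_derive x (ev l) (dv a (fun z => g z b c)) (dv l (dv a (fun z => g z b c)) x).
  exact: Ck_derive (Ck_partial _ (gC _ _)) Ux.
have [dG _] := is_derive_mul (is_derive_const (2^-1 : R) x (ev l))
  (is_derive_bigsum (index_enum 'I_n) (P := predT) (fun m _ => is_derive_mul (partial_ginv l k m Ux)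
     (is_derive_add (is_derive_add (D i j m) (D j i m)) (is_derive_opp (D m i j))))).
exact: (derivableP dG).
Qed.

Lemma first_bianchi p i j k x : U x ->
  riemann g p i j k x + riemann g p j k i x + riemann g p k i j x = 0.
Proof.
move=> Ux; rewrite !riemannE.
have S a b c : dv a (christoffel g p b c) x = dv a (christoffel g p c b) x.
  by apply: (partial_near_eq _ oU Ux) => z Uz; exact: christoffel_sym.
have C := fun m a b => @christoffel_sym m a b x Ux.
rewrite (S i j k) (S j k i) (S k i j).
move: (dv j _ x) (dv k _ x) (dv i _ x) => a b c.
move: (christoffel g) C {S} => G C.
rewrite [X in X = 0](_ : _ = \sum_m (G p j m x * G m i k x - G p k m x * G m i j x)
  + \sum_m (G p k m x * G m j i x - G p i m x * G m j k x)
  + \sum_m (G p i m x * G m k j x - G p j m x * G m k i x)); last by ring.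
rewrite -!big_split /=; apply: big1 => m _.
rewrite (C m j i) (C m k j) (C m k i); ring.
Qed.

(** The second partial derivatives of g_qi commute; expanding both orders through metric
    compatibility leaves exactly the two curvature terms. *)
Lemma riemann_lower_antisym q i j k x : U x ->
  \sum_p g x q p * riemann g p i j k x + \sum_p g x i p * riemann g p q j k x = 0.
Proof.
move=> Ux.
pose Gm := fun m k i => christoffel g m k i x.
have E u v a b : dv u (dv v (fun z => g z a b)) x =
    \sum_m (dv u (christoffel g m v a) x * g x m b + dv u (christoffel g m v b) x * g x a m)
    + \sum_m \sum_r (Gm m v a * Gm r u m * g x r b + Gm m v a * Gm r u b * g x m r
       + Gm m v b * Gm r u a * g x r m + Gm m v b * Gm r u m * g x a r).
  rewrite (partial_near_eq u oU Ux (fun z Uz => partial_metric v a b Uz)).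
  have dg c d : is_derive x (ev u) (fun z => g z c d : R) _ := Ck_derive u (gC c d) Ux.
  have := @is_derive_bigsum R _ _ (index_enum _) predT
     (fun m z => christoffel g m v a z * g z m b + christoffel g m v b z * g z a m) _ x (ev u)
     (fun m _ => is_derive_add
         (is_derive_mul (christoffel_derive u m v a Ux) (dg m b))
         (is_derive_mul (christoffel_derive u m v b Ux) (dg a m))).
  move=> /partialE ->; rewrite -big_split /=; apply: eq_bigr => m _.
  rewrite !partial_metric //; move: (dv u _ x) (dv u _ x) => d1 d2.
  rewrite /Gm; move: (christoffel g) => G.
  rewrite addrACA; congr (_ + _).
  rewrite !big_distrr -big_split /=; apply: eq_bigr => r _; ring.
have := partial_swap j k oU Ux (gC q i); rewrite !E => /eqP; rewrite -subr_eq0 => /eqP H.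
rewrite -[RHS]H.
under eq_bigr do rewrite riemannE.
under [X in _ + X]eq_bigr do rewrite riemannE.
apply: (metric_second_derivative_swap (h := fun a b => g x a b) (G := Gm)
  (dG := fun u m a b => dv u (christoffel g m a b) x)).
- by move=> a b; exact: gsym.
- by move=> m a b; exact: christoffel_sym.
- by move=> u m a b; apply: (partial_near_eq _ oU Ux) => z Uz; exact: christoffel_sym.
Qed.

End LeviCivita.

(** * Ricci curvature of a connection plus a tensor *)

Section RicciForm.
Context {R : realFieldType} {n : nat}.
Implicit Types (A C : 'I_n -> 'I_n -> 'I_n -> R) (y : 'I_n -> R)
  (dA dC : 'I_n -> 'I_n -> 'I_n -> 'I_n -> R).

(* [A k i j] are the coefficients of a connection at a point and [dA l k i j]
   their derivatives in the direction [l]. *)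
Definition ricci_form A dA y : R :=
  \sum_k \sum_j \sum_l (dA k k j l - dA l k j k
    + \sum_m (A k k m * A m j l - A k l m * A m j k)) * y j * y l.

Definition conn_trace A m : R := \sum_k A k k m.
Definition conn_quad A y k : R := \sum_j \sum_l A k j l * y j * y l.
Definition conn_mx A y k m : R := \sum_l A k l m * y l.

Lemma sum_rotate (F : 'I_n -> 'I_n -> 'I_n -> R) :
  \sum_j \sum_l \sum_m F m j l = \sum_m \sum_j \sum_l F m j l.
Proof.
under eq_bigr do rewrite exchange_big /=.
by rewrite exchange_big.
Qed.

Lemma ricci_formE A dA y : ricci_form A dA y =
  \sum_k \sum_j \sum_l dA k k j l * y j * y l
  - \sum_k \sum_j \sum_l dA l k j k * y j * y l
  + \sum_m conn_trace A m * conn_quad A y m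
  - \sum_k \sum_m conn_mx A y k m * conn_mx A y m k.
Proof.
have -> : \sum_m conn_trace A m * conn_quad A y m =
    \sum_k \sum_m A k k m * conn_quad A y m.
  rewrite exchange_big /=; apply: eq_bigr => m _.
  by rewrite /conn_trace big_distrl.
rewrite -!(sumrB, big_split) /=; apply: eq_bigr => k _.
rewrite /ricci_form.
have -> : \sum_m A k k m * conn_quad A y m =
    \sum_j \sum_l \sum_m A k k m * A m j l * y j * y l.
  rewrite sum_rotate; apply: eq_bigr => m _; rewrite /conn_quad big_distrr /=.
  apply: eq_bigr => j _; rewrite big_distrr /=; apply: eq_bigr => l _.
  by rewrite !mulrA.
have -> : \sum_m conn_mx A y k m * conn_mx A y m k =
    \sum_j \sum_l \sum_m A k l m * A m j k * y j * y l.
  rewrite sum_rotate; apply: eq_bigr => m _; rewrite /conn_mx big_distrlr /=.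
  rewrite exchange_big; apply: eq_bigr => j _; apply: eq_bigr => l _; ring.
rewrite -!(sumrB, big_split) /=; apply: eq_bigr => j _.
rewrite -!(sumrB, big_split) /=; apply: eq_bigr => l _.
rewrite mulrDl mulrDl big_distrl big_distrl /=.
rewrite -[RHS]addrA.
rewrite -sumrB; congr (_ + _); first by ring.
by apply: eq_bigr => m _; ring.
Qed.

Lemma conn_traceD A C m :
  conn_trace (fun k i j => A k i j + C k i j) m = conn_trace A m + conn_trace C m.
Proof. exact: big_split. Qed.

Lemma conn_quadD A C y m :
  conn_quad (fun k i j => A k i j + C k i j) y m = conn_quad A y m + conn_quad C y m.
Proof.
rewrite -big_split; apply: eq_bigr => j _; rewrite -big_split.
by apply: eq_bigr => l _; rewrite !mulrDl.
Qed.

Lemma conn_mxD A C y k m :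
  conn_mx (fun k i j => A k i j + C k i j) y k m = conn_mx A y k m + conn_mx C y k m.
Proof. by rewrite -big_split; apply: eq_bigr => l _; rewrite mulrDl. Qed.

(** The quadratic part of the curvature is bilinear in the connection. The cross terms between [A]
    and [C] isolated here are the ones that later turn the partial derivatives of [C] into covariant
    derivatives. *)
Lemma ricci_formD A C dA dC y :
  ricci_form (fun k i j => A k i j + C k i j)
             (fun u k i j => dA u k i j + dC u k i j) y
  = ricci_form A dA y
  + \sum_k \sum_j \sum_l dC k k j l * y j * y l
  - \sum_k \sum_j \sum_l dC l k j k * y j * y l
  + \sum_m conn_trace A m * conn_quad C y m
  + \sum_m conn_trace C m * conn_quad A y m
  + \sum_m conn_trace C m * conn_quad C y m
  - 2 * (\sum_k \sum_m conn_mx A y k m * conn_mx C y m k)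
  - \sum_k \sum_m conn_mx C y k m * conn_mx C y m k.
Proof.
rewrite !ricci_formE.
have H (d d' : 'I_n -> 'I_n -> 'I_n -> R) :
    \sum_k \sum_j \sum_l (d k j l + d' k j l) * y j * y l =
    \sum_k \sum_j \sum_l d k j l * y j * y l + \sum_k \sum_j \sum_l d' k j l * y j * y l.
  rewrite -big_split; apply: eq_bigr => k _; rewrite -big_split.
  apply: eq_bigr => j _; rewrite -big_split; apply: eq_bigr => l _.
  by rewrite !mulrDl.
rewrite (H (fun k j l => dA k k j l)) (H (fun k j l => dA l k j k)).
have -> : \sum_m conn_trace (fun k i j => A k i j + C k i j) m *
      conn_quad (fun k i j => A k i j + C k i j) y m =
    \sum_m conn_trace A m * conn_quad A y m + \sum_m conn_trace A m * conn_quad C y m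
    + \sum_m conn_trace C m * conn_quad A y m + \sum_m conn_trace C m * conn_quad C y m.
  rewrite -!big_split; apply: eq_bigr => m _ /=.
  rewrite conn_traceD conn_quadD; ring.
have -> : \sum_k \sum_m conn_mx (fun k i j => A k i j + C k i j) y k m *
      conn_mx (fun k i j => A k i j + C k i j) y m k =
    \sum_k \sum_m conn_mx A y k m * conn_mx A y m k
    + \sum_k \sum_m conn_mx A y k m * conn_mx C y m k
    + \sum_k \sum_m conn_mx C y k m * conn_mx A y m k
    + \sum_k \sum_m conn_mx C y k m * conn_mx C y m k.
  rewrite -!big_split; apply: eq_bigr => k _ /=.
  rewrite -!big_split; apply: eq_bigr => m _ /=.
  rewrite !conn_mxD; ring.
have -> : \sum_k \sum_m conn_mx C y k m * conn_mx A y m k =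
    \sum_k \sum_m conn_mx A y k m * conn_mx C y m k.
  rewrite exchange_big; apply: eq_bigr => k _; apply: eq_bigr => m _.
  exact: mulrC.
ring.
Qed.

End RicciForm.

Section ParallelExtension.
Context {R : realType} {n : nat}.
Notation dv j f := (@partial R n R j f).
Notation ev j := (delta_mx 0 j : 'rV[R]_n).
Variables (A : 'I_n -> 'I_n -> 'I_n -> R) (x : 'rV[R]_n) (y : 'I_n -> R).
Hypothesis Asym : forall k i j, A k i j = A k j i.

(* The affine extension of the vector [y] at [x] that is parallel at [x], which
   turns partial derivatives at [x] into covariant ones. *)
Definition parallel_ext (m : 'I_n) (z : 'rV[R]_n) : R :=
  y m - \sum_k conn_mx A y m k * (z 0 k - x 0 k).

Lemma parallel_ext_at m : parallel_ext m x = y m.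
Proof. by rewrite /parallel_ext big1 ?subr0 // => k _; rewrite subrr mulr0. Qed.

Lemma is_derive_coord (k j : 'I_n) (z : 'rV[R]_n) :
  is_derive z (ev k) (fun z : 'rV[R]_n => z 0 j : R) (k == j)%:R.
Proof.
apply: DeriveDef; first exact: (@diff_derivable _ _ _ _ _ _ (differentiable_coord z 0 j)).
have /matrixP/(_ 0 j) := @derive_mx R _ 1 n (fun z : 'rV[R]_n => z) z (ev k) (@derivable_id _ _ _ _).
by rewrite derive_id !mxE /= => <-; rewrite ?eqxx /= eq_sym.
Qed.

Lemma is_derive_parallel_ext m k :
  is_derive x (ev k) (parallel_ext m) (- conn_mx A y m k).
Proof.
have := is_derive_add (is_derive_const (y m) x (ev k)) (is_derive_opp
  (is_derive_bigsum (index_enum 'I_n) (P := predT) (fun l _ => is_derive_mul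
     (is_derive_const (conn_mx A y m l) x (ev k))
     (is_derive_add (is_derive_coord k l x) (is_derive_const (- x 0 l) x (ev k)))))).
move=> H; apply: (is_derive_eq H).
rewrite add0r; congr (- _); rewrite -[RHS]sum_delta; apply: eq_bigr => l _.
by rewrite mul0r add0r addr0 mulrC.
Qed.

Variables (C : 'I_n -> 'I_n -> 'I_n -> 'rV[R]_n -> R)
  (dA dC : 'I_n -> 'I_n -> 'I_n -> 'I_n -> R).
Hypotheses (Csym : forall k i j, C k i j x = C k j i x)
  (CD : forall u k i j, is_derive x (ev u) (C k i j) (dC u k i j)).

Let Cx k i j := C k i j x.
Let quad k z := \sum_j \sum_l C k j l z * parallel_ext j z * parallel_ext l z.
Let trace z := \sum_j (\sum_k C k j k z) * parallel_ext j z.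

(** With the vector extended parallel at [x], the divergence of C(Y,Y) and the derivative of (tr
    C)(Y) absorb all cross terms of [ricci_formD]. [Q] and [T] are closed forms of these two
    quantities near [x], so they can be differentiated in place of the components of [C]. *)
Lemma ricci_form_difference (V : set 'rV[R]_n) (Q : 'I_n -> 'rV[R]_n -> R)
    (T : 'rV[R]_n -> R) dQ dT :
  open V -> V x ->
  (forall k z, V z -> \sum_j \sum_l C k j l z * parallel_ext j z * parallel_ext l z = Q k z) ->
  (forall z, V z -> \sum_j (\sum_k C k j k z) * parallel_ext j z = T z) ->
  (forall k, is_derive x (ev k) (Q k) (dQ k)) ->
  (forall k, is_derive x (ev k) T (dT k)) ->
  ricci_form (fun k i j => A k i j + Cx k i j)
             (fun u k i j => dA u k i j + dC u k i j) y
  = ricci_form A dA y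
  + (\sum_k dQ k + \sum_m conn_trace A m * Q m x)
  - \sum_l y l * dT l
  + \sum_m conn_trace Cx m * Q m x
  - \sum_k \sum_m conn_mx Cx y k m * conn_mx Cx y m k.
Proof.
move=> oV Vx QE TE QD TD; rewrite ricci_formD.
have Qx m : Q m x = conn_quad Cx y m.
  rewrite -QE //; apply: eq_bigr => j _; apply: eq_bigr => l _.
  by rewrite !parallel_ext_at.
(* Each of the two factors [parallel_ext] contributes the same cross term, by the symmetry of [C];
   [E1] and [E2] are the two ways of writing it. *)
have dQE k : dQ k = \sum_j \sum_l dC k k j l * y j * y l
    - 2 * \sum_m conn_mx A y m k * conn_mx Cx y k m.
  have H : is_derive x (ev k) (quad k)
     (\sum_j \sum_l ((dC k k j l * parallel_ext j x + C k j l x * - conn_mx A y j k)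
        * parallel_ext l x + (C k j l x * parallel_ext j x) * - conn_mx A y l k)).
    apply: is_derive_bigsum => j _; apply: is_derive_bigsum => l _.
    apply: is_derive_mul; last exact: is_derive_parallel_ext.
    by apply: is_derive_mul => //; exact: is_derive_parallel_ext.
  have H' := is_derive_near_eq oV Vx (QE k) H.
  rewrite (is_derive_unique (QD k) H') {H H'}.
  have E1 : \sum_m conn_mx A y m k * conn_mx Cx y k m =
      \sum_j \sum_l C k j l x * conn_mx A y j k * y l.
    apply: eq_bigr => j _; rewrite /conn_mx big_distrr /=; apply: eq_bigr => l _.
    by rewrite /Cx (Csym k l j); ring.
  have E2 : \sum_m conn_mx A y m k * conn_mx Cx y k m =
      \sum_j \sum_l C k j l x * y j * conn_mx A y l k.
    rewrite exchange_big; apply: eq_bigr => j _; rewrite /conn_mx big_distrr /=.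
    by apply: eq_bigr => l _; rewrite /Cx; ring.
  rewrite [2]mulr2n mulrDl mul1r {1}E1 E2 opprD addrA -!sumrB.
  apply: eq_bigr => j _; rewrite -!sumrB; apply: eq_bigr => l _.
  by rewrite !parallel_ext_at; ring.
have dTE l : dT l = \sum_j (\sum_k dC l k j k) * y j - \sum_j conn_trace Cx j * conn_mx A y j l.
  have H : is_derive x (ev l) trace
     (\sum_j ((\sum_k dC l k j k) * parallel_ext j x + (\sum_k C k j k x) * - conn_mx A y j l)).
    apply: is_derive_bigsum => j _; apply: is_derive_mul; last exact: is_derive_parallel_ext.
    by apply: is_derive_bigsum => k _.
  have H' := is_derive_near_eq oV Vx TE H.
  rewrite (is_derive_unique (TD l) H') -sumrB; apply: eq_bigr => j _.
  rewrite parallel_ext_at mulrN; congr (_ - _ * _); apply: eq_bigr => k _.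
  by rewrite /Cx Csym.
have -> : \sum_k \sum_j \sum_l dC l k j k * y j * y l = \sum_l y l * \sum_j (\sum_k dC l k j k) * y j.
  rewrite exchange_big /=; under eq_bigr do rewrite exchange_big /=.
  rewrite exchange_big /=; apply: eq_bigr => l _; rewrite big_distrr /=.
  apply: eq_bigr => j _; rewrite big_distrl big_distrr /=; apply: eq_bigr => k _; ring.
have -> : \sum_l y l * dT l = \sum_l y l * (\sum_j (\sum_k dC l k j k) * y j)
    - \sum_m conn_trace Cx m * conn_quad A y m.
  have -> : \sum_m conn_trace Cx m * conn_quad A y m =
      \sum_l y l * \sum_j conn_trace Cx j * conn_mx A y j l.
    under [RHS]eq_bigr do rewrite big_distrr /=.
    rewrite exchange_big; apply: eq_bigr => m _ /=.
    rewrite /conn_quad exchange_big big_distrr /=; apply: eq_bigr => l _.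
    rewrite /conn_mx !big_distrr /=; apply: eq_bigr => j _; ring.
  by rewrite -sumrB; apply: eq_bigr => l _; rewrite dTE mulrBr.
have -> : \sum_k dQ k = \sum_k \sum_j \sum_l dC k k j l * y j * y l
    - 2 * \sum_k \sum_m conn_mx A y k m * conn_mx Cx y m k.
  rewrite [X in _ - 2 * X]exchange_big big_distrr -sumrB /=; apply: eq_bigr => k _.
  by rewrite dQE.
under [\sum_m conn_trace A m * Q m x]eq_bigr do rewrite Qx.
under [\sum_m conn_trace Cx m * Q m x]eq_bigr do rewrite Qx.
ring.
Qed.

End ParallelExtension.

(** * Killing forms *)

Section CovariantDerivatives.
Context {R : realType} {n : nat}.
Notation dv j f := (@partial R n R j f).
Notation ev j := (delta_mx 0 j : 'rV[R]_n).
Variables (U : set 'rV[R]_n) (g : 'rV[R]_n -> 'M[R]_n).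
Hypotheses (oU : open U)
  (gC : forall i j, Ck_on 2 U (fun z => g z i j : R))
  (gsym : forall x i j, U x -> g x i j = g x j i)
  (gunit : forall x, U x -> g x \in unitmx).
Implicit Types (x : 'rV[R]_n) (i j k l m p q : 'I_n) (y : 'I_n -> R).

Definition gamma x k i j := christoffel g k i j x.

(** The covariant derivative of a 1-form whose partial derivatives [dw] are given as data. The
    direction of differentiation is the first index here, the second in [cov]. *)
Definition cov_form x (w : 'I_n -> R) (dw : 'I_n -> 'I_n -> R) k i : R :=
  dw k i - \sum_m gamma x m k i * w m.

(** Since the inverse metric is parallel, raising the index commutes with covariant differentiation;
    the remaining term is the Christoffel term of a vector field, which cancels in a divergence. *)
Lemma is_derive_raise x (w : 'I_n -> 'rV[R]_n -> R) dw k i : U x ->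
  (forall i, is_derive x (ev k) (w i) (dw k i)) ->
  is_derive x (ev k) (fun z => \sum_j ginv g z i j * w j z)
   (\sum_j ginv g x i j * cov_form x (w^~ x) dw k j
    - \sum_m gamma x i k m * (\sum_j ginv g x m j * w j x)).
Proof.
move=> Ux wD.
have H := is_derive_bigsum (index_enum 'I_n) (P := predT) (fun j _ => is_derive_mul
  (partial_ginv oU gC gsym gunit k i j Ux) (wD j)).
apply: (is_derive_eq H).
have E1 : \sum_m gamma x i k m * (\sum_j ginv g x m j * w j x) =
    \sum_j (\sum_m gamma x i k m * ginv g x m j) * w j x.
  under eq_bigr do rewrite big_distrr /=.
  rewrite exchange_big; apply: eq_bigr => j _; rewrite big_distrl /=.
  by apply: eq_bigr => m _; rewrite mulrA.
have E2 : \sum_j ginv g x i j * (\sum_m gamma x m k j * w m x) =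
    \sum_j (\sum_m gamma x j k m * ginv g x i m) * w j x.
  under eq_bigr do rewrite big_distrr /=.
  rewrite exchange_big; apply: eq_bigr => j _; rewrite big_distrl /=.
  by apply: eq_bigr => m _; rewrite mulrA (mulrC (ginv _ _ _ _)).
under [in RHS]eq_bigr do rewrite /cov_form mulrBr.
rewrite sumrB E2 E1 -!sumrB; apply: eq_bigr => j _.
by rewrite big_split /= /gamma; ring.
Qed.

Lemma divergence_raise x (w : 'I_n -> 'rV[R]_n -> R) dw : U x ->
  \sum_k (\sum_j ginv g x k j * cov_form x (w^~ x) dw k j
    - \sum_m gamma x k k m * (\sum_j ginv g x m j * w j x))
  + \sum_m conn_trace (gamma x) m * (\sum_j ginv g x m j * w j x)
  = \sum_k \sum_j ginv g x k j * cov_form x (w^~ x) dw k j.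
Proof.
move=> Ux; rewrite sumrB -addrA -[RHS]addr0; congr (_ + _).
rewrite exchange_big /= addrC; apply/eqP; rewrite subr_eq0; apply/eqP.
by apply: eq_bigr => m _; rewrite /conn_trace big_distrl.
Qed.

(** The Christoffel term of the 1-form cancels against the derivative of the parallel extension, so
    a scalar is differentiated in place of a tensor. *)
Lemma is_derive_pairing x (w : 'I_n -> 'rV[R]_n -> R) dw k y : U x ->
  (forall i, is_derive x (ev k) (w i) (dw k i)) ->
  is_derive x (ev k) (fun z => \sum_i w i z * parallel_ext (gamma x) x y i z)
   (\sum_i cov_form x (w^~ x) dw k i * y i).
Proof.
move=> Ux wD.
have H := is_derive_bigsum (index_enum 'I_n) (P := predT) (fun j _ => is_derive_mul
  (wD j) (is_derive_parallel_ext (gamma x) x y j k)).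
apply: (is_derive_eq H).
under [RHS]eq_bigr do rewrite /cov_form mulrBl.
rewrite big_split sumrB /=; congr (_ + _).
  by apply: eq_bigr => i _; rewrite parallel_ext_at.
under eq_bigr do rewrite mulrN; rewrite sumrN; congr (- _).
under [RHS]eq_bigr do rewrite big_distrl /=.
rewrite exchange_big; apply: eq_bigr => i _; rewrite /conn_mx big_distrr /=.
apply: eq_bigr => l _; rewrite /gamma (christoffel_sym oU gsym _ l k Ux); ring.
Qed.

Lemma is_derive_metric_pairing x k y : U x ->
  is_derive x (ev k) (fun z => \sum_i \sum_j g z i j
    * parallel_ext (gamma x) x y i z * parallel_ext (gamma x) x y j z) 0.
Proof.
move=> Ux.
have H := is_derive_bigsum (index_enum 'I_n) (P := predT) (fun i _ =>
  is_derive_bigsum (index_enum 'I_n) (P := predT) (fun j _ => is_derive_mul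
  (is_derive_mul (Ck_derive k (gC i j) Ux) (is_derive_parallel_ext (gamma x) x y i k))
   (is_derive_parallel_ext (gamma x) x y j k))).
apply: (is_derive_eq H).
under eq_bigr do under eq_bigr do
  rewrite !parallel_ext_at (partial_metric oU gsym gunit) // mulrDl -addrA.
under eq_bigr do rewrite big_split /=.
rewrite big_split /=.
have -> : \sum_i \sum_j (\sum_m (christoffel g m k i x * g x m j +
      christoffel g m k j x * g x i m)) * y i * y j =
    \sum_i \sum_j g x i j * y j * conn_mx (gamma x) y i k
    + \sum_i \sum_j g x i j * y i * conn_mx (gamma x) y j k.
  have -> : \sum_i \sum_j g x i j * y j * conn_mx (gamma x) y i k =
      \sum_i \sum_j \sum_m christoffel g m k i x * g x m j * y i * y j.
    rewrite sum_rotate; apply: eq_bigr => m _; rewrite exchange_big.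
    apply: eq_bigr => j _; rewrite /conn_mx big_distrr /=; apply: eq_bigr => i _.
    by rewrite /gamma (christoffel_sym oU gsym _ i k Ux); ring.
  have -> : \sum_i \sum_j g x i j * y i * conn_mx (gamma x) y j k =
      \sum_i \sum_j \sum_m christoffel g m k j x * g x i m * y i * y j.
    apply: eq_bigr => i _; rewrite exchange_big; apply: eq_bigr => m _.
    rewrite /conn_mx big_distrr /=; apply: eq_bigr => j _.
    by rewrite /gamma (christoffel_sym oU gsym _ j k Ux); ring.
  rewrite -big_split; apply: eq_bigr => i _; rewrite -big_split.
  apply: eq_bigr => j _; rewrite big_split !mulrDl !big_distrl -!big_split /=.
  by [].
rewrite -!big_split big1 // => i _; rewrite -!big_split big1 // => j _ /=.
ring.
Qed.

End CovariantDerivatives.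

Section KillingForms.
Context {R : realType} {n : nat}.
Notation dv j f := (@partial R n R j f).
Notation ev j := (delta_mx 0 j : 'rV[R]_n).
Variables (U : set 'rV[R]_n) (g : 'rV[R]_n -> 'M[R]_n) (b : 'rV[R]_n -> 'rV[R]_n).
Hypotheses (oU : open U)
  (gC : forall i j, Ck_on 2 U (fun z => g z i j : R))
  (gsym : forall x i j, U x -> g x i j = g x j i)
  (gunit : forall x, U x -> g x \in unitmx)
  (bC : forall i, Ck_on 2 U (fun z => b z 0 i : R))
  (bK : forall x i j, U x -> cov g b i j x + cov g b j i x = 0).
Implicit Types (x : 'rV[R]_n) (i j k l m p q : 'I_n) (y : 'I_n -> R).

Lemma covE i j x : cov g b i j x =
  dv j (fun z => b z 0 i) x - \sum_k christoffel g k i j x * b x 0 k.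
Proof. by []. Qed.

Lemma cov_antisym i j x : U x -> cov g b i j x = - cov g b j i x.
Proof. by move=> /(bK i j)/eqP; rewrite addr_eq0 => /eqP. Qed.

Lemma s_ijE i j x : U x -> s_ij g b i j x = cov g b i j x.
Proof. by move=> Ux; rewrite /s_ij (cov_antisym j i Ux) opprK; by field. Qed.

Lemma cov_form_b k i x : U x ->
  cov_form g x (fun i => b x 0 i) (fun k i => dv k (fun z => b z 0 i) x) k i = cov g b i k x.
Proof.
move=> Ux; rewrite covE /cov_form; congr (_ - _); apply: eq_bigr => m _.
by rewrite /gamma (christoffel_sym oU gsym _ i k Ux).
Qed.

Lemma cov_derive i j k x : U x -> is_derive x (ev k) (cov g b i j) (dv k (cov g b i j) x).
Proof.
move=> Ux.
have [dc _] := is_derive_add (Ck_derive k (Ck_partial j (bC i)) Ux)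
  (is_derive_opp (is_derive_bigsum (index_enum 'I_n) (P := predT) (fun m _ =>
     is_derive_mul (christoffel_derive oU gC gsym gunit k m i j Ux) (Ck_derive k (bC m) Ux)))).
exact: (derivableP dc).
Qed.

(** b_{i|j|k}, the index [k] being the direction of the last differentiation. *)
Definition cov2 i j k x : R := dv k (cov g b i j) x
  - \sum_m gamma g x m k i * cov g b m j x - \sum_m gamma g x m k j * cov g b i m x.

Lemma cov2_antisym i j k x : U x -> cov2 i j k x = - cov2 j i k x.
Proof.
move=> Ux; have dS : dv k (cov g b i j) x = - dv k (cov g b j i) x.
  rewrite (partial_near_eq k oU Ux (fun z Uz => cov_antisym i j Uz)).
  exact: partialE (is_derive_opp (cov_derive j i k Ux)).
have S a c : cov g b a c x = - cov g b c a x by exact: cov_antisym.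
rewrite /cov2 dS; move: (dv k _ x) => d.
move: (cov g b) S (gamma g x) => c S G.
rewrite (eq_bigr (fun m => - (G m k i * c j m x))) => [|m _]; last by rewrite S mulrN.
rewrite [X in _ - X = _](eq_bigr (fun m => - (G m k j * c m i x))) => [|m _]; last by rewrite S mulrN.
by rewrite !sumrN; ring.
Qed.

(** The Ricci identity for 1-forms in the sign convention of [riemann]: the second partials of b
    commute, and the products of a Christoffel symbol with a first partial of b are symmetric in j
    and k. *)
Lemma cov2_comm i j k x : U x ->
  cov2 i j k x - cov2 i k j x = \sum_p b x 0 p * riemann g p i j k x.
Proof.
move=> Ux.
have E u v : cov2 i u v x = dv v (dv u (fun z => b z 0 i)) x
    - \sum_m (dv v (christoffel g m i u) x * b x 0 m
        + christoffel g m i u x * dv v (fun z => b z 0 m) x)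
    - \sum_m gamma g x m v i * dv u (fun z => b z 0 m) x
    + \sum_m \sum_k gamma g x m v i * christoffel g k m u x * b x 0 k
    - \sum_m gamma g x m v u * cov g b i m x.
  rewrite /cov2; congr (_ - _).
  have H := is_derive_add (Ck_derive v (Ck_partial u (bC i)) Ux)
    (is_derive_opp (is_derive_bigsum (index_enum 'I_n) (P := predT) (fun m _ =>
     is_derive_mul (christoffel_derive oU gC gsym gunit v m i u Ux) (Ck_derive v (bC m) Ux)))).
  rewrite (partialE H) -[RHS]addrA; congr (_ + _).
  rewrite -sumrN -sumrN -big_split; apply: eq_bigr => m _ /=.
  rewrite covE mulrBr opprB addrC big_distrr /=; congr (_ - _).
  by apply: eq_bigr => l _; rewrite mulrA.
have S : \sum_m gamma g x m k j * cov g b i m x = \sum_m gamma g x m j k * cov g b i m x.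
  by apply: eq_bigr => m _; rewrite /gamma (christoffel_sym oU gsym _ k j Ux).
rewrite !E (partial_swap k j oU Ux (bC i)) S {S E}.
have -> : \sum_p b x 0 p * riemann g p i j k x =
    \sum_p (dv j (christoffel g p i k) x - dv k (christoffel g p i j) x) * b x 0 p
    + (\sum_m \sum_p gamma g x m k i * christoffel g p m j x * b x 0 p
       - \sum_m \sum_p gamma g x m j i * christoffel g p m k x * b x 0 p).
  rewrite [X in _ = _ + (X - _)]exchange_big [X in _ = _ + (_ - X)]exchange_big /=.
  rewrite -sumrB -big_split; apply: eq_bigr => p _ /=.
  rewrite riemannE mulrDr mulrC; congr (_ + _); rewrite big_distrr -sumrB.
  apply: eq_bigr => m _ /=; rewrite /gamma.
  rewrite (christoffel_sym oU gsym m k i Ux) (christoffel_sym oU gsym m j i Ux).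
  rewrite (christoffel_sym oU gsym p m j Ux) (christoffel_sym oU gsym p m k Ux).
  move: (christoffel g) => G; ring.
have S u v : \sum_m (dv v (christoffel g m i u) x * b x 0 m
        + christoffel g m i u x * dv v (fun z => b z 0 m) x) =
    \sum_m dv v (christoffel g m i u) x * b x 0 m
    + \sum_m gamma g x m u i * dv v (fun z => b z 0 m) x.
  rewrite -big_split; apply: eq_bigr => m _.
  by rewrite /gamma (christoffel_sym oU gsym _ u i Ux).
rewrite (S k j) (S j k) {S} /gamma.
have -> : \sum_p (dv j (christoffel g p i k) x - dv k (christoffel g p i j) x) * b x 0 p =
    \sum_p dv j (christoffel g p i k) x * b x 0 p
    - \sum_p dv k (christoffel g p i j) x * b x 0 p.
  by rewrite -sumrB; apply: eq_bigr => p _; rewrite mulrBl.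
move: (dv _ _ x) => d.
move: (christoffel g) => G; ring.
Qed.

(** The [c] are the cyclic permutations of b_{i|j|k}, the [d] the same with the first two indices
    exchanged, the [r] the curvature terms. Antisymmetry turns the Ricci identities into c1 + c3 =
    r1, c1 + c2 = r2 and c2 + c3 = r3; the Bianchi identity r1 + r2 + r3 = 0 makes c1 + c2 + c3
    vanish, so c1 = - (c2 + c3) = - r3. *)
Lemma cyclic_antisym (c1 c2 c3 d1 d2 d3 r1 r2 r3 : R) :
  r1 + r2 + r3 = 0 -> c1 - d3 = r1 -> c2 - d1 = r2 -> c3 - d2 = r3 ->
  c1 = - d1 -> c2 = - d2 -> c3 = - d3 -> c1 = - r3.
Proof. by move=> *; lra. Qed.

Lemma cov2_killing i j k x : U x ->
  cov2 i j k x = - \sum_p b x 0 p * riemann g p k i j x.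
Proof.
move=> Ux.
have B : \sum_p b x 0 p * riemann g p i j k x + \sum_p b x 0 p * riemann g p j k i x
    + \sum_p b x 0 p * riemann g p k i j x = 0.
  rewrite -!big_split big1 // => p _ /=.
  by rewrite -!mulrDr (first_bianchi oU gsym) // mulr0.
exact: (cyclic_antisym B (cov2_comm i j k Ux) (cov2_comm j k i Ux)
  (cov2_comm k i j Ux) (cov2_antisym i j k Ux) (cov2_antisym j k i Ux)
  (cov2_antisym k i j Ux)).
Qed.

Lemma is_derive_bup i k x : U x -> is_derive x (ev k) (bup g b i)
  (\sum_j ginv g x i j * cov g b j k x - \sum_m gamma g x i k m * bup g b m x).
Proof.
move=> Ux.
have H := is_derive_raise oU gC gsym gunit (w := fun i z => b z 0 i)
  (dw := fun k i => dv k (fun z => b z 0 i) x) (k := k) i Ux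
  (fun i => Ck_derive k (bC i) Ux).
apply: (is_derive_eq H); congr (_ - _); apply: eq_bigr => j _.
by rewrite cov_form_b.
Qed.

Lemma s_iE i x : U x -> s_i g b i x = \sum_m bup g b m x * cov g b m i x.
Proof. by move=> Ux; apply: eq_bigr => m _; rewrite s_ijE. Qed.

(** The covariant derivative of s in the direction [k], by the Leibniz rule for s_i = b^m
    b_{m|i}. *)
Definition cov_s k i x : R := \sum_m (\sum_j ginv g x m j * cov g b j k x) * cov g b m i x
  + \sum_m bup g b m x * cov2 m i k x.

Lemma is_derive_s_i i k x : U x ->
  is_derive x (ev k) (s_i g b i) (cov_s k i x + \sum_m gamma g x m k i * s_i g b m x).
Proof.
move=> Ux.
apply: (is_derive_near_eq oU Ux (f := fun z => \sum_m bup g b m z * cov g b m i z)).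
  by move=> z Uz; rewrite s_iE.
have H := is_derive_bigsum (index_enum 'I_n) (P := predT) (fun m _ =>
  is_derive_mul (is_derive_bup m k Ux) (cov_derive m i k Ux)).
apply: (is_derive_eq H).
have E1 : \sum_m gamma g x m k i * s_i g b m x =
    \sum_m bup g b m x * (\sum_l gamma g x l k i * cov g b m l x).
  under eq_bigr do rewrite (s_iE _ Ux) big_distrr /=.
  rewrite exchange_big; apply: eq_bigr => m _; rewrite big_distrr /=.
  by apply: eq_bigr => l _; rewrite mulrCA.
have E2 : \sum_m (\sum_l gamma g x m k l * bup g b l x) * cov g b m i x =
    \sum_m bup g b m x * (\sum_l gamma g x l k m * cov g b l i x).
  under eq_bigr do rewrite big_distrl /=.
  rewrite exchange_big; apply: eq_bigr => m _; rewrite big_distrr /=.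
  by apply: eq_bigr => l _; rewrite mulrAC mulrC.
have -> : \sum_(m | predT m) ((\sum_j ginv g x m j * cov g b j k x
      - \sum_l gamma g x m k l * bup g b l x) * cov g b m i x
      + bup g b m x * dv k (cov g b m i) x) =
    \sum_m (\sum_j ginv g x m j * cov g b j k x) * cov g b m i x
    - \sum_m (\sum_l gamma g x m k l * bup g b l x) * cov g b m i x
    + \sum_m bup g b m x * dv k (cov g b m i) x.
  by rewrite -sumrB -big_split; apply: eq_bigr => m _; rewrite mulrBl.
rewrite /cov_s E1 E2 -!addrA; congr (_ + _).
rewrite -!sumrN -!big_split; apply: eq_bigr => m _ /=; rewrite /cov2; ring.
Qed.

Lemma cov_form_s x k i : cov_form g x (fun i => s_i g b i x)
  (fun k i => cov_s k i x + \sum_m gamma g x m k i * s_i g b m x) k i = cov_s k i x.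
Proof. by rewrite /cov_form addrK. Qed.

(** The square of [blen] without the square root, so that differentiating it requires no sign
    condition. *)
Definition norm2 x : R := \sum_i bup g b i x * b x 0 i.

Lemma is_derive_norm2 k x : U x -> is_derive x (ev k) norm2 (2 * s_i g b k x).
Proof.
move=> Ux.
have H := is_derive_bigsum (index_enum 'I_n) (P := predT) (fun m _ =>
  is_derive_mul (is_derive_bup m k Ux) (Ck_derive k (bC m) Ux)).
apply: (is_derive_eq H).
have E1 : \sum_i (\sum_j ginv g x i j * cov g b j k x) * b x 0 i = s_i g b k x.
  rewrite s_iE //; under eq_bigr do rewrite big_distrl /=.
  rewrite exchange_big; apply: eq_bigr => j _; rewrite /bup big_distrl /=.
  by apply: eq_bigr => i _; rewrite (ginv_sym gsym) //; ring.
have E2 : \sum_i bup g b i x * dv k (fun z => b z 0 i) x = s_i g b k x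
    + \sum_i (\sum_m gamma g x i k m * bup g b m x) * b x 0 i.
  have -> : \sum_i (\sum_m gamma g x i k m * bup g b m x) * b x 0 i =
      \sum_i bup g b i x * (\sum_m gamma g x m k i * b x 0 m).
    under eq_bigr do rewrite big_distrl /=.
    rewrite exchange_big; apply: eq_bigr => j _; rewrite big_distrr /=.
    by apply: eq_bigr => i _; ring.
  rewrite s_iE // -big_split; apply: eq_bigr => i _ /=.
  rewrite -mulrDr covE; congr (_ * _).
  rewrite [X in _ = _ + X](eq_bigr (fun m => christoffel g m i k x * b x 0 m)) ?subrK // => m _.
  by rewrite /gamma (christoffel_sym oU gsym _ k i Ux).
rewrite big_split /= E2; under eq_bigr do rewrite mulrBl.
rewrite sumrB E1; ring.
Qed.

(** Only the second index is contracted with the parallel vector; the free index [m] keeps its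
    Christoffel term, which is removed when that index is raised. *)
Lemma is_derive_s_pairing x m k y : U x ->
  is_derive x (ev k) (fun z => \sum_j cov g b m j z * parallel_ext (gamma g x) x y j z)
   (\sum_j cov2 m j k x * y j + \sum_l gamma g x l k m * \sum_j cov g b l j x * y j).
Proof.
move=> Ux.
have H := @is_derive_pairing R n U g oU gsym x (fun j => cov g b m j)
  (fun k j => dv k (cov g b m j) x) k y Ux (fun j => cov_derive m j k Ux).
apply: (is_derive_eq H).
have -> : \sum_l gamma g x l k m * (\sum_j cov g b l j x * y j) =
    \sum_j (\sum_l gamma g x l k m * cov g b l j x) * y j.
  under eq_bigr do rewrite big_distrr /=.
  rewrite exchange_big; apply: eq_bigr => j _; rewrite big_distrl /=.
  by apply: eq_bigr => l _; rewrite mulrA.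
rewrite -big_split; apply: eq_bigr => j _ /=; rewrite /cov2 /cov_form; ring.
Qed.

End KillingForms.

(** * Algebra of beta, s and s_ij at a point *)

Section PointAlgebra.
Context {R : realFieldType} {n : nat}.
Implicit Types (u : 'cV[R]_n) (v : 'rV[R]_n) (A : 'M[R]_n).

Definition pr v u : R := (v *m u) 0 0.

Lemma prE v u : v *m u = (pr v u)%:M.
Proof. by rewrite [LHS]mx11_scalar. Qed.

Lemma prDl v v' u : pr (v + v') u = pr v u + pr v' u.
Proof. by rewrite /pr mulmxDl mxE. Qed.

Lemma prDr v u u' : pr v (u + u') = pr v u + pr v u'.
Proof. by rewrite /pr mulmxDr mxE. Qed.

Lemma prZl c v u : pr (c *: v) u = c * pr v u.
Proof. by rewrite /pr -scalemxAl mxE. Qed.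

Lemma prZr c v u : pr v (c *: u) = c * pr v u.
Proof. by rewrite /pr -scalemxAr mxE. Qed.

Lemma prNl v u : pr (- v) u = - pr v u.
Proof. by rewrite /pr mulNmx mxE. Qed.

Lemma prNr v u : pr v (- u) = - pr v u.
Proof. by rewrite /pr mulmxN mxE. Qed.

Lemma pr0r v : pr v 0 = 0.
Proof. by rewrite /pr mulmx0 mxE. Qed.

Lemma pr_tr v u : pr v u = pr u^T v^T.
Proof. by rewrite /pr -trmx_mul [RHS]mxE. Qed.

Lemma prA v A u : pr (v *m A) u = pr v (A *m u).
Proof. by rewrite /pr mulmxA. Qed.

Definition pr_linear := (prDl, prDr, prNl, prNr, prZl, prZr).

Lemma mxtrace_rank1 u v : \tr (u *m v) = pr v u.
Proof. by rewrite mxtrace_mulC prE mxtrace_scalar. Qed.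

(** The endomorphism C_y is a simple matrix plus a few terms of rank one; for such a matrix the
    trace of the square reduces to finitely many pairings. *)
Lemma mxtrace_sq_rank1_sum (I : finType) A (u : I -> 'cV[R]_n) (v : I -> 'rV[R]_n) :
  let B := A + \sum_i u i *m v i in
  \tr (B *m B) = \tr (A *m A) + 2 * \sum_i pr (v i) (A *m u i)
    + \sum_i \sum_j pr (v i) (u j) * pr (v j) (u i).
Proof.
move=> /=; rewrite mulmxDl !mulmxDr !raddfD /=.
rewrite [X in _ + (X + _) = _]mxtrace_mulC.
have -> : \tr (A *m (\sum_i u i *m v i)) = \sum_i pr (v i) (A *m u i).
  rewrite mulmx_sumr raddf_sum; apply: eq_bigr => i _ /=.
  by rewrite mulmxA mxtrace_rank1.
have -> : \tr ((\sum_i u i *m v i) *m (\sum_i u i *m v i)) =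
    \sum_i \sum_j pr (v i) (u j) * pr (v j) (u i).
  rewrite mulmx_suml raddf_sum; apply: eq_bigr => i _ /=.
  rewrite mulmx_sumr raddf_sum; apply: eq_bigr => j _ /=.
  rewrite -mulmxA (mulmxA (v i)) prE mul_scalar_mx -scalemxAr mxtraceZ.
  by rewrite mxtrace_rank1.
ring.
Qed.

Lemma pr_antisym A v : A^T = - A -> pr v (A *m v^T) = 0.
Proof.
move=> AT; have : pr v (A *m v^T) = - pr v (A *m v^T).
  by rewrite {1}pr_tr trmx_mul trmxK AT mulmxN prNl prA.
by move=> ?; lra.
Qed.

Lemma pr_sym A v v' : A^T = A -> pr v (A *m v'^T) = pr v' (A *m v^T).
Proof. by move=> AT; rewrite pr_tr trmx_mul trmxK AT prA. Qed.

Lemma rank1_mul v v' u : (v^T *m v') *m u = pr v' u *: v^T.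
Proof. by rewrite -mulmxA prE scalar_mxC mul_scalar_mx. Qed.

Variables (g G S : 'M[R]_n) (b s y : 'rV[R]_n) (a mu t w : R).
Hypotheses (gG : g *m G = 1%:M) (Gg : G *m g = 1%:M)
  (GT : G^T = G) (ST : S^T = - S)
  (sE : s = b *m G *m S) (tE : t = pr b (G *m b^T))
  (wE : w = a ^+ 2 - mu * t) (w0 : w != 0)
  (SS : S *m G *m S = - a ^+ 2 *: g + mu *: (b^T *m b) + (mu / w) *: (s^T *m s)).

Let al := pr y (g *m y^T).
Let be := pr b y^T.
Let si := pr s y^T.
Let N := G *m S.
(** [S] is the matrix of b_{i|j} and [N] the endomorphism obtained by raising its first index. The
    vectors [u0], [u1], [u2], [u3] are y, s and b with raised index, and N y. Their span is stable
    under [N], so every contraction below can be read off from the action of [N] on them. *)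
Let u0 := y^T.
Let u1 := G *m s^T.
Let u2 := G *m b^T.
Let u3 := N *m y^T.

Lemma GSG_skew : (G *m S *m G)^T = - (G *m S *m G).
Proof. by rewrite !trmx_mul GT ST mulNmx mulmxN mulmxA. Qed.

Lemma sT : s^T = - (S *m u2).
Proof. by rewrite sE !trmx_mul GT ST mulNmx. Qed.

Lemma N_u2 : N *m u2 = - u1.
Proof. by rewrite /u1 sT mulmxN opprK /N -mulmxA. Qed.

Lemma pr_b_u1 : pr b u1 = 0.
Proof.
have := pr_antisym b GSG_skew; rewrite -(mulmxA (G *m S)) -/u2 -/N N_u2 prNr.
by move/eqP; rewrite oppr_eq0 => /eqP.
Qed.

Lemma pr_b_u2 : pr b u2 = t. Proof. by []. Qed.

Lemma pr_b_u3 : pr b u3 = si.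
Proof. by rewrite /u3 /N /si sE -prA mulmxA. Qed.

Lemma pr_s_u2 : pr s u2 = 0.
Proof. by rewrite /u2 (pr_sym _ _ GT) pr_b_u1. Qed.

Lemma SGS_mul u : S *m (N *m u) =
  - a ^+ 2 *: (g *m u) + (mu * pr b u) *: b^T + (mu / w * pr s u) *: s^T.
Proof.
rewrite /N !mulmxA SS !mulmxDl -!scalemxAl !rank1_mul !scalerA.
by [].
Qed.

Lemma N_N u : N *m (N *m u) = - a ^+ 2 *: u + (mu * pr b u) *: u2 + (mu / w * pr s u) *: u1.
Proof.
rewrite -[N in LHS]/(G *m S) -mulmxA SGS_mul !mulmxDr -!scalemxAr mulmxA Gg mul1mx.
by [].
Qed.

Lemma N_u1 : N *m u1 = w *: u2.
Proof.
have -> : u1 = - (N *m u2) by rewrite N_u2 opprK.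
rewrite mulmxN N_N pr_b_u2 pr_s_u2 mulr0 scale0r addr0 -scalerDl -scaleNr wE.
by congr (_ *: _); ring.
Qed.

Lemma pr_s_u1 : pr s u1 = w * t.
Proof. by rewrite {1}sE -mulmxA prA -/N N_u1 prZr pr_b_u2. Qed.

Lemma S_u1 : S *m u1 = w *: b^T.
Proof.
have := congr1 (mulmx g) N_u1.
by rewrite /N -!mulmxA (mulmxA g) gG mul1mx /u2 -scalemxAr (mulmxA g) gG mul1mx.
Qed.

Lemma pr_y_b : pr y b^T = be. Proof. by rewrite pr_tr trmxK. Qed.

Lemma pr_y_s : pr y s^T = si. Proof. by rewrite pr_tr trmxK. Qed.

Lemma pr_yS_u1 : pr (y *m S) u1 = w * be.
Proof. by rewrite prA S_u1 prZr pr_y_b. Qed.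

Lemma pr_yS_u2 : pr (y *m S) u2 = - si.
Proof. by rewrite prA -pr_y_s sT prNr opprK. Qed.

Lemma pr_s_u3 : pr s u3 = - (w * be).
Proof.
rewrite -pr_yS_u1 /u3 /N /u1 pr_tr !trmx_mul trmxK ST GT.
by rewrite mulNmx mulmxN prNl -!prA -!mulmxA.
Qed.

Lemma N_u3 : N *m u3 = - a ^+ 2 *: u0 + (mu * be) *: u2 + (mu / w * si) *: u1.
Proof. exact: N_N. Qed.

Lemma pr_yg_u0 : pr (y *m g) u0 = al. Proof. by rewrite prA. Qed.

Lemma pr_yg_u1 : pr (y *m g) u1 = si.
Proof. by rewrite prA /u1 mulmxA gG mul1mx pr_tr trmxK. Qed.

Lemma pr_yg_u2 : pr (y *m g) u2 = be.
Proof. by rewrite prA /u2 mulmxA gG mul1mx pr_tr trmxK. Qed.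

Lemma pr_yg_u3 : pr (y *m g) u3 = 0.
Proof. by rewrite prA /u3 /N !mulmxA gG mul1mx (pr_antisym _ ST). Qed.

Lemma norm_Sy : pr (y *m S^T) u3 = a ^+ 2 * al - mu * be ^+ 2 - mu / w * si ^+ 2.
Proof.
rewrite ST mulmxN prNl prA SGS_mul !pr_linear -/al -/be -/si.
rewrite pr_y_b pr_y_s; ring.
Qed.

Lemma pr_yS_u3 : pr (y *m S) u3 = - (a ^+ 2 * al - mu * be ^+ 2 - mu / w * si ^+ 2).
Proof. by rewrite -norm_Sy ST mulmxN prNl opprK. Qed.

Lemma tr_N : \tr N = 0.
Proof.
have : \tr N = - \tr N.
  by rewrite -{1}mxtrace_tr /N trmx_mul GT ST mulNmx raddfN /= mxtrace_mulC.
by move=> ?; lra.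
Qed.

(** The two rank-one terms of [SS] have traces mu t and (mu / w) (w t), whence the factor 2. *)
Lemma tr_NN : \tr (N *m N) = - n%:R * a ^+ 2 + 2 * mu * t.
Proof.
have -> : N *m N = - a ^+ 2 *: 1%:M + (mu *: (u2 *m b) + (mu / w) *: (u1 *m s)).
  rewrite /N -!mulmxA [S *m _]mulmxA SS !mulmxDr -!scalemxAr Gg -addrA.
  by rewrite /u1 /u2 !mulmxA.
rewrite !raddfD /= !mxtraceZ mxtrace1 !mxtrace_rank1 pr_b_u2 pr_s_u1.
by field.
Qed.

Variables (P Q K r : R).

Definition difference_mx : 'M[R]_n := (P * si)%:M + (- (K * be)) *: N
  + u0 *m (P *: s) + u1 *m ((Q * be) *: b - P *: (y *m g))
  + u2 *m ((r * si) *: b + (r * be) *: s) + u3 *m (- K *: b).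

Lemma difference_mxE k m : difference_mx k m =
  P * si * (k == m)%:R + - (K * be) * N k m + y 0 k * (P * s 0 m)
  + u1 k 0 * (Q * be * b 0 m - P * (y *m g) 0 m)
  + u2 k 0 * (r * si * b 0 m + r * be * s 0 m) + u3 k 0 * (- K * b 0 m).
Proof.
have r1 (u : 'cV[R]_n) (v : 'rV[R]_n) : (u *m v) k m = u k 0 * v 0 m.
  by rewrite mxE big_ord1.
have ad (A B : 'M[R]_n) : (A + B) k m = A k m + B k m by rewrite mxE.
have zE c (v : 'rV[R]_n) : (c *: v) 0 m = c * v 0 m by rewrite mxE.
have sE' (v v' : 'rV[R]_n) : (v - v') 0 m = v 0 m - v' 0 m by rewrite !mxE.
have dE (v v' : 'rV[R]_n) : (v + v') 0 m = v 0 m + v' 0 m by rewrite mxE.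
have nE c (B : 'M[R]_n) : (c *: B) k m = c * B k m by rewrite mxE.
have iE c : (c%:M : 'M[R]_n) k m = c * (k == m)%:R by rewrite mxE mulr_natr.
by rewrite /difference_mx !ad !r1 nE iE !zE sE' dE !zE [u0 k 0]mxE.
Qed.

Lemma tr_difference_sq : \tr (difference_mx *m difference_mx) =
  n%:R * P ^+ 2 * si ^+ 2 + K ^+ 2 * be ^+ 2 * (- n%:R * a ^+ 2 + 2 * mu * t)
  + (4 * K * P * w - 2 * K * Q * w * t + 2 * K * r * w * t - 2 * K ^+ 2 * w) * be ^+ 2
  + (2 * P * r * t - 2 * P * K) * si ^+ 2
  + (2 * P ^+ 2 + r ^+ 2 * t ^+ 2 + K ^+ 2) * si ^+ 2
  + 2 * P * w * t * (Q * be ^+ 2 - P * al) + 2 * P * K * w * be ^+ 2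
  + 2 * r * w * t * (Q * t - P) * be ^+ 2 - 2 * K * r * t * si ^+ 2
  + 2 * K * r * w * t * be ^+ 2.
Proof.
pose c1 := P * si; pose c2 := - (K * be).
pose v0 := P *: s; pose v1 := (Q * be) *: b - P *: (y *m g).
pose v2 := (r * si) *: b + (r * be) *: s; pose v3 := - K *: b.
pose u (i : 'I_4) := nth u0 [:: u0; u1; u2; u3] i.
pose v (i : 'I_4) := nth v0 [:: v0; v1; v2; v3] i.
have -> : difference_mx = (c1%:M + c2 *: N) + \sum_i u i *m v i.
  by rewrite !big_ord_recl big_ord0 /u /v /= addr0 !addrA.
rewrite mxtrace_sq_rank1_sum.
have -> : \tr ((c1%:M + c2 *: N) *m (c1%:M + c2 *: N)) =
    c1 ^+ 2 * n%:R + c2 ^+ 2 * \tr (N *m N).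
  rewrite mulmxDl !mulmxDr !raddfD /= -scalar_mxM mxtrace_scalar.
  rewrite mul_scalar_mx mul_mx_scalar -scalemxAl -scalemxAr !mxtraceZ tr_N.
  by rewrite mulr_natr; ring.
have E i : pr (v i) ((c1%:M + c2 *: N) *m u i) = c1 * pr (v i) (u i) + c2 * pr (v i) (N *m u i).
  by rewrite mulmxDl prDr mul_scalar_mx prZr -scalemxAl prZr.
under eq_bigr do rewrite E.
rewrite !big_ord_recl !big_ord0 /u /v /= tr_NN.
rewrite N_u3 N_u2 N_u1 -/u3 !pr_linear.
rewrite pr_b_u1 pr_b_u2 pr_b_u3 pr_s_u1 pr_s_u2 pr_s_u3.
rewrite pr_yg_u0 pr_yg_u1 pr_yg_u2 pr_yg_u3 -/be -/si.
(* The relation between a, w, mu and t is eliminated, so that a pure polynomial identity remains. *)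
have -> : a ^+ 2 = w + mu * t by rewrite wE; ring.
rewrite /c1 /c2; ring.
Qed.

End PointAlgebra.

(** * Contractions of the curvature *)

Section Polarization.
Context {R : realFieldType} {n : nat}.

Definition qform (B : 'I_n -> 'I_n -> R) (y : 'I_n -> R) := \sum_i \sum_j B i j * y i * y j.

Lemma qformE (B : 'I_n -> 'I_n -> R) (y : 'I_n -> R) i j (c d : R) :
  (forall k, y k = c * (i == k)%:R + d * (j == k)%:R) ->
  qform B y = c ^+ 2 * B i i + c * d * (B i j + B j i) + d ^+ 2 * B j j.
Proof.
move=> yE.
have E k : \sum_l B k l * y k * y l = y k * (c * B k i + d * B k j).
  rewrite (eq_bigr (fun l => c * y k * ((i == l)%:R * B k l) + d * y k * ((j == l)%:R * B k l))).
    by rewrite big_split /= -!big_distrr /= !sum_delta; ring.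
  by move=> l _; rewrite (yE l); ring.
rewrite /qform; under eq_bigr do rewrite E.
rewrite (eq_bigr (fun k => c * ((i == k)%:R * (c * B k i + d * B k j))
    + d * ((j == k)%:R * (c * B k i + d * B k j)))).
  by rewrite big_split /= -!big_distrr /= !sum_delta; ring.
by move=> k _; rewrite yE; ring.
Qed.

Lemma qform_polar (B C : 'I_n -> 'I_n -> R) : (forall y, qform B y = qform C y) ->
  forall i j, B i j + B j i = C i j + C j i.
Proof.
move=> BC i j.
have E c d : c ^+ 2 * B i i + c * d * (B i j + B j i) + d ^+ 2 * B j j =
    c ^+ 2 * C i i + c * d * (C i j + C j i) + d ^+ 2 * C j j.
  pose y k : R := c * (i == k)%:R + d * (j == k)%:R.
  by rewrite -!(@qformE _ y).
have := E 1 1; have := E 1 0; have := E 0 1.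
by move=> H1 H2 H3; lra.
Qed.

Lemma qform_polar_sym (B C : 'I_n -> 'I_n -> R) : (forall y, qform B y = qform C y) ->
  (forall i j, B i j = B j i) -> (forall i j, C i j = C j i) ->
  forall i j, B i j = C i j.
Proof.
move=> /qform_polar BC Bs Cs i j; have := BC i j.
by rewrite (Bs j i) (Cs j i) => ?; lra.
Qed.

(** A quadratic form determines only the symmetric part of its matrix, and the symmetric [G] sees
    only that part; the trace is thus available without knowing that [B] is symmetric. *)
Lemma qform_trace (G B C : 'I_n -> 'I_n -> R) : (forall y, qform B y = qform C y) ->
  (forall i j, G i j = G j i) ->
  \sum_i \sum_j G i j * B i j = \sum_i \sum_j G i j * C i j.
Proof.
move=> /qform_polar BC Gs.
have E (D : 'I_n -> 'I_n -> R) : 2 * (\sum_i \sum_j G i j * D i j) =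
    \sum_i \sum_j G i j * (D i j + D j i).
  rewrite [2]mulr2n mulrDl mul1r {2}exchange_big /= -big_split.
  apply: eq_bigr => i _; rewrite -big_split; apply: eq_bigr => j _ /=.
  by rewrite (Gs j i) mulrDr.
have : 2 * (\sum_i \sum_j G i j * B i j) = 2 * (\sum_i \sum_j G i j * C i j).
  by rewrite !E; apply: eq_bigr => i _; apply: eq_bigr => j _; rewrite BC.
by move/mulfI; apply; rewrite pnatr_eq0.
Qed.

Lemma sum_reverse (F : 'I_n -> 'I_n -> 'I_n -> R) :
  \sum_k \sum_m \sum_q F k m q = \sum_q \sum_m \sum_k F k m q.
Proof.
rewrite exchange_big; under eq_bigr do rewrite exchange_big /=.
by rewrite exchange_big.
Qed.

End Polarization.

Section KillingCurvature.
Context {R : realType} {n : nat}.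
Variables (U : set 'rV[R]_n) (g : 'rV[R]_n -> 'M[R]_n) (b : 'rV[R]_n -> 'rV[R]_n).
Hypotheses (oU : open U)
  (gC : forall i j, Ck_on 2 U (fun z => g z i j : R))
  (gsym : forall x i j, U x -> g x i j = g x j i)
  (gunit : forall x, U x -> g x \in unitmx)
  (bC : forall i, Ck_on 2 U (fun z => b z 0 i : R))
  (bK : forall x i j, U x -> cov g b i j x + cov g b j i x = 0).
Implicit Types (x : 'rV[R]_n) (i j k l m p q : 'I_n).

Lemma riemann_antisym i j k l x : riemann g i j k l x = - riemann g i j l k x.
Proof.
rewrite !riemannE; move: (christoffel g) => G.
rewrite opprD opprB -sumrN; congr (_ + _); apply: eq_bigr => m _; ring.
Qed.

Lemma bup_lower p x : U x -> \sum_q g x p q * bup g b q x = b x 0 p.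
Proof. by move=> Ux; exact: (sum_mulmx1 p (fun j => b x 0 j) (ginv_mul gunit Ux).1). Qed.

(** The bilinear form b_p b^m R^p_{kmi}, whose quadratic form is R_bb by [RbbE]. *)
Definition bcurv k i x : R :=
  \sum_m bup g b m x * (\sum_p b x 0 p * riemann g p k m i x).

Lemma cov2_contract i k x : U x -> \sum_m bup g b m x * cov2 g b m i k x = - bcurv k i x.
Proof.
move=> Ux; rewrite /bcurv -sumrN; apply: eq_bigr => m _.
by rewrite (cov2_killing oU gC gsym gunit bC bK) // mulrN.
Qed.

Lemma RbbE x y : Rbb g b x y = qform (fun j l => bcurv j l x) (y 0).
Proof.
rewrite /Rbb /riem /qform /bcurv.
transitivity (\sum_p \sum_m \sum_j \sum_l bup g b m x * (b x 0 p * riemann g p j m l x) * y 0 j * y 0 l).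
  apply: eq_bigr => p _; apply: eq_bigr => m _; rewrite !big_distrl /=.
  by apply: eq_bigr => j _; rewrite !big_distrl; apply: eq_bigr => l _ /=; ring.
rewrite exchange_big /=.
transitivity (\sum_m \sum_j \sum_p \sum_l
    bup g b m x * (b x 0 p * riemann g p j m l x) * y 0 j * y 0 l).
  by apply: eq_bigr => m _; rewrite exchange_big.
rewrite exchange_big; apply: eq_bigr => j _ /=.
transitivity (\sum_m \sum_l \sum_p
    bup g b m x * (b x 0 p * riemann g p j m l x) * y 0 j * y 0 l).
  by apply: eq_bigr => m _; rewrite exchange_big.
rewrite exchange_big; apply: eq_bigr => l _ /=.
rewrite !big_distrl /=; apply: eq_bigr => m _; rewrite big_distrr !big_distrl /=.
by apply: eq_bigr => p _.
Qed.

Lemma b_riemann k m i x : U x -> \sum_p b x 0 p * riemann g p k m i x =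
  \sum_q bup g b q x * (\sum_p g x q p * riemann g p k m i x).
Proof.
move=> Ux; under eq_bigr do rewrite -(bup_lower _ Ux) big_distrl /=.
rewrite exchange_big; apply: eq_bigr => q _; rewrite big_distrr /=.
by apply: eq_bigr => p _; rewrite (gsym p q Ux); ring.
Qed.

(** b enters twice through the first two indices of the lowered curvature, which is antisymmetric in
    them. *)
Lemma bup_bcurv i x : U x -> \sum_k bup g b k x * bcurv k i x = 0.
Proof.
move=> Ux; rewrite /bcurv.
under eq_bigr do rewrite big_distrr /=.
rewrite exchange_big big1 // => m _ /=.
rewrite (eq_bigr (fun k => \sum_q bup g b m x * (bup g b k x * bup g b q x
    * (\sum_p g x q p * riemann g p k m i x)))); last first.
  move=> k _; rewrite b_riemann // !big_distrr /=; apply: eq_bigr => q _; ring.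
apply: sum2_antisym => k q.
have /eqP := riemann_lower_antisym oU gC gsym gunit q k m i Ux.
rewrite addr_eq0 => /eqP ->; move: (bigop _ _ _) => z; ring.
Qed.

Definition ricci_tensor j l x : R := \sum_k riemann g k j k l x.

Lemma ricci_qform x y : ricci g x y = qform (fun j l => ricci_tensor j l x) (y 0).
Proof.
rewrite /ricci /riem /qform /ricci_tensor exchange_big; apply: eq_bigr => j _ /=.
rewrite exchange_big; apply: eq_bigr => l _ /=; rewrite !big_distrl /=.
by apply: eq_bigr.
Qed.

(** Lowering the upper index and raising it again, the trace becomes the symmetric inverse metric
    contracted with an antisymmetric tensor. *)
Lemma riemann_trace0 i j x : U x -> \sum_k riemann g k k i j x = 0.
Proof.
move=> Ux.
rewrite (eq_bigr (fun k => \sum_q ginv g x k q * (\sum_p g x q p * riemann g p k i j x))); last first.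
  move=> k _.
  by rewrite (sum_mulmx1 k (fun p => riemann g p k i j x) (ginv_mul gunit Ux).2).
apply: sum2_antisym => k q.
have /eqP := riemann_lower_antisym oU gC gsym gunit q k i j Ux.
by rewrite addr_eq0 => /eqP ->; rewrite (ginv_sym gsym) // mulrN.
Qed.

(** By the first Bianchi identity the antisymmetric part is a trace R^k_{klj}, which is zero. *)
Lemma ricci_tensor_sym j l x : U x -> ricci_tensor j l x = ricci_tensor l j x.
Proof.
move=> Ux; apply/eqP; rewrite -subr_eq0 /ricci_tensor -sumrB.
rewrite (eq_bigr (fun k => - riemann g k k l j x)) => [|k _].
  by rewrite sumrN (riemann_trace0 _ _ Ux) oppr0.
have := first_bianchi oU gsym k j k l Ux.
by rewrite (riemann_antisym k l j k) addrAC => /eqP; rewrite addr_eq0 => /eqP.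
Qed.

(** Bochner's identity for a Killing form. The Killing identity expresses b_{m|j|k} by the
    curvature; exchanging the lowered first pair of indices turns the contraction into a Ricci
    trace. *)
Lemma div_cov j x : U x -> \sum_k \sum_m ginv g x k m * cov2 g b m j k x =
  \sum_q bup g b q x * ricci_tensor q j x.
Proof.
move=> Ux.
have E k m : cov2 g b m j k x = - \sum_q bup g b q x * (\sum_p g x k p * riemann g p q j m x).
  rewrite (cov2_antisym oU gC gsym gunit bC bK) // (cov2_killing oU gC gsym gunit bC bK) // opprK.
  rewrite b_riemann // -sumrN; apply: eq_bigr => q _; rewrite -mulrN; congr (_ * _).
  apply/eqP; rewrite -addr_eq0; apply/eqP.
  exact: (riemann_lower_antisym oU gC gsym gunit q k j m Ux).
transitivity (\sum_k \sum_m \sum_q (- bup g b q x * (ginv g x k m * (\sum_p g x k p * riemann g p q j m x)))).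
  apply: eq_bigr => k _; apply: eq_bigr => m _; rewrite E mulrN big_distrr -sumrN.
  by apply: eq_bigr => q _ /=; ring.
rewrite sum_reverse; apply: eq_bigr => q _; rewrite /ricci_tensor big_distrr /=; apply: eq_bigr => m _.
rewrite -big_distrr /= (riemann_antisym m q m j) mulrN mulNr; congr (- (_ * _)).
rewrite -[RHS](sum_mulmx1 m (fun p => riemann g p q j m x) (ginv_mul gunit Ux).2).
by apply: eq_bigr => k _; rewrite (ginv_sym gsym).
Qed.

End KillingCurvature.

(** * The deformed metric *)

Section DifferenceTensor.
Context {R : realFieldType} {n : nat}.
Variables (g Su : 'I_n -> 'I_n -> R) (b s bu su : 'I_n -> R) (P Q ka r : R).
Implicit Types (i j k : 'I_n).

(* Difference between the Levi-Civita connections of [g] and of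
   [E(t) (g - ka(t) b b)], [t = |b|^2], where [E'/E = P] and
   [Q = ka' + P ka], [r = - (ka' + ka^2) / (1 - t ka)]; [bu], [su] and [Su] are
   [b], [s] and [s_ij] with the first index raised. *)
Definition diff_tensor k i j : R :=
  P * (s i * (k == j)%:R + s j * (k == i)%:R - su k * g i j)
  + Q * su k * b i * b j - ka * (b j * Su k i + b i * Su k j)
  + r * bu k * (s i * b j + s j * b i).

Lemma diff_tensor_sym : (forall i j, g i j = g j i) ->
  forall k i j, diff_tensor k i j = diff_tensor k j i.
Proof. by move=> gs k i j; rewrite /diff_tensor (gs i j); ring. Qed.

Lemma diff_tensor_contract (w : 'I_n -> R) i j :
  \sum_k diff_tensor k i j * w k =
  P * (s i * w j + s j * w i - (\sum_k su k * w k) * g i j)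
  + Q * (\sum_k su k * w k) * b i * b j
  - ka * (b j * (\sum_k Su k i * w k) + b i * (\sum_k Su k j * w k))
  + r * (\sum_k bu k * w k) * (s i * b j + s j * b i).
Proof.
rewrite (eq_bigr (fun k => P * s i * ((j == k)%:R * w k)
  + P * s j * ((i == k)%:R * w k)
  + (Q * b i * b j - P * g i j) * (su k * w k)
  + - (ka * b j) * (Su k i * w k) + - (ka * b i) * (Su k j * w k)
  + r * (s i * b j + s j * b i) * (bu k * w k))); last first.
  by move=> k _; rewrite /diff_tensor (eq_sym j) (eq_sym i); ring.
by rewrite !big_split /= -!big_distrr /= !sum_delta; ring.
Qed.

Lemma diff_tensor_trace j : \sum_k g j k * su k = s j -> \sum_k su k * b k = 0 ->
  \sum_k Su k j * b k = s j -> \sum_k Su k k = 0 -> \sum_k bu k * s k = 0 ->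
  \sum_k diff_tensor k j k = (n%:R * P - ka + r * \sum_k bu k * b k) * s j.
Proof.
move=> h1 h2 h3 h4 h5.
rewrite (eq_bigr (fun k => P * s j + P * ((j == k)%:R * s k)
  + - P * (g j k * su k) + Q * b j * (su k * b k)
  + - ka * (Su k j * b k) + - (ka * b j) * Su k k
  + r * s j * (bu k * b k) + r * b j * (bu k * s k))).
  rewrite !big_split /= -!big_distrr /= sum_delta h1 h2 h3 h4 h5 sumr_const card_ord.
  by rewrite -[s j *+ n]mulr_natl; ring.
by move=> k _; rewrite /diff_tensor eqxx mulr1n (eq_sym j); ring.
Qed.

Lemma diff_tensor_quad (y : 'I_n -> R) k :
  \sum_i \sum_j diff_tensor k i j * y i * y j =
  2 * (P * (\sum_i s i * y i)) * y k
  + - (P * (\sum_i \sum_j g i j * y i * y j)) * su k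
  + Q * (\sum_i b i * y i) ^+ 2 * su k
  + - (2 * (ka * (\sum_i b i * y i))) * (\sum_j Su k j * y j)
  + 2 * (r * (\sum_i s i * y i) * (\sum_i b i * y i)) * bu k.
Proof.
set si := \sum_i s i * y i; set be := \sum_i b i * y i.
set Sy := \sum_j Su k j * y j.
have E i : \sum_j diff_tensor k i j * y i * y j =
    P * y k * (s i * y i) + P * si * ((k == i)%:R * y i)
    + - (P * su k) * (\sum_j g i j * y i * y j) + Q * su k * be * (b i * y i)
    + - (ka * be) * (Su k i * y i) + - (ka * Sy) * (b i * y i)
    + r * bu k * be * (s i * y i) + r * bu k * si * (b i * y i).
  rewrite (eq_bigr (fun j => P * s i * y i * ((k == j)%:R * y j)
    + P * (k == i)%:R * y i * (s j * y j)
    + - (P * su k) * (g i j * y i * y j) + Q * su k * b i * y i * (b j * y j)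
    + - (ka * Su k i * y i) * (b j * y j)
    + - (ka * b i * y i) * (Su k j * y j)
    + r * bu k * s i * y i * (b j * y j)
    + r * bu k * b i * y i * (s j * y j))); last first.
    by move=> j _; rewrite /diff_tensor; ring.
  by rewrite !big_split /= -!big_distrr /= sum_delta -/si -/be -/Sy; ring.
under eq_bigr do rewrite E.
rewrite !big_split /= -!big_distrr /= sum_delta -/si -/be -/Sy; ring.
Qed.

Lemma diff_tensor_mx (y : 'I_n -> R) k m :
  conn_mx diff_tensor y k m =
  P * (\sum_i s i * y i) * (k == m)%:R + - (ka * (\sum_i b i * y i)) * Su k m
  + y k * (P * s m)
  + su k * (Q * (\sum_i b i * y i) * b m - P * (\sum_i g i m * y i))
  + bu k * (r * (\sum_i s i * y i) * b m + r * (\sum_i b i * y i) * s m)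
  + (\sum_i Su k i * y i) * (- ka * b m).
Proof.
rewrite /conn_mx (eq_bigr (fun i => P * (k == m)%:R * (s i * y i)
  + P * s m * ((k == i)%:R * y i) + - (P * su k) * (g i m * y i)
  + Q * su k * b m * (b i * y i) + - (ka * b m) * (Su k i * y i)
  + - (ka * Su k m) * (b i * y i) + r * bu k * b m * (s i * y i)
  + r * bu k * s m * (b i * y i))).
  by rewrite !big_split /= -!big_distrr /= sum_delta; ring.
by move=> i _; rewrite /diff_tensor; ring.
Qed.

End DifferenceTensor.

Section KillingAlgebra.
Context {R : realType} {n : nat}.
Notation dv j f := (@partial R n R j f).
Notation ev j := (delta_mx 0 j : 'rV[R]_n).
Variables (U : set 'rV[R]_n) (g : 'rV[R]_n -> 'M[R]_n) (b : 'rV[R]_n -> 'rV[R]_n).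
Hypotheses (oU : open U)
  (gC : forall i j, Ck_on 2 U (fun z => g z i j : R))
  (gsym : forall x i j, U x -> g x i j = g x j i)
  (gunit : forall x, U x -> g x \in unitmx)
  (bC : forall i, Ck_on 2 U (fun z => b z 0 i : R))
  (bK : forall x i j, U x -> cov g b i j x + cov g b j i x = 0).
Implicit Types (x z : 'rV[R]_n) (i j k l m p q : 'I_n).

Definition cov_mx x : 'M[R]_n := \matrix_(i, j) cov g b i j x.
Definition s_row x : 'rV[R]_n := \row_i s_i g b i x.
Definition s_raise k x : R := \sum_j ginv g x k j * s_i g b j x.
Definition s_mixed k j x : R := \sum_m ginv g x k m * cov g b m j x.

Lemma bupE x k : bup g b k x = (ginv g x *m (b x)^T) k 0.
Proof. by rewrite mxE; apply: eq_bigr => j _; rewrite !mxE. Qed.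

Lemma s_raiseE x k : s_raise k x = (ginv g x *m (s_row x)^T) k 0.
Proof. by rewrite mxE; apply: eq_bigr => j _; rewrite !mxE. Qed.

Lemma s_mixedE x k j : s_mixed k j x = (ginv g x *m cov_mx x) k j.
Proof. by rewrite mxE; apply: eq_bigr => m _; rewrite !mxE. Qed.

Lemma norm2E x : norm2 g b x = pr (b x) (ginv g x *m (b x)^T).
Proof. by rewrite /pr mxE; apply: eq_bigr => i _; rewrite bupE mulrC. Qed.

Lemma ginv_tr x : U x -> (ginv g x)^T = ginv g x.
Proof. by move=> Ux; apply/matrixP => i j; rewrite mxE (ginv_sym gsym). Qed.

Lemma cov_mx_tr x : U x -> (cov_mx x)^T = - cov_mx x.
Proof. by move=> Ux; apply/matrixP => i j; rewrite !mxE (cov_antisym bK). Qed.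

Lemma s_rowE x : U x -> s_row x = b x *m ginv g x *m cov_mx x.
Proof.
move=> Ux; apply/matrixP => o i; rewrite ord1 !mxE (s_iE bK) //.
apply: eq_bigr => m _; rewrite mxE; congr (_ * _).
  by apply: eq_bigr => j _; rewrite (ginv_sym gsym) // mulrC.
by rewrite mxE.
Qed.

Lemma sum_b_s_raise x : U x -> \sum_k s_raise k x * b x 0 k = 0.
Proof.
move=> Ux; rewrite -[RHS](pr_b_u1 (ginv_tr Ux) (cov_mx_tr Ux) (s_rowE Ux)).
by rewrite /pr mxE; apply: eq_bigr => k _; rewrite s_raiseE mulrC.
Qed.

Lemma sum_b_s_mixed i x : U x -> \sum_k s_mixed k i x * b x 0 k = s_i g b i x.
Proof.
move=> Ux; have /matrixP/(_ 0 i) := s_rowE Ux; rewrite [LHS]mxE => ->.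
by rewrite -mulmxA mxE; apply: eq_bigr => k _; rewrite s_mixedE mulrC.
Qed.

Lemma sum_s_mixed x : U x -> \sum_k s_mixed k k x = 0.
Proof.
move=> Ux; rewrite -[RHS](tr_N (ginv_tr Ux) (cov_mx_tr Ux)).
by apply: eq_bigr => k _; rewrite s_mixedE.
Qed.

Lemma sum_bup_s x : U x -> \sum_k bup g b k x * s_i g b k x = 0.
Proof.
move=> Ux; rewrite -[RHS](pr_s_u2 (ginv_tr Ux) (cov_mx_tr Ux) (s_rowE Ux)).
by rewrite /pr mxE; apply: eq_bigr => k _; rewrite bupE [s_row x 0 k]mxE mulrC.
Qed.

Lemma s_raise_lower j x : U x -> \sum_k g x j k * s_raise k x = s_i g b j x.
Proof. by move=> Ux; exact: (sum_mulmx1 j (fun j => s_i g b j x) (ginv_mul gunit Ux).1). Qed.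

Lemma s_mixed_lower j i x : U x -> \sum_k g x j k * s_mixed k i x = cov g b j i x.
Proof. by move=> Ux; exact: (sum_mulmx1 j (fun j => cov g b j i x) (ginv_mul gunit Ux).1). Qed.


End KillingAlgebra.

Section Deformation.
Context {R : realType} {n : nat}.
Notation dv j f := (@partial R n R j f).
Notation ev j := (delta_mx 0 j : 'rV[R]_n).
Variables (U : set 'rV[R]_n) (g gb : 'rV[R]_n -> 'M[R]_n) (b : 'rV[R]_n -> 'rV[R]_n).
Hypotheses (oU : open U)
  (gC : forall i j, Ck_on 2 U (fun z => g z i j : R))
  (gsym : forall x i j, U x -> g x i j = g x j i)
  (gunit : forall x, U x -> g x \in unitmx)
  (bC : forall i, Ck_on 2 U (fun z => b z 0 i : R))
  (bK : forall x i j, U x -> cov g b i j x + cov g b j i x = 0)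
  (gbsym : forall x i j, U x -> gb x i j = gb x j i)
  (gbunit : forall x, U x -> gb x \in unitmx).
Variables (E P ka ka1 : R -> R).
Let t := norm2 g b.
Let Q (u : R) := ka1 u + P u * ka u.
Let r (u : R) := - (ka1 u + ka u ^+ 2) / (1 - u * ka u).
Hypotheses
  (gbE : forall z i j, U z -> gb z i j = E (t z) * (g z i j - ka (t z) * b z 0 i * b z 0 j))
  (ED : forall z, U z -> is_derive (t z) 1 E (P (t z) * E (t z)))
  (kaD : forall z, U z -> is_derive (t z) 1 ka (ka1 (t z)))
  (D0 : forall z, U z -> 1 - t z * ka (t z) != 0).
Implicit Types (x z : 'rV[R]_n) (i j k l m : 'I_n).

Definition deformation_tensor z k i j : R :=
  diff_tensor (fun i j => g z i j) (fun k j => s_mixed g b k j z) (fun i => b z 0 i)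
    (fun i => s_i g b i z) (fun k => bup g b k z) (fun k => s_raise g b k z)
    (P (t z)) (Q (t z)) (ka (t z)) (r (t z)) k i j.
Local Notation C := deformation_tensor.

Lemma deformation_tensor_sym z k i j : U z -> C z k i j = C z k j i.
Proof. by move=> Uz; apply: diff_tensor_sym => a c; exact: gsym. Qed.

(** Compatibility of the new connection with the deformed metric, every contraction being replaced
    by a variable. [dgi], [dgj], [dbi] and [dbj] stand for the Christoffel parts of the derivatives
    of g and b; collecting the products of s with two factors b gives r D = - (k1 + kz^2), the
    equation that defines [rz]. *)
Lemma compat_algebra (Ez Pz kz k1 tz D s_k si sj bi bj gij gik gjk bk Sjk Sik Sji Sij dgi dgj dbi dbj : R) :
  D = 1 - tz * kz -> D != 0 -> Sij = - Sji ->
  let Qz := k1 + Pz * kz in let rz := - (k1 + kz ^+ 2) / D in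
  Pz * Ez * (2 * s_k) * (gij - kz * bi * bj)
  + Ez * ((dgi + dgj) + - ((k1 * (2 * s_k) * bi + kz * (Sik + dbi)) * bj
      + kz * bi * (Sjk + dbj))) =
  Ez * (dgi - kz * dbi * bj) + Ez * (dgj - kz * dbj * bi)
  + Ez * ((Pz * (s_k * gij + si * gjk - sj * gik) + Qz * sj * bk * bi
        - kz * (bi * Sjk + bk * Sji) + rz * bj * (s_k * bi + si * bk))
     - kz * (Pz * (s_k * bi + si * bk) - kz * (bi * s_k + bk * si) + rz * tz * (s_k * bi + si * bk)) * bj)
  + Ez * ((Pz * (s_k * gij + sj * gik - si * gjk) + Qz * si * bk * bj
        - kz * (bj * Sik + bk * Sij) + rz * bi * (s_k * bj + sj * bk))
     - kz * (Pz * (s_k * bj + sj * bk) - kz * (bj * s_k + bk * sj) + rz * tz * (s_k * bj + sj * bk)) * bi).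
Proof. by move=> DE D0' -> /=; rewrite DE; field; rewrite -DE. Qed.

(** By uniqueness it suffices that the sum is symmetric and compatible with [gb] at [z]; hence only
    the contractions of [C] with g and with b, [Cg] and [Cb], are required and the inverse of [gb]
    is never computed. *)
Lemma christoffel_deformed z k i j : U z ->
  christoffel gb k i j z = christoffel g k i j z + C z k i j.
Proof.
move=> Uz; apply: (levi_civita_unique gbsym gbunit (A := fun k i j => christoffel g k i j z + C z k i j) Uz).
  by move=> k' i' j'; rewrite (christoffel_sym oU gsym k' i' j' Uz) deformation_tensor_sym.
move=> {}k {}i {}j.
(* The derivatives of b and g are split into a tensorial part and a Christoffel part; the
   Christoffel parts match on the two sides because the old connection is compatible with g. *)
have tD : is_derive z (ev k) t (2 * s_i g b k z) by exact: (is_derive_norm2 oU gC gsym gunit bC bK).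
have bD a : is_derive z (ev k) (fun z => b z 0 a) (cov g b a k z + \sum_m christoffel g m k a z * b z 0 m).
  apply: (is_derive_eq (Ck_derive k (bC a) Uz)).
  rewrite covE (eq_bigr (fun m => christoffel g m k a z * b z 0 m)) ?subrK // => m _.
  by rewrite (christoffel_sym oU gsym m k a Uz).
have gD : is_derive z (ev k) (fun z => g z i j)
    (\sum_m christoffel g m k i z * g z m j + \sum_m christoffel g m k j z * g z m i).
  apply: (is_derive_eq (Ck_derive k (gC i j) Uz)).
  rewrite (partial_metric oU gsym gunit) // big_split; congr (_ + _).
  by apply: eq_bigr => m _; rewrite (gsym i m Uz).
have H := is_derive_mul (is_derive_comp1 (ED Uz) tD)
  (is_derive_add gD (is_derive_opp (is_derive_mul (is_derive_mul
     (is_derive_comp1 (kaD Uz) tD) (bD i)) (bD j)))).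
have H' := is_derive_near_eq oU Uz (fun z Uz => esym (gbE i j Uz)) H.
rewrite (partialE H') {H H'}.
rewrite big_split /=.
under [X in _ = _ + X]eq_bigr do rewrite gbsym //.
have CE a c : \sum_m (christoffel g m k a z + C z m k a) * gb z m c =
    E (t z) * (\sum_m christoffel g m k a z * g z m c
        - ka (t z) * (\sum_m christoffel g m k a z * b z 0 m) * b z 0 c)
    + E (t z) * (\sum_m C z m k a * g z m c
        - ka (t z) * (\sum_m C z m k a * b z 0 m) * b z 0 c).
  rewrite (eq_bigr (fun m => E (t z) * (christoffel g m k a z * g z m c)
     + - (E (t z) * ka (t z) * b z 0 c) * (christoffel g m k a z * b z 0 m)
     + E (t z) * (C z m k a * g z m c)
     + - (E (t z) * ka (t z) * b z 0 c) * (C z m k a * b z 0 m))); last first.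
    move=> m _; rewrite gbE //; move: (christoffel g) (C z) => G Cz; ring.
  rewrite !big_split /= -!big_distrr /=.
  move: (\sum_i0 christoffel g i0 k a z * g z i0 c) (\sum_i0 christoffel g i0 k a z * b z 0 i0).
  move: (\sum_i0 C z i0 k a * g z i0 c) (\sum_i0 C z i0 k a * b z 0 i0) => X1 X2 X3 X4; ring.
rewrite (CE i j) (CE j i) {CE}.
have Cg a c : \sum_m C z m k a * g z m c =
    P (t z) * (s_i g b k z * g z a c + s_i g b a z * g z k c - s_i g b c z * g z k a)
    + Q (t z) * s_i g b c z * b z 0 k * b z 0 a
    - ka (t z) * (b z 0 a * cov g b c k z + b z 0 k * cov g b c a z)
    + r (t z) * b z 0 c * (s_i g b k z * b z 0 a + s_i g b a z * b z 0 k).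
  rewrite /deformation_tensor diff_tensor_contract.
  have -> : \sum_m s_raise g b m z * g z m c = s_i g b c z.
    rewrite -(s_raise_lower b gunit c Uz); apply: eq_bigr => m _.
    by rewrite (gsym m c Uz) mulrC.
  have S a' : \sum_m s_mixed g b m a' z * g z m c = cov g b c a' z.
    rewrite -(s_mixed_lower b gunit c a' Uz); apply: eq_bigr => m _.
    by rewrite (gsym m c Uz) mulrC.
  have -> : \sum_m bup g b m z * g z m c = b z 0 c.
    rewrite -(bup_lower b gunit c Uz); apply: eq_bigr => m _.
    by rewrite (gsym m c Uz) mulrC.
  by rewrite (S k) (S a).
have Cb a : \sum_m C z m k a * b z 0 m =
    P (t z) * (s_i g b k z * b z 0 a + s_i g b a z * b z 0 k)
    - ka (t z) * (b z 0 a * s_i g b k z + b z 0 k * s_i g b a z)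
    + r (t z) * t z * (s_i g b k z * b z 0 a + s_i g b a z * b z 0 k).
  rewrite /deformation_tensor diff_tensor_contract.
  rewrite (sum_b_s_raise gsym bK Uz) !(sum_b_s_mixed gsym bK _ Uz) -/(norm2 g b z) -/(t z).
  by rewrite mulr0 !mul0r subr0 addr0.
rewrite (Cg i j) (Cg j i) (Cb i) (Cb j) (gsym j i Uz).
rewrite [RHS]addrACA [RHS]addrA.
exact: (@compat_algebra (E (t z)) (P (t z)) (ka (t z)) (ka1 (t z)) (t z) (1 - t z * ka (t z))
  (s_i g b k z) (s_i g b i z) (s_i g b j z) (b z 0 i) (b z 0 j) (g z i j) (g z k i) (g z k j)
  (b z 0 k) (cov g b j k z) (cov g b i k z) (cov g b j i z) (cov g b i j z)
  (\sum_m christoffel g m k i z * g z m j) (\sum_m christoffel g m k j z * g z m i) (\sum_m christoffel g m k i z * b z 0 m) (\sum_m christoffel g m k j z * b z 0 m) erefl (D0 Uz) (cov_antisym bK i j Uz)).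
Qed.

End Deformation.

(** * Divergences and contractions built from beta, s and s_ij *)

Section Divergence.
Context {R : realType} {n : nat}.
Notation ev j := (delta_mx 0 j : 'rV[R]_n).
Variables (A : 'I_n -> 'I_n -> 'I_n -> R) (x : 'rV[R]_n).
Implicit Types (V : 'I_n -> 'rV[R]_n -> R).

(** The divergence at [x] for the connection [A], as a relation that also carries derivability, so
    that sum and product rules can be chained. *)
Definition has_div V (c : R) := exists2 dV : 'I_n -> R,
  (forall k, is_derive x (ev k) (V k) (dV k)) &
  \sum_k dV k + \sum_m conn_trace A m * V m x = c.

Lemma has_divD V V' c c' : has_div V c -> has_div V' c' ->
  has_div (fun k z => V k z + V' k z) (c + c').
Proof.
move=> [dV VD <-] [dV' VD' <-]; exists (fun k => dV k + dV' k).
  by move=> k; exact: is_derive_add.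
under [\sum_m conn_trace A m * _]eq_bigr do rewrite mulrDr.
by rewrite !big_split /= addrACA.
Qed.

Lemma has_div_scale (f : 'rV[R]_n -> R) df V c :
  (forall k, is_derive x (ev k) f (df k)) -> has_div V c ->
  has_div (fun k z => f z * V k z) (\sum_k df k * V k x + f x * c).
Proof.
move=> fD [dV VD <-]; exists (fun k => df k * V k x + f x * dV k).
  by move=> k; exact: is_derive_mul.
rewrite big_split /= -addrA; congr (_ + _); rewrite mulrDr !big_distrr /=.
by congr (_ + _); apply: eq_bigr => m _; rewrite mulrCA.
Qed.

Lemma has_div_eq V V' c c' : c = c' -> (forall k z, V k z = V' k z) ->
  has_div V c -> has_div V' c'.
Proof.
move=> -> VV' [dV VD E]; exists dV => [k|].
  by rewrite (_ : V' k = V k) //; apply/funext => z.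
by rewrite -E; congr (_ + _); apply: eq_bigr => m _; rewrite VV'.
Qed.

Lemma has_div_parallel_ext y : (forall k i j, A k i j = A k j i) ->
  has_div (parallel_ext A x y) 0.
Proof.
move=> As; exists (fun k => - conn_mx A y k k).
  by move=> k; exact: is_derive_parallel_ext.
rewrite sumrN addrC; apply/eqP; rewrite subr_eq0; apply/eqP.
under eq_bigr do rewrite parallel_ext_at /conn_trace big_distrl /=.
rewrite exchange_big; apply: eq_bigr => k _; apply: eq_bigr => m _.
by rewrite (As k k m).
Qed.

End Divergence.

Section KillingContractions.
Context {R : realType} {n : nat}.
Notation dv j f := (@partial R n R j f).
Notation ev j := (delta_mx 0 j : 'rV[R]_n).
Variables (U : set 'rV[R]_n) (g : 'rV[R]_n -> 'M[R]_n) (b : 'rV[R]_n -> 'rV[R]_n).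
Hypotheses (oU : open U)
  (gC : forall i j, Ck_on 2 U (fun z => g z i j : R))
  (gsym : forall x i j, U x -> g x i j = g x j i)
  (gunit : forall x, U x -> g x \in unitmx)
  (bC : forall i, Ck_on 2 U (fun z => b z 0 i : R))
  (bK : forall x i j, U x -> cov g b i j x + cov g b j i x = 0).
Variables (x y : 'rV[R]_n) (a mu w : R).
Hypothesis Ux : U x.
Let t := norm2 g b x.
Let al := pr y (g x *m y^T).
Let be := pr (b x) y^T.
Let si := pr (s_row g b x) y^T.
Hypotheses (wE : w = a ^+ 2 - mu * t) (w0 : w != 0)
  (SS : cov_mx g b x *m ginv g x *m cov_mx g b x = - a ^+ 2 *: g x
     + mu *: ((b x)^T *m b x) + (mu / w) *: ((s_row g b x)^T *m s_row g b x))
  (hR : forall y, qform (fun j l => bcurv g b j l x) y =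
     mu * (t * qform (fun i j => g x i j) y - (\sum_i b x 0 i * y i) ^+ 2))
  (hE : forall j l, ricci_tensor g j l x = (n%:R - 1) * mu * g x j l).
Implicit Types (i j k l m : 'I_n).
Local Notation A := (gamma g x).
Local Notation Y := (parallel_ext A x (y 0)).

Let gG := (ginv_mul gunit Ux).1.
Let Gg := (ginv_mul gunit Ux).2.
Let GT := ginv_tr gsym Ux.
Let ST := cov_mx_tr bK Ux.
Let sE := s_rowE gsym bK Ux.
Let tE : t = pr (b x) (ginv g x *m (b x)^T) := norm2E g b x.

(** [dsigma] and [dbeta] are the gradients at [x] of s(Y) and beta(Y) for the parallel extension Y
    of y; [s_vec] is the vector field s^k_j Y^j. *)
Definition dsigma k := \sum_i cov_s g b k i x * y 0 i.
Definition dbeta k := \sum_i cov g b i k x * y 0 i.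
Definition s_vec k z := \sum_m ginv g z k m * (\sum_j cov g b m j z * Y j z).

Lemma is_derive_sigma k :
  is_derive x (ev k) (fun z => \sum_i s_i g b i z * Y i z) (dsigma k).
Proof.
have H := is_derive_pairing oU gsym (y 0) Ux
  (fun i => is_derive_s_i oU gC gsym gunit bC bK i k Ux)
  (dw := fun k i => cov_s g b k i x + \sum_m gamma g x m k i * s_i g b m x).
by apply: (is_derive_eq H); apply: eq_bigr => i _; rewrite cov_form_s.
Qed.

Lemma is_derive_beta k :
  is_derive x (ev k) (fun z => \sum_i b z 0 i * Y i z) (dbeta k).
Proof.
have H := is_derive_pairing oU gsym (y 0) Ux (fun i => Ck_derive k (bC i) Ux)
  (dw := fun k i => dv k (fun z => b z 0 i) x).
by apply: (is_derive_eq H); apply: eq_bigr => i _; rewrite (cov_form_b b oU gsym).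
Qed.

Lemma prS (v : 'rV[R]_n) (u : 'cV[R]_n) : pr v u = \sum_k v 0 k * u k 0.
Proof. by rewrite /pr mxE. Qed.

Lemma s_rowi i : s_row g b x 0 i = s_i g b i x.
Proof. by rewrite mxE. Qed.

Lemma dbetaE k : dbeta k = (y *m cov_mx g b x) 0 k.
Proof. by rewrite mxE; apply: eq_bigr => i _; rewrite mxE mulrC. Qed.

Lemma s_vecE k : s_vec k x = (ginv g x *m cov_mx g b x *m y^T) k 0.
Proof.
rewrite -mulmxA mxE; apply: eq_bigr => m _; congr (_ * _); rewrite mxE.
by apply: eq_bigr => j _; rewrite parallel_ext_at !mxE.
Qed.

Lemma sum_s_y : \sum_k s_i g b k x * y 0 k = si.
Proof. by rewrite /si prS; apply: eq_bigr => k _; rewrite s_rowi mxE. Qed.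

Lemma sum_b_y : \sum_k b x 0 k * y 0 k = be.
Proof. by rewrite /be prS; apply: eq_bigr => k _; rewrite mxE. Qed.

Lemma sum_g_yy : \sum_i \sum_j g x i j * y 0 i * y 0 j = al.
Proof.
rewrite /al prS; apply: eq_bigr => i _; rewrite mxE big_distrr /=.
by apply: eq_bigr => j _; rewrite !mxE; ring.
Qed.

Lemma sum_s_s_raise : \sum_k s_i g b k x * s_raise g b k x = w * t.
Proof.
rewrite -(pr_s_u1 Gg GT ST sE tE wE SS) prS.
by apply: eq_bigr => k _; rewrite s_rowi s_raiseE.
Qed.

Lemma sum_dbeta_s_raise : \sum_k dbeta k * s_raise g b k x = w * be.
Proof.
rewrite -(pr_yS_u1 y gG Gg GT ST sE tE wE SS) prS.
by apply: eq_bigr => k _; rewrite dbetaE s_raiseE.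
Qed.

Lemma sum_s_svec : \sum_k s_i g b k x * s_vec k x = - (w * be).
Proof.
rewrite -(pr_s_u3 y gG Gg GT ST sE tE wE SS) prS.
by apply: eq_bigr => k _; rewrite s_rowi s_vecE.
Qed.

Lemma sum_dbeta_svec : \sum_k dbeta k * s_vec k x =
  - (a ^+ 2 * al - mu * be ^+ 2 - mu / w * si ^+ 2).
Proof.
rewrite -(pr_yS_u3 (g := g x) (b := b x) (s := s_row g b x) y ST SS) prS.
by apply: eq_bigr => k _; rewrite dbetaE s_vecE.
Qed.

Lemma sum_s_bup : \sum_k s_i g b k x * bup g b k x = 0.
Proof.
rewrite -[RHS](sum_bup_s gsym bK Ux).
by apply: eq_bigr => k _; rewrite mulrC.
Qed.

Lemma sum_dbeta_bup : \sum_k dbeta k * bup g b k x = - si.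
Proof.
rewrite -(pr_yS_u2 y GT ST sE) prS.
by apply: eq_bigr => k _; rewrite dbetaE bupE.
Qed.

Lemma cov_sE k i : cov_s g b k i x =
  \sum_m (ginv g x *m cov_mx g b x) m k * cov g b m i x - bcurv g b k i x.
Proof.
rewrite /cov_s (cov2_contract oU gC gsym gunit bC bK) //; congr (_ - _).
by apply: eq_bigr => m _; rewrite -s_mixedE.
Qed.

(** The derivative of s has two terms: one pairs s_ij y with the image of [u] under the endomorphism
    s_ij, the other is the curvature form of b at [u] and y, by the Killing identity. *)
Lemma sum_dsigma (u : 'cV[R]_n) : \sum_k dsigma k * u k 0 =
  pr (y *m (cov_mx g b x)^T) (ginv g x *m cov_mx g b x *m u)
  - \sum_k \sum_i bcurv g b k i x * u k 0 * y 0 i.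
Proof.
have -> : \sum_k dsigma k * u k 0 =
    \sum_k \sum_i \sum_m (ginv g x *m cov_mx g b x) m k * u k 0 * (cov g b m i x * y 0 i)
    - \sum_k \sum_i bcurv g b k i x * u k 0 * y 0 i.
  rewrite -sumrB; apply: eq_bigr => k _; rewrite /dsigma big_distrl -sumrB /=.
  apply: eq_bigr => i _; rewrite cov_sE !mulrBl; congr (_ - _); last exact: mulrAC.
  by rewrite !big_distrl /=; apply: eq_bigr => m _; rewrite mulrACA mulrA mulrAC.
congr (_ - _); rewrite sum_rotate prS; apply: eq_bigr => m _.
rewrite [(_ *m u) m 0]mxE [(y *m _) 0 m]mxE big_distrlr /= exchange_big /=.
by apply: eq_bigr => k _; apply: eq_bigr => i _; rewrite !mxE; ring.
Qed.

Lemma sum_dsigma_y : \sum_k dsigma k * y 0 k = w * al - mu / w * si ^+ 2.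
Proof.
have -> : \sum_k dsigma k * y 0 k = \sum_k dsigma k * y^T k 0.
  by apply: eq_bigr => k _; rewrite mxE.
rewrite sum_dsigma (norm_Sy y ST SS).
have -> : \sum_k \sum_i bcurv g b k i x * y^T k 0 * y 0 i =
    qform (fun k i => bcurv g b k i x) (y 0).
  by apply: eq_bigr => k _; apply: eq_bigr => i _; rewrite mxE.
rewrite hR [qform _ _]sum_g_yy sum_b_y wE -/al -/be -/si; ring.
Qed.

(** The curvature form vanishes in the direction of b, so only the product of two s_ij survives. *)
Lemma sum_dsigma_bup : \sum_k dsigma k * bup g b k x = w * be.
Proof.
have -> : \sum_k dsigma k * bup g b k x = \sum_k dsigma k * (ginv g x *m (b x)^T) k 0.
  by apply: eq_bigr => k _; rewrite bupE.
rewrite sum_dsigma (N_u2 GT ST sE) prNr ST mulmxN prNl opprK.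
rewrite (pr_yS_u1 y gG Gg GT ST sE tE wE SS) exchange_big big1 ?subr0 // => i _ /=.
rewrite (eq_bigr (fun k => bup g b k x * bcurv g b k i x * y 0 i)).
  by rewrite -big_distrl /= (bup_bcurv b oU gC gsym gunit) // mul0r.
by move=> k _; rewrite -bupE (mulrC (bcurv _ _ _ _ _)).
Qed.

Lemma has_div_bup : has_div A x (bup g b) 0.
Proof.
have := @has_div_eq R n A x (fun k z => \sum_j ginv g z k j * b z 0 j) (bup g b).
move=> H; apply: H (erefl _) _ _ => //.
exists (fun k => \sum_j ginv g x k j * cov_form g x (fun j => b x 0 j) (fun k i => dv k (fun z => b z 0 i) x) k j
    - \sum_m gamma g x k k m * (\sum_j ginv g x m j * b x 0 j)).
  move=> k; exact: (is_derive_raise oU gC gsym gunit k Ux (w := fun j z => b z 0 j) (fun i => Ck_derive k (bC i) Ux)).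
rewrite (divergence_raise g (fun j z => b z 0 j) (fun k i => dv k (fun z => b z 0 i) x) Ux).
apply: sum2_antisym => k j.
rewrite !(cov_form_b b oU gsym) // (ginv_sym gsym) // (cov_antisym bK _ _ Ux); ring.
Qed.

(** Minus the trace of the squared endomorphism gives n a^2 - 2 mu t, and the trace of the curvature
    form takes away (n - 1) mu t; the total is n w - mu t. *)
Lemma has_div_s_raise : has_div A x (s_raise g b) (n%:R * w - mu * t).
Proof.
exists (fun k => \sum_j ginv g x k j * cov_form g x (fun j => s_i g b j x)
     (fun k i => cov_s g b k i x + \sum_m gamma g x m k i * s_i g b m x) k j
    - \sum_m gamma g x k k m * (\sum_j ginv g x m j * s_i g b j x)).
  move=> k; exact: (is_derive_raise oU gC gsym gunit k Ux (w := fun j z => s_i g b j z)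
   (fun i => is_derive_s_i oU gC gsym gunit bC bK i k Ux)).
rewrite (divergence_raise g (fun j z => s_i g b j z) _ Ux).
have -> : \sum_k \sum_j ginv g x k j * cov_form g x (fun j => s_i g b j x)
     (fun k i => cov_s g b k i x + \sum_m gamma g x m k i * s_i g b m x) k j =
   \sum_k \sum_j \sum_m (ginv g x *m cov_mx g b x) m k * (ginv g x k j * cov g b m j x)
   - \sum_k \sum_j ginv g x k j * bcurv g b k j x.
  rewrite -sumrB; apply: eq_bigr => k _; rewrite -sumrB; apply: eq_bigr => j _.
  rewrite cov_form_s cov_sE mulrBr; congr (_ - _).
  by rewrite big_distrr; apply: eq_bigr => m _; exact: mulrCA.
have -> : \sum_k \sum_j \sum_m (ginv g x *m cov_mx g b x) m k * (ginv g x k j * cov g b m j x)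
    = - \tr (ginv g x *m cov_mx g b x *m (ginv g x *m cov_mx g b x)).
  have -> : - \tr (ginv g x *m cov_mx g b x *m (ginv g x *m cov_mx g b x)) =
      \tr (ginv g x *m cov_mx g b x *m (ginv g x *m (cov_mx g b x)^T)).
    by rewrite ST !mulmxN raddfN.
  rewrite sum_rotate; apply: eq_bigr => m _; rewrite mxE; apply: eq_bigr => k _.
  rewrite [X in _ = _ * X]mxE big_distrr /=; apply: eq_bigr => j _.
  by rewrite [(cov_mx g b x)^T j m]mxE [cov_mx g b x m j]mxE.
rewrite (tr_NN Gg GT ST sE tE wE w0 SS).
have -> : \sum_k \sum_j ginv g x k j * bcurv g b k j x = mu * (n%:R * t - t).
  (* The hypothesis on R_bb is put in the form of an equality of quadratic forms, so that its trace
     can be taken with [qform_trace]. *)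
  have Eq c y' : mu * (c * qform (fun i j => g x i j) y' - (\sum_i b x 0 i * y' i) ^+ 2) =
      qform (fun i j => mu * (c * g x i j - b x 0 i * b x 0 j)) y'.
    rewrite expr2 big_distrlr /qform big_distrr -sumrB big_distrr /=.
    apply: eq_bigr => i _; rewrite big_distrr -sumrB big_distrr /=.
    by apply: eq_bigr => j _; ring.
  have Es c : \sum_i \sum_j ginv g x i j * (mu * (c * g x i j - b x 0 i * b x 0 j)) =
      mu * ((\sum_i \sum_j ginv g x i j * g x i j) * c
        - \sum_i \sum_j ginv g x i j * (b x 0 i * b x 0 j)).
    rewrite big_distrl -sumrB big_distrr; apply: eq_bigr => i _ /=.
    by rewrite big_distrl -sumrB big_distrr; apply: eq_bigr => j _ /=; ring.
  rewrite (qform_trace (C := fun i j => mu * (t * g x i j - b x 0 i * b x 0 j))).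
  - rewrite Es; congr (mu * (_ * t - _)).
      rewrite -(mxtrace1 R n) -Gg; apply: eq_bigr => i _; rewrite mxE.
      by apply: eq_bigr => j _; rewrite (gsym j i Ux).
    rewrite tE prS; apply: eq_bigr => i _; rewrite mxE big_distrr.
    by apply: eq_bigr => j _ /=; rewrite mxE; ring.
  - by move=> y'; rewrite hR Eq.
  - by move=> i j; exact: (ginv_sym gsym).
rewrite wE; ring.
Qed.

Lemma has_div_svec : has_div A x s_vec ((n%:R - 1) * mu * be).
Proof.
exists (fun k => \sum_m ginv g x k m * cov_form g x (fun m => \sum_j cov g b m j x * Y j x)
     (fun k m => \sum_j cov2 g b m j k x * y 0 j
        + \sum_l gamma g x l k m * (\sum_j cov g b l j x * y 0 j)) k m
    - \sum_m gamma g x k k m * (\sum_j ginv g x m j * (\sum_l cov g b j l x * Y l x))).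
  move=> k; exact: (is_derive_raise oU gC gsym gunit k Ux
    (w := fun m z => \sum_j cov g b m j z * Y j z)
    (fun m => is_derive_s_pairing oU gC gsym gunit bC m k (y 0) Ux)).
rewrite (divergence_raise g (fun m z => \sum_j cov g b m j z * Y j z) _ Ux).
transitivity (\sum_k \sum_m \sum_j ginv g x k m * cov2 g b m j k x * y 0 j).
  apply: eq_bigr => k _; apply: eq_bigr => m _; rewrite /cov_form.
  under [X in _ + _ - X]eq_bigr do under eq_bigr do rewrite parallel_ext_at.
  by rewrite addrK big_distrr; apply: eq_bigr => j _ /=; rewrite mulrA.
rewrite sum_reverse -sum_b_y big_distrr; apply: eq_bigr => j _ /=.
rewrite exchange_big mulrA -[b x 0 j](bup_lower b gunit j Ux) /=.
transitivity ((\sum_k \sum_m ginv g x k m * cov2 g b m j k x) * y 0 j).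
  rewrite big_distrl; apply: eq_bigr => k _; rewrite big_distrl.
  by apply: eq_bigr => m _.
rewrite (div_cov oU gC gsym gunit bC bK) //; congr (_ * _).
rewrite big_distrr; apply: eq_bigr => q _ /=.
by rewrite hE (gsym j q Ux); ring.
Qed.

End KillingContractions.

Lemma sum_lin3 (R : comRingType) n (c d e : R) (u v w V : 'I_n -> R) :
  \sum_k (c * u k + d * v k + e * w k) * V k =
  c * (\sum_k u k * V k) + d * (\sum_k v k * V k) + e * (\sum_k w k * V k).
Proof.
rewrite !big_distrr -!big_split; apply: eq_bigr => k _ /=; ring.
Qed.

(** * Ricci curvature of the deformed metric *)

Section DeformedRicci.
Context {R : realType} {n : nat}.
Notation dv j f := (@partial R n R j f).
Notation ev j := (delta_mx 0 j : 'rV[R]_n).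
Variables (U : set 'rV[R]_n) (g gb : 'rV[R]_n -> 'M[R]_n) (b : 'rV[R]_n -> 'rV[R]_n).
Hypotheses (oU : open U)
  (gC : forall i j, Ck_on 2 U (fun z => g z i j : R))
  (gsym : forall x i j, U x -> g x i j = g x j i)
  (gunit : forall x, U x -> g x \in unitmx)
  (bC : forall i, Ck_on 2 U (fun z => b z 0 i : R))
  (bK : forall x i j, U x -> cov g b i j x + cov g b j i x = 0)
  (gbsym : forall x i j, U x -> gb x i j = gb x j i)
  (gbunit : forall x, U x -> gb x \in unitmx).
Variables (E P ka ka1 : R -> R).
Let t := norm2 g b.
Let Q (u : R) := ka1 u + P u * ka u.
Let r (u : R) := - (ka1 u + ka u ^+ 2) / (1 - u * ka u).
Hypotheses
  (gbE : forall z i j, U z -> gb z i j = E (t z) * (g z i j - ka (t z) * b z 0 i * b z 0 j))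
  (ED : forall z, U z -> is_derive (t z) 1 E (P (t z) * E (t z)))
  (kaD : forall z, U z -> is_derive (t z) 1 ka (ka1 (t z)))
  (D0 : forall z, U z -> 1 - t z * ka (t z) != 0).
Variables (x y : 'rV[R]_n) (a mu w p1 q1 r1 : R).
Hypothesis Ux : U x.
Let al := pr y (g x *m y^T).
Let be := pr (b x) y^T.
Let si := pr (s_row g b x) y^T.
Hypotheses (wE : w = a ^+ 2 - mu * t x) (w0 : w != 0)
  (SS : cov_mx g b x *m ginv g x *m cov_mx g b x = - a ^+ 2 *: g x
     + mu *: ((b x)^T *m b x) + (mu / w) *: ((s_row g b x)^T *m s_row g b x))
  (hR : forall y, qform (fun j l => bcurv g b j l x) y =
     mu * (t x * qform (fun i j => g x i j) y - (\sum_i b x 0 i * y i) ^+ 2))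
  (hE : forall j l, ricci_tensor g j l x = (n%:R - 1) * mu * g x j l)
  (PD : is_derive (t x) 1 P p1) (QD : is_derive (t x) 1 Q q1)
  (rD : is_derive (t x) 1 r r1).
Implicit Types (i j k l m : 'I_n) (z : 'rV[R]_n).
Local Notation A := (gamma g x).
Local Notation Y := (parallel_ext A x (y 0)).
Local Notation C := (deformation_tensor g b P ka ka1).

Let sigma z := \sum_i s_i g b i z * Y i z.
Let beta_ z := \sum_i b z 0 i * Y i z.
Let quad z := \sum_i \sum_j g z i j * Y i z * Y j z.
(** The trace of [C] is h(t) s, by [deformation_trace]; [h1] is the derivative of [h] at t(x). *)
Let h (u : R) := n%:R * P u - ka u + r u * u.
Let h1 := n%:R * p1 - ka1 (t x) + (r1 * t x + r (t x)).
Let tD k := is_derive_norm2 oU gC gsym gunit bC bK k Ux.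

Let sigma_x : sigma x = si.
Proof. by rewrite /si -sum_s_y; apply: eq_bigr => i _; rewrite parallel_ext_at. Qed.

Let beta_x : beta_ x = be.
Proof. by rewrite /be -sum_b_y; apply: eq_bigr => i _; rewrite parallel_ext_at. Qed.

Let quad_x : quad x = al.
Proof.
rewrite /al -sum_g_yy; apply: eq_bigr => i _; apply: eq_bigr => j _.
by rewrite !parallel_ext_at.
Qed.

(** The vector field C(Y,Y) in closed form: scalar multiples of Y, s, s_ij Y and b with raised
    indices. *)
Let Qfield k z := 2 * (P (t z) * sigma z) * Y k z
  + - (P (t z) * quad z) * s_raise g b k z
  + Q (t z) * beta_ z ^+ 2 * s_raise g b k z
  + - (2 * (ka (t z) * beta_ z)) * s_vec g b x y k z
  + 2 * (r (t z) * sigma z * beta_ z) * bup g b k z.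

Lemma deformation_quad k z :
  \sum_j \sum_l C z k j l * Y j z * Y l z = Qfield k z.
Proof.
rewrite diff_tensor_quad /Qfield /s_vec; congr (_ + _ * _ + _).
under [RHS]eq_bigr do rewrite big_distrr /=.
rewrite exchange_big; apply: eq_bigr => j _; rewrite big_distrl /=.
by apply: eq_bigr => m _; rewrite mulrA.
Qed.

Lemma deformation_trace j z : U z -> \sum_k C z k j k = h (t z) * s_i g b j z.
Proof.
move=> Uz; apply: diff_tensor_trace.
- exact: (s_raise_lower b gunit j Uz).
- exact: (sum_b_s_raise gsym bK Uz).
- exact: (sum_b_s_mixed gsym bK j Uz).
- exact: (sum_s_mixed gsym bK Uz).
- exact: (sum_bup_s gsym bK Uz).
Qed.

Lemma deformation_trace_pairing z : U z ->
  \sum_j (\sum_k C z k j k) * Y j z = h (t z) * sigma z.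
Proof.
move=> Uz; rewrite big_distrr; apply: eq_bigr => j _ /=.
by rewrite deformation_trace // mulrA.
Qed.

(** One summand for each of the five terms of [Qfield], in the same order. *)
Definition div_deformation :=
  2 * (2 * p1 * si ^+ 2 + P (t x) * (w * al - mu / w * si ^+ 2))
  - (2 * p1 * w * t x * al + P (t x) * al * (n%:R * w - mu * t x))
  + (2 * q1 * w * t x * be ^+ 2 + 2 * Q (t x) * w * be ^+ 2
     + Q (t x) * be ^+ 2 * (n%:R * w - mu * t x))
  + (4 * ka1 (t x) * w * be ^+ 2
     + 2 * ka (t x) * (a ^+ 2 * al - mu * be ^+ 2 - mu / w * si ^+ 2)
     - 2 * ka (t x) * be ^+ 2 * (n%:R - 1) * mu)
  + 2 * r (t x) * (w * be ^+ 2 - si ^+ 2).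

Lemma has_div_Qfield : has_div A x Qfield div_deformation.
Proof.
have sD := is_derive_sigma oU gC gsym gunit bC bK y Ux.
have bD := is_derive_beta oU gsym bC y Ux.
have PtD k := is_derive_comp1 PD (tD k).
have QtD k := is_derive_comp1 QD (tD k).
have rtD k := is_derive_comp1 rD (tD k).
have ktD k := is_derive_comp1 (kaD Ux) (tD k).
have sD' k : is_derive x (ev k) sigma (dsigma g b x y k) := sD k.
have bD' k : is_derive x (ev k) beta_ (dbeta g b x y k) := bD k.
have qD' k : is_derive x (ev k) quad 0 :=
  is_derive_metric_pairing oU gC gsym gunit k (y 0) Ux.
have c2 k := is_derive_const 2 x (ev k).
(* The gradients of the five scalar coefficients are combinations of [S], [dS] and [dB]; [sum_lin3]
   then reduces the divergence to contractions already evaluated. *)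
pose S k := s_i g b k x; pose dS k := dsigma g b x y k; pose dB k := dbeta g b x y k.
have F1 k : is_derive x (ev k) (fun z => 2 * (P (t z) * sigma z))
    (4 * p1 * si * S k + 2 * P (t x) * dS k + 0 * dB k).
  apply: (is_derive_eq (is_derive_mul (c2 k) (is_derive_mul (PtD k) (sD' k)))).
  by rewrite sigma_x -/(S k) -/(dS k); ring.
have F2 k : is_derive x (ev k) (fun z => - (P (t z) * quad z))
    (- (2 * p1 * al) * S k + 0 * dS k + 0 * dB k).
  apply: (is_derive_eq (is_derive_opp (is_derive_mul (PtD k) (qD' k)))).
  by rewrite quad_x -/(S k); ring.
have F3 k : is_derive x (ev k) (fun z => Q (t z) * beta_ z ^+ 2)
    (2 * q1 * be ^+ 2 * S k + 0 * dS k + 2 * Q (t x) * be * dB k).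
  apply: (is_derive_eq (is_derive_mul (QtD k) (is_derive_mul (bD' k) (bD' k)))).
  by rewrite beta_x -/(S k) -/(dB k); ring.
have F4 k : is_derive x (ev k) (fun z => - (2 * (ka (t z) * beta_ z)))
    (- (4 * ka1 (t x) * be) * S k + 0 * dS k + - (2 * ka (t x)) * dB k).
  apply: (is_derive_eq (is_derive_opp (is_derive_mul (c2 k) (is_derive_mul (ktD k) (bD' k))))).
  by rewrite beta_x -/(S k) -/(dB k); ring.
have F5 k : is_derive x (ev k) (fun z => 2 * (r (t z) * sigma z * beta_ z))
    (4 * r1 * si * be * S k + 2 * r (t x) * be * dS k + 2 * r (t x) * si * dB k).
  apply: (is_derive_eq (is_derive_mul (c2 k) (is_derive_mul (is_derive_mul (rtD k) (sD' k)) (bD' k)))).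
  by rewrite sigma_x beta_x -/(S k) -/(dS k) -/(dB k); ring.
have dY : has_div A x Y 0.
  by apply: has_div_parallel_ext => k i j; rewrite /gamma (christoffel_sym oU gsym k i j Ux).
have dSup := has_div_s_raise oU gC gsym gunit bC bK Ux wE w0 SS hR.
have dV := has_div_svec oU gC gsym gunit bC bK y Ux hE.
have dBup := has_div_bup oU gC gsym gunit bC bK Ux.
have H := has_divD (has_divD (has_divD (has_divD (has_div_scale F1 dY) (has_div_scale F2 dSup))
  (has_div_scale F3 dSup)) (has_div_scale F4 dV)) (has_div_scale F5 dBup).
apply: (has_div_eq _ _ H) => //.
rewrite !sum_lin3 sigma_x beta_x quad_x.
rewrite /S /dS /dB.
have -> : \sum_k s_i g b k x * Y k x = si by rewrite -sigma_x.
have -> : \sum_k dsigma g b x y k * Y k x = w * al - mu / w * si ^+ 2.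
  rewrite -(sum_dsigma_y oU gC gsym gunit bC bK y Ux wE SS hR).
  by apply: eq_bigr => k _; rewrite parallel_ext_at.
rewrite (sum_s_s_raise gsym gunit bK Ux wE SS) (sum_dbeta_s_raise gsym gunit bK y Ux wE SS).
rewrite (sum_s_svec gsym gunit bK y Ux wE SS) (sum_dbeta_svec bK y Ux SS).
rewrite (sum_s_bup gsym bK Ux) (sum_dbeta_bup gsym bK y Ux).
rewrite (sum_dsigma_bup oU gC gsym gunit bC bK y Ux wE SS).
rewrite -/t -/al -/be -/si /div_deformation -/(t x) !mul0r.
ring.
Qed.

Lemma ricci_ricci_form (g' : 'rV[R]_n -> 'M[R]_n) : ricci g' x y =
  ricci_form (gamma g' x) (fun u k i j => dv u (christoffel g' k i j) x) (y 0).
Proof.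
apply: eq_bigr => k _; apply: eq_bigr => j _; apply: eq_bigr => l _.
by rewrite riemannE.
Qed.

(** Only derivability is at stake: the product rules are chained to obtain it, and the value they
    produce is discarded. *)
Lemma is_derive_deformation u k i j : is_derive x (ev u) (fun z => C z k i j)
  (dv u (fun z => C z k i j) x).
Proof.
have sD i' := is_derive_s_i oU gC gsym gunit bC bK i' u Ux.
have supD := is_derive_raise oU gC gsym gunit (w := fun j z => s_i g b j z)
  (dw := fun k i => cov_s g b k i x + \sum_m gamma g x m k i * s_i g b m x) k Ux sD.
have mixD j' := is_derive_raise oU gC gsym gunit (w := fun m z => cov g b m j' z)
  (dw := fun u m => dv u (cov g b m j') x) k Ux (fun m => cov_derive oU gC gsym gunit bC m j' u Ux).
have bD i' := Ck_derive u (bC i') Ux.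
have bupD := is_derive_bup oU gC gsym gunit bC k u Ux.
have PtD := is_derive_comp1 PD (tD u).
have QtD := is_derive_comp1 QD (tD u).
have rtD := is_derive_comp1 rD (tD u).
have ktD := is_derive_comp1 (kaD Ux) (tD u).
have cD (c : R) := is_derive_const c x (ev u).
have [dC _] := is_derive_add (is_derive_add (is_derive_add
  (is_derive_mul PtD (is_derive_add (is_derive_add (is_derive_mul (sD i) (cD (k == j)%:R))
     (is_derive_mul (sD j) (cD (k == i)%:R))) (is_derive_opp (is_derive_mul supD (Ck_derive u (gC i j) Ux)))))
  (is_derive_mul (is_derive_mul (is_derive_mul QtD supD) (bD i)) (bD j)))
  (is_derive_opp (is_derive_mul ktD (is_derive_add (is_derive_mul (bD j) (mixD i)) (is_derive_mul (bD i) (mixD j))))))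
  (is_derive_mul (is_derive_mul rtD bupD) (is_derive_add (is_derive_mul (sD i) (bD j)) (is_derive_mul (sD j) (bD i)))).
exact: derivableP.
Qed.

Lemma ricci_deformed : ricci gb x y = ricci g x y + div_deformation
  - (2 * h1 * si ^+ 2 + h (t x) * (w * al - mu / w * si ^+ 2))
  + h (t x) * (2 * P (t x) * si ^+ 2 - P (t x) * al * w * t x + Q (t x) * be ^+ 2 * w * t x
      + 2 * ka (t x) * w * be ^+ 2)
  - \tr (difference_mx (g x) (ginv g x) (cov_mx g b x) (b x) (s_row g b x) y
        (P (t x)) (Q (t x)) (ka (t x)) (r (t x))
      *m difference_mx (g x) (ginv g x) (cov_mx g b x) (b x) (s_row g b x) y
        (P (t x)) (Q (t x)) (ka (t x)) (r (t x))).
Proof.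
have chr k i j z : U z -> christoffel gb k i j z = christoffel g k i j z + C z k i j.
  exact: (christoffel_deformed oU gC gsym gunit bC bK gbsym gbunit gbE ED kaD D0).
have -> : ricci gb x y = ricci_form (fun k i j => gamma g x k i j + C x k i j)
    (fun u k i j => dv u (christoffel g k i j) x + dv u (fun z => C z k i j) x) (y 0).
  rewrite ricci_ricci_form.
  have -> : gamma gb x = (fun k i j => gamma g x k i j + C x k i j).
    apply/funext => k; apply/funext => i; apply/funext => j; exact: chr.
  congr (ricci_form _ _ _).
  apply/funext => u; apply/funext => k; apply/funext => i; apply/funext => j.
  rewrite (partial_near_eq u oU Ux (chr k i j)).
  exact: partialE (is_derive_add (christoffel_derive oU gC gsym gunit u k i j Ux)
    (is_derive_deformation u k i j)).
have [dQ QfD QfE] := has_div_Qfield.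
have idD : is_derive (t x) 1 (fun u : R => u) (1 : R) by exact: is_derive_id.
have hD : is_derive (t x) 1 h h1.
  apply: (is_derive_eq (is_derive_add (is_derive_add (is_derive_mul
    (is_derive_const (n%:R : R) (t x : R) 1) PD) (is_derive_opp (kaD Ux)))
    (is_derive_mul rD idD))).
  by rewrite mul0r add0r mulr1 /h1.
have TD k : is_derive x (ev k) (fun z => h (t z) * sigma z)
    (2 * h1 * si * s_i g b k x + h (t x) * dsigma g b x y k).
  apply: (is_derive_eq (is_derive_mul (is_derive_comp1 hD (tD k))
    (is_derive_sigma oU gC gsym gunit bC bK y Ux k))).
  by rewrite -/(sigma x) sigma_x; move: (dsigma _ _ _ _ _) => d; ring.
have := @ricci_form_difference R n (gamma g x) x (y 0)
  (fun k i j z => C z k i j)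
  (fun u k i j => dv u (christoffel g k i j) x) (fun u k i j => dv u (fun z => C z k i j) x)
  (fun k i j => deformation_tensor_sym b gsym P ka ka1 k i j Ux)
  is_derive_deformation U Qfield (fun z => h (t z) * sigma z) dQ _ oU Ux
  (fun k z _ => deformation_quad k z) deformation_trace_pairing QfD TD.
move=> ->; rewrite -ricci_ricci_form QfE.
have -> : \sum_l y 0 l * (2 * h1 * si * s_i g b l x + h (t x) * dsigma g b x y l) =
    2 * h1 * si ^+ 2 + h (t x) * (w * al - mu / w * si ^+ 2).
  rewrite -(sum_dsigma_y oU gC gsym gunit bC bK y Ux wE SS hR).
  rewrite (eq_bigr (fun l => 2 * h1 * si * (s_i g b l x * y 0 l)
     + h (t x) * (dsigma g b x y l * y 0 l))).
    by rewrite big_split /= -!big_distrr /= sum_s_y -/si; ring.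
  by move=> l _; move: (dsigma _ _ _ _ _) => d; ring.
have -> : \sum_m conn_trace (fun k i => [eta C x k i]) m * Qfield m x =
    h (t x) * (2 * P (t x) * si ^+ 2 - P (t x) * al * w * t x + Q (t x) * be ^+ 2 * w * t x
      + 2 * ka (t x) * w * be ^+ 2).
  rewrite (eq_bigr (fun m => h (t x) * (2 * P (t x) * si * (s_i g b m x * y 0 m)
     + (Q (t x) * be ^+ 2 - P (t x) * al) * (s_i g b m x * s_raise g b m x)
     - 2 * ka (t x) * be * (s_i g b m x * s_vec g b x y m x)
     + 2 * r (t x) * si * be * (s_i g b m x * bup g b m x)))); last first.
    move=> m _.
    have -> : conn_trace (fun k i => [eta C x k i]) m = h (t x) * s_i g b m x.
      rewrite -deformation_trace //; apply: eq_bigr => k _.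
      exact: (deformation_tensor_sym b gsym P ka ka1 k k m Ux).
    rewrite /Qfield sigma_x beta_x quad_x parallel_ext_at.
    move: (s_i _ _ _ _) (s_raise _ _ _ _) (s_vec _ _ _ _ _ _) (bup _ _ _ _) => s1 s2 s3 s4.
    ring.
  rewrite -big_distrr !(big_split, sumrN) /= -!big_distrr /= sum_s_y.
  rewrite (sum_s_s_raise gsym gunit bK Ux wE SS) (sum_s_svec gsym gunit bK y Ux wE SS).
  by rewrite (sum_s_bup gsym bK Ux) -/si -/be -/(t x); ring.
congr (_ - _); apply: eq_bigr => k _; rewrite [RHS]mxE; apply: eq_bigr => m _.
have D k' m' : conn_mx (fun k i => [eta C x k i]) (y 0) k' m' =
   difference_mx (g x) (ginv g x) (cov_mx g b x) (b x) (s_row g b x) y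
        (P (t x)) (Q (t x)) (ka (t x)) (r (t x)) k' m'.
  rewrite diff_tensor_mx difference_mxE -s_raiseE -bupE -s_mixedE !s_rowi.
  have -> : (y *m g x) 0 m' = \sum_i g x i m' * y 0 i.
    by rewrite mxE; apply: eq_bigr => i _; rewrite mulrC.
  have -> : (ginv g x *m cov_mx g b x *m y^T) k' 0 = \sum_i s_mixed g b k' i x * y 0 i.
    by rewrite mxE; apply: eq_bigr => i _; rewrite -s_mixedE mxE.
  by rewrite sum_s_y sum_b_y.
by rewrite !D.
Qed.

End DeformedRicci.

(** * The coefficients X, Y and Z *)

Section EinsteinDefect.
Context {R : realFieldType}.
Variables (N a mu mb t e k k1 k2 f1 f2 al B Sg : R).
Let w := a ^+ 2 - mu * t.
Let d := 1 - t * k.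
Let d1 := - k - t * k1.
Let d2 := - (2 * k1) - t * k2.
Let p := 1 + 2 * t * f1.
Let p' := 2 * f1 + 2 * t * f2.
Let P := 2 * f1.
Let P1 := 2 * f2.
Let Q := k1 + P * k.
Let Q1 := k2 + (P1 * k + P * k1).
Let r := - (k1 + k ^+ 2) / d.
Let r1 := - (k2 + 2 * k * k1) / d + (k1 + k ^+ 2) * d1 / d ^+ 2.
Let h := N * P - k + r * t.
Let h1 := N * P1 - k1 + (r1 * t + r).
Let Hyy := w * al - mu / w * Sg.

(** Here [N] stands for n, [mb] for mubar, [e] for e^{2 rho}, [k], [k1], [k2] for kappa and its
    derivatives, [f1], [f2] for rho' and rho'', and [al], [B], [Sg] for alpha^2, beta^2 and s_0^2.
    The logarithmic derivative of e^{2 rho} gives P = 2 rho'. The left side is the Ricci curvature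
    of the deformed metric, term by term as in [ricci_deformed], minus (n - 1) mubar times the
    squared deformed norm; the right side is X alpha^2 + Y beta^2 + Z s_0^2. *)
Lemma einstein_defect : t != 0 -> d != 0 -> w != 0 ->
  (N - 1) * mu * al
  + (2 * (2 * P1 * Sg + P * Hyy) - (2 * P1 * w * t * al + P * al * (N * w - mu * t))
     + (2 * Q1 * w * t * B + 2 * Q * w * B + Q * B * (N * w - mu * t))
     + (4 * k1 * w * B + 2 * k * (a ^+ 2 * al - mu * B - mu / w * Sg)
        - 2 * k * B * (N - 1) * mu)
     + 2 * r * (w * B - Sg))
  - (2 * h1 * Sg + h * Hyy)
  + h * (2 * P * Sg - P * al * w * t + Q * B * w * t + 2 * k * w * B)
  - (N * P ^+ 2 * Sg + k ^+ 2 * B * (- N * a ^+ 2 + 2 * mu * t)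
     + (4 * k * P * w - 2 * k * Q * w * t + 2 * k * r * w * t - 2 * k ^+ 2 * w) * B
     + (2 * P * r * t - 2 * P * k) * Sg
     + (2 * P ^+ 2 + r ^+ 2 * t ^+ 2 + k ^+ 2) * Sg
     + 2 * P * w * t * (Q * B - P * al) + 2 * P * k * w * B
     + 2 * r * w * t * (Q * t - P) * B - 2 * k * r * t * Sg + 2 * k * r * w * t * B)
  - (N - 1) * mb * (e * (al - k * B)) =
  (t * d)^-1 * (a ^+ 2 * d * (N - 2 * d) + t * (mu * d - w * d1) * p
     - (N - 2) * w * d * p ^+ 2 - 2 * w * t * d * p' - (N - 1) * mb * t * d * e) * al
  - (t ^+ 2 * d)^-1 * (a ^+ 2 * d * (1 - d) * (N + (N - 2) * d)
     + (2 * a ^+ 2 - 3 * mu * t) * t * d * d1 - w * t ^+ 2 * d1 ^+ 2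
     + 2 * w * t ^+ 2 * d * d2 + mu * t * d * (1 - d) * p
     - w * t * (1 - (N - 1) * d) * d1 * p - (N - 2) * w * d * (1 - d) * p ^+ 2
     - 2 * w * t * d * (1 - d) * p' - (N - 1) * mb * t * d * (1 - d) * e) * B
  - (w * t ^+ 2 * d ^+ 2)^-1 * (a ^+ 2 * d ^+ 2 * (N - 2 * d)
     + (2 * a ^+ 2 - 3 * mu * t) * t * d * d1 - w * t ^+ 2 * d1 ^+ 2
     + 2 * w * t ^+ 2 * d * d2 - (N - 2) * mu * t * d ^+ 2 * p
     - (N - 2) * w * d ^+ 2 * p ^+ 2 + 2 * (N - 2) * w * t * d ^+ 2 * p') * Sg.
Proof.
move=> t0 d0 w0.
rewrite /Hyy /h /h1 /r /r1 /Q /Q1 /P /P1 /p /p' /d1 /d2.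
rewrite /w /d in t0 d0 w0 *.
field.
by rewrite t0 d0 w0.
Qed.
End EinsteinDefect.

(** * Continuity of the Ricci curvature in the base point *)

Section Continuity.
Context {R : realType} {V : normedModType R}.
Implicit Types (f h : V -> R) (x : V).

Lemma continuous_add f h x : {for x, continuous f} -> {for x, continuous h} ->
  {for x, continuous (fun z => f z + h z)}.
Proof. by move=> cf ch; exact: cvgD. Qed.

Lemma continuous_opp f x : {for x, continuous f} -> {for x, continuous (fun z => - f z)}.
Proof. by move=> cf; exact: cvgN. Qed.

Lemma continuous_mul f h x : {for x, continuous f} -> {for x, continuous h} ->
  {for x, continuous (fun z => f z * h z)}.
Proof. by move=> cf ch; exact: cvgM. Qed.

Lemma continuous_inv f x : f x != 0 -> {for x, continuous f} ->
  {for x, continuous (fun z => (f z)^-1)}.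
Proof. by move=> f0 cf; exact: cvgV. Qed.

Lemma continuous_const (c : R) x : {for x, continuous (fun _ : V => c)}.
Proof. exact: cvg_cst. Qed.

Lemma continuous_bigsum (I : Type) (s : seq I) (Q : pred I) (f : I -> V -> R) x :
  (forall i, {for x, continuous (f i)}) ->
  {for x, continuous (fun z => \sum_(i <- s | Q i) f i z)}.
Proof.
move=> cf; elim: s => [|i s IH].
  rewrite (_ : (fun _ => _) = (fun _ => 0)); first exact: continuous_const.
  by apply/funext => z; rewrite big_nil.
rewrite (_ : (fun _ => _) = (fun z => if Q i then
  f i z + \sum_(i <- s | Q i) f i z else \sum_(i <- s | Q i) f i z)); last first.
  by apply/funext => z; rewrite big_cons.
by case: (Q i) => //; exact: continuous_add.
Qed.

Lemma continuous_bigprod (I : Type) (s : seq I) (Q : pred I) (f : I -> V -> R) x :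
  (forall i, {for x, continuous (f i)}) ->
  {for x, continuous (fun z => \prod_(i <- s | Q i) f i z)}.
Proof.
move=> cf; elim: s => [|i s IH].
  rewrite (_ : (fun _ => _) = (fun _ => 1)); first exact: continuous_const.
  by apply/funext => z; rewrite big_nil.
rewrite (_ : (fun _ => _) = (fun z => if Q i then
  f i z * \prod_(i <- s | Q i) f i z else \prod_(i <- s | Q i) f i z)); last first.
  by apply/funext => z; rewrite big_cons.
by case: (Q i) => //; exact: continuous_mul.
Qed.

Lemma continuous_det p (F : V -> 'M[R]_p) x :
  (forall i j, {for x, continuous (fun z => F z i j)}) ->
  {for x, continuous (fun z => \det (F z))}.
Proof.
move=> cF; apply: (@continuous_bigsum _ _ _ (fun (s : 'S_p) z => (-1) ^+ s * \prod_i F z i (s i))) => s.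
apply: continuous_mul; first exact: continuous_const.
exact: continuous_bigprod.
Qed.

End Continuity.

Section RicciContinuity.
Context {R : realType} {n : nat}.
Notation dv j f := (@partial R n R j f).
Notation ev j := (delta_mx 0 j : 'rV[R]_n).
Variables (U : set 'rV[R]_n) (g : 'rV[R]_n -> 'M[R]_n).
Hypotheses (oU : open U)
  (gC : forall i j, Ck_on 2 U (fun z => g z i j : R))
  (gsym : forall x i j, U x -> g x i j = g x j i)
  (gunit : forall x, U x -> g x \in unitmx).
Implicit Types (x y : 'rV[R]_n) (i j k l m p q : 'I_n).

Lemma continuous_ginv i j x : U x -> {for x, continuous (fun z => ginv g z i j)}.
Proof.
move=> Ux.
apply: (@continuous_near_eq _ _ _ _ (fun z => (\det (g z))^-1 * cofactor (g z) j i)).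
  apply: near_open_eq oU Ux _ => z Uz.
  by rewrite /ginv /invmx gunit // !mxE.
have gc k l := Ck_continuous (gC k l) Ux.
apply: continuous_mul.
  apply: continuous_inv; last exact: continuous_det.
  by have := gunit Ux; rewrite unitmxE unitfE.
apply: continuous_mul; first exact: continuous_const.
apply: continuous_det => k l.
rewrite (_ : (fun z => _) = (fun z => g z (lift j k) (lift i l))) //.
by apply/funext => z; rewrite !mxE.
Qed.

Lemma continuous_partial k i j x : U x -> {for x, continuous (dv k (fun z => g z i j))}.
Proof. by move=> Ux; exact: Ck_continuous (Ck_partial k (gC i j)) Ux. Qed.

Lemma continuous_christoffel k i j x : U x -> {for x, continuous (christoffel g k i j)}.
Proof.
move=> Ux; apply: continuous_mul; first exact: continuous_const.
apply: continuous_bigsum => l; apply: continuous_mul; first exact: continuous_ginv.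
apply: continuous_add; last by apply: continuous_opp; exact: continuous_partial.
by apply: continuous_add; exact: continuous_partial.
Qed.

(** The right-hand side involves only the inverse metric and partial derivatives of g up to order
    two, so its continuity follows from the C^2 hypothesis. *)
Lemma partial_christoffel l k i j x : U x -> dv l (christoffel g k i j) x =
  2^-1 * \sum_m (- (\sum_q (christoffel g k l q x * ginv g x q m
        + christoffel g m l q x * ginv g x k q))
      * (dv i (fun z => g z j m) x + dv j (fun z => g z i m) x - dv m (fun z => g z i j) x)
    + ginv g x k m * (dv l (dv i (fun z => g z j m)) x + dv l (dv j (fun z => g z i m)) x
        - dv l (dv m (fun z => g z i j)) x)).
Proof.
move=> Ux.
have D a b c : is_derive x (ev l) (dv a (fun z => g z b c)) (dv l (dv a (fun z => g z b c)) x).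
  exact: Ck_derive (Ck_partial _ (gC _ _)) Ux.
have H := is_derive_mul (is_derive_const (2^-1 : R) x (ev l))
  (is_derive_bigsum (index_enum 'I_n) (P := predT) (fun m _ => is_derive_mul
     (partial_ginv oU gC gsym gunit l k m Ux)
     (is_derive_add (is_derive_add (D i j m) (D j i m)) (is_derive_opp (D m i j))))).
have [_ E] := H; rewrite mul0r add0r in E.
exact: E.
Qed.

Lemma continuous_partial_christoffel l k i j x : U x ->
  {for x, continuous (dv l (christoffel g k i j))}.
Proof.
move=> Ux; have C2 a b c : {for x, continuous (dv l (dv a (fun z => g z b c)))}.
  exact: Ck_continuous (Ck_partial l (Ck_partial a (gC b c))) Ux.
apply: (@continuous_near_eq _ _ _ _ (fun x => 2^-1 * \sum_m (- (\sum_q (christoffel g k l q x * ginv g x q m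
        + christoffel g m l q x * ginv g x k q))
      * (dv i (fun z => g z j m) x + dv j (fun z => g z i m) x - dv m (fun z => g z i j) x)
    + ginv g x k m * (dv l (dv i (fun z => g z j m)) x + dv l (dv j (fun z => g z i m)) x
        - dv l (dv m (fun z => g z i j)) x)))).
  by apply: near_open_eq oU Ux _ => z Uz; rewrite partial_christoffel.
apply: continuous_mul; first exact: continuous_const.
apply: continuous_bigsum => m; apply: continuous_add.
  apply: continuous_mul.
    apply: continuous_opp; apply: continuous_bigsum => q; apply: continuous_add;
      by apply: continuous_mul; first [exact: continuous_christoffel|exact: continuous_ginv].
  apply: continuous_add; last by apply: continuous_opp; exact: continuous_partial.
  by apply: continuous_add; exact: continuous_partial.
apply: continuous_mul; first exact: continuous_ginv.
apply: continuous_add; last by apply: continuous_opp.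
exact: continuous_add.
Qed.

Lemma continuous_ricci y x : U x -> {for x, continuous (fun z => ricci g z y)}.
Proof.
move=> Ux; rewrite (_ : (fun z => ricci g z y) = (fun z => \sum_k \sum_j \sum_l
   (dv k (christoffel g k j l) z - dv l (christoffel g k j k) z
    + \sum_m (christoffel g k k m z * christoffel g m j l z
      - christoffel g k l m z * christoffel g m j k z)) * y 0 j * y 0 l)); last by [].
do 3! (apply: continuous_bigsum => ?).
apply: continuous_mul; last exact: continuous_const.
apply: continuous_mul; last exact: continuous_const.
apply: continuous_add.
  apply: continuous_add; first exact: continuous_partial_christoffel.
  by apply: continuous_opp; exact: continuous_partial_christoffel.
apply: continuous_bigsum => m; apply: continuous_add; last apply: continuous_opp;
  by apply: continuous_mul; exact: continuous_christoffel.
Qed.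

End RicciContinuity.

(** * Derivatives and continuity of the coefficients as functions of b^2 *)

Section OneVariable.
Context {R : realType}.
Variables (D : set R) (rho kappa : R -> R).
Hypotheses (oD : open D) (rhoS : smooth1_on D rho) (kappaS : smooth1_on D kappa).
Implicit Types (u : R).

Lemma near_open_eq1 u (f h : R -> R) : D u -> (forall v, D v -> f v = h v) ->
  {near u, f =1 h}.
Proof.
move=> Du fh; have : \forall v \near u, D v by exact: open_nbhs_nbhs.
by apply: filterS => v; exact: fh.
Qed.

Lemma smooth_is_derive f k u : smooth1_on D f -> D u ->
  is_derive u 1 (derive1n k f) (derive1n k.+1 f u).
Proof.
move=> fS Du; have := derivableP (fS k u Du).
by rewrite -derive1E -derive1nS.
Qed.

Lemma derive1_is_derive (f : R -> R) u a : is_derive u 1 f a -> derive1 f u = a.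
Proof. by move=> [_ <-]; rewrite derive1E. Qed.

Lemma continuous_is_derive (f : R -> R) u a : is_derive u 1 f a -> {for u, continuous f}.
Proof. by move=> [/derivable1_diffP/differentiable_continuous]. Qed.

Lemma is_derive_Delta u : D u ->
  is_derive u 1 (Delta kappa) (- kappa u - u * derive1 kappa u).
Proof.
move=> Du; have idD : is_derive u 1 (fun v : R => v) (1 : R) by exact: is_derive_id.
apply: (is_derive_eq (is_derive_add (is_derive_const (1 : R) u 1)
  (is_derive_opp (is_derive_mul idD (smooth_is_derive 0 kappaS Du))))).
by rewrite derive1n1 /=; ring.
Qed.

Lemma derive1_Delta u : D u -> derive1 (Delta kappa) u = - kappa u - u * derive1 kappa u.
Proof. by move=> Du; exact/derive1_is_derive/is_derive_Delta. Qed.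

Lemma is_derive_derive1_Delta u : D u -> is_derive u 1 (derive1 (Delta kappa))
  (- (2 * derive1 kappa u) - u * derive1n 2 kappa u).
Proof.
move=> Du; have idD : is_derive u 1 (fun v : R => v) (1 : R) by exact: is_derive_id.
apply: (@near_eq_is_derive _ _ _ (fun u => - kappa u - u * derive1 kappa u)).
  by apply: near_open_eq1 => // v Dv; rewrite derive1_Delta.
apply: (is_derive_eq (is_derive_add (is_derive_opp (smooth_is_derive 0 kappaS Du))
  (is_derive_opp (is_derive_mul idD (smooth_is_derive 1 kappaS Du))))).
by rewrite derive1n1 /=; ring.
Qed.

Lemma derive2_Delta u : D u ->
  derive1n 2 (Delta kappa) u = - (2 * derive1 kappa u) - u * derive1n 2 kappa u.
Proof. by move=> Du; apply: derive1_is_derive; exact: is_derive_derive1_Delta. Qed.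

Lemma is_derive_P_fun u : D u ->
  is_derive u 1 (P_fun rho) (2 * derive1 rho u + 2 * u * derive1n 2 rho u).
Proof.
move=> Du; have idD : is_derive u 1 (fun v : R => v) (1 : R) by exact: is_derive_id.
apply: (is_derive_eq (is_derive_add (is_derive_const (1 : R) u 1)
  (is_derive_mul (is_derive_mul (is_derive_const (2 : R) u 1) idD) (smooth_is_derive 1 rhoS Du)))).
by rewrite derive1n1 /=; ring.
Qed.

Lemma derive1_P_fun u : D u ->
  derive1 (P_fun rho) u = 2 * derive1 rho u + 2 * u * derive1n 2 rho u.
Proof. by move=> Du; apply: derive1_is_derive; exact: is_derive_P_fun. Qed.

Lemma is_derive_exp_rho u : D u -> is_derive u 1 (fun u => expR (2 * rho u))
  (2 * derive1 rho u * expR (2 * rho u)).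
Proof.
move=> Du; have H : is_derive u 1 (fun v => 2 * rho v) (2 * derive1 rho u).
  apply: (is_derive_eq (is_derive_mul (is_derive_const (2 : R) u 1) (smooth_is_derive 0 rhoS Du))).
  by rewrite derive1n1 mul0r add0r.
have H' := is_derive_comp1 (f := fun v => 2 * rho v) (is_derive_expR (2 * rho u)) H.
by apply: (is_derive_eq H'); rewrite mulrC.
Qed.

Lemma continuous_sqr (f : R -> R) u : {for u, continuous f} ->
  {for u, continuous (fun v => f v ^+ 2)}.
Proof. by move=> cf; apply: continuous_mul. Qed.

Section Shapes.
Variables (d d1 d2 p p1 e : R -> R) (N a mu mb u : R).
Hypotheses (cd : {for u, continuous d}) (cd1 : {for u, continuous d1})
  (cd2 : {for u, continuous d2}) (cp : {for u, continuous p})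
  (cp1 : {for u, continuous p1}) (ce : {for u, continuous e}).

Let cid : {for u, continuous (fun v : R => v)}.
Proof. exact: cvg_id. Qed.

Let K (c : R) : {for u, continuous (fun _ : R => c)}.
Proof. exact: continuous_const. Qed.

Let cA (f f' : R -> R) : {for u, continuous f} -> {for u, continuous f'} ->
  {for u, continuous (fun v : R => f v + f' v)}.
Proof. exact: continuous_add. Qed.

Let cM (f f' : R -> R) : {for u, continuous f} -> {for u, continuous f'} ->
  {for u, continuous (fun v : R => f v * f' v)}.
Proof. exact: continuous_mul. Qed.

Let cN (f : R -> R) : {for u, continuous f} -> {for u, continuous (fun v : R => - f v)}.
Proof. exact: continuous_opp. Qed.

Let cV (f : R -> R) : f u != 0 -> {for u, continuous f} ->
  {for u, continuous (fun v : R => (f v)^-1)}.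
Proof. exact: continuous_inv. Qed.

Let cS (f : R -> R) : {for u, continuous f} -> {for u, continuous (fun v : R => f v ^+ 2)}.
Proof. exact: continuous_sqr. Qed.

Let cw : {for u, continuous (fun v : R => a ^+ 2 - mu * v)}.
Proof. exact: (cA (@K (a ^+ 2)) (cN (cM (@K mu) cid))). Qed.

Let c1d : {for u, continuous (fun v => 1 - d v)}.
Proof. exact: (cA (@K 1) (cN cd)). Qed.

(** Delta, 1 + 2 t rho', e^{2 rho} and the derivatives are replaced by arbitrary continuous
    functions, which separates the form of the expression from the regularity of its ingredients. *)
Lemma continuous_X_shape : u * d u != 0 ->
  {for u, continuous (fun t : R => (t * d t)^-1 * (a ^+ 2 * d t * (N - 2 * d t)
     + t * (mu * d t - (a ^+ 2 - mu * t) * d1 t) * p t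
     - (N - 2) * (a ^+ 2 - mu * t) * d t * p t ^+ 2
     - 2 * (a ^+ 2 - mu * t) * t * d t * p1 t
     - (N - 1) * mb * t * d t * e t))}.
Proof.
move=> den0.
have T1 := cM (cM (@K (a ^+ 2)) cd)
  (cA (@K N) (cN (cM (@K 2) cd))).
have T2 := cM (cM cid (cA (cM (@K mu) cd)
  (cN (cM cw cd1)))) cp.
have T3 := cM (cM (cM (@K (N - 2)) cw) cd) (cS cp).
have T4 := cM (cM (cM (cM (@K 2) cw) cid) cd) cp1.
have T5 := cM (cM (cM (@K ((N - 1) * mb)) cid) cd) ce.
exact: (cM (cV den0 (cM cid cd))
  (cA (cA (cA (cA T1 T2)
    (cN T3)) (cN T4)) (cN T5))).
Qed.

Lemma continuous_Y_shape : u ^+ 2 * d u != 0 ->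
  {for u, continuous (fun t : R => - (t ^+ 2 * d t)^-1 *
  (a ^+ 2 * d t * (1 - d t) * (N + (N - 2) * d t)
   + (2 * a ^+ 2 - 3 * mu * t) * t * d t * d1 t
   - (a ^+ 2 - mu * t) * t ^+ 2 * d1 t ^+ 2
   + 2 * (a ^+ 2 - mu * t) * t ^+ 2 * d t * d2 t
   + mu * t * d t * (1 - d t) * p t
   - (a ^+ 2 - mu * t) * t * (1 - (N - 1) * d t) * d1 t * p t
   - (N - 2) * (a ^+ 2 - mu * t) * d t * (1 - d t) * p t ^+ 2
   - 2 * (a ^+ 2 - mu * t) * t * d t * (1 - d t) * p1 t
   - (N - 1) * mb * t * d t * (1 - d t) * e t))}.
Proof.
move=> den0; have ct2 := cS cid.
have S1 := cM (cM (cM (@K (a ^+ 2)) cd) c1d)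
  (cA (@K N) (cM (@K (N - 2)) cd)).
have S2 := cM (cM (cM
  (cA (@K (2 * a ^+ 2)) (cN (cM (@K (3 * mu)) cid))) cid) cd) cd1.
have S3 := cM (cM cw ct2) (cS cd1).
have S4 := cM (cM (cM (cM (@K 2) cw) ct2) cd) cd2.
have S5 := cM (cM (cM (cM (@K mu) cid) cd) c1d) cp.
have S6 := cM (cM (cM (cM cw cid)
  (cA (@K 1) (cN (cM (@K (N - 1)) cd)))) cd1) cp.
have S7 := cM (cM (cM (cM (@K (N - 2)) cw) cd) c1d)
  (cS cp).
have S8 := cM (cM (cM (cM
  (cM (@K 2) cw) cid) cd) c1d) cp1.
have S9 := cM (cM (cM (cM
  (@K ((N - 1) * mb)) cid) cd) c1d) ce.
exact: (cM (cN (cV den0 (cM ct2 cd)))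
  (cA (cA (cA (cA (cA
    (cA (cA (cA S1 S2) (cN S3)) S4) S5)
    (cN S6)) (cN S7)) (cN S8)) (cN S9))).
Qed.

End Shapes.

Section Coefficients.
Variables (n : nat) (a mu mubar u : R).
Hypotheses (Du : D u) (u0 : u != 0) (d0 : Delta kappa u != 0).

Let cid : {for u, continuous (fun v : R => v)}.
Proof. exact: cvg_id. Qed.

Let cD : {for u, continuous (Delta kappa)}.
Proof. exact: continuous_is_derive (is_derive_Delta Du). Qed.

Let cD1 : {for u, continuous (derive1 (Delta kappa))}.
Proof. exact: continuous_is_derive (is_derive_derive1_Delta Du). Qed.

Let cD2 : {for u, continuous (derive1n 2 (Delta kappa))}.
Proof.
have cf : {for u, continuous (fun u => - (2 * derive1 kappa u) - u * derive1n 2 kappa u)}.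
  apply: continuous_add; apply: continuous_opp; apply: continuous_mul => //.
  - exact: continuous_const.
  - by have := continuous_is_derive (smooth_is_derive 1 kappaS Du).
  - exact: continuous_is_derive (smooth_is_derive 2 kappaS Du).
rewrite /prop_for /continuous_at derive2_Delta //.
apply: cvg_trans cf; apply: near_eq_cvg.
by apply: near_open_eq1 => // v Dv; rewrite derive2_Delta.
Qed.

Let cP : {for u, continuous (P_fun rho)}.
Proof. exact: continuous_is_derive (is_derive_P_fun Du). Qed.

Let cP1 : {for u, continuous (derive1 (P_fun rho))}.
Proof.
have cf : {for u, continuous (fun u => 2 * derive1 rho u + 2 * u * derive1n 2 rho u)}.
  apply: continuous_add; apply: continuous_mul.
  - exact: continuous_const.
  - by have := continuous_is_derive (smooth_is_derive 1 rhoS Du).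
  - by apply: continuous_mul => //; exact: continuous_const.
  - exact: continuous_is_derive (smooth_is_derive 2 rhoS Du).
rewrite /prop_for /continuous_at derive1_P_fun //.
apply: cvg_trans cf; apply: near_eq_cvg.
by apply: near_open_eq1 => // v Dv; rewrite derive1_P_fun.
Qed.

Let cE : {for u, continuous (fun u => expR (2 * rho u))}.
Proof. exact: continuous_is_derive (is_derive_exp_rho Du). Qed.

Lemma continuous_X_fun : {for u, continuous (X_fun n a mu mubar rho kappa)}.
Proof. by apply: continuous_X_shape cD cD1 cP cP1 cE _; rewrite mulf_neq0. Qed.

Lemma continuous_Y_fun : {for u, continuous (Y_fun n a mu mubar rho kappa)}.
Proof.
by apply: continuous_Y_shape cD cD1 cD2 cP cP1 cE _; rewrite mulf_neq0 // expf_neq0.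
Qed.

End Coefficients.

End OneVariable.

Lemma closure_zero (R : realType) (V : normedModType R) (A : set V) (f : V -> R) (x : V) :
  {for x, continuous f} -> closure A x -> (forall z, A z -> f z = 0) -> f x = 0.
Proof.
move=> fc Ax f0; apply/eqP/negPn/negP => fx0.
have fx : 0 < `|f x| by rewrite normr_gt0.
have /cvgrPdist_lt/(_ _ fx) near_x := fc.
have [z [Az]] := Ax _ near_x.
by rewrite /= (f0 z Az) subr0 ltxx.
Qed.

(** * Passage to the whole manifold *)

Section PositiveDefinite.
Context {R : realType} {n : nat}.
Implicit Types (A : 'M[R]_n) (y : 'rV[R]_n).

Lemma qform_mx A y : (y *m A *m y^T) 0 0 = qform (fun i j => A i j) (y 0).
Proof.
rewrite mxE /qform exchange_big; apply: eq_bigr => j _ /=; rewrite mxE big_distrl /=.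
by apply: eq_bigr => i _; rewrite mxE; ring.
Qed.

Lemma qform_pr A y : qform (fun i j => A i j) (y 0) = pr y (A *m y^T).
Proof. by rewrite -qform_mx /pr mulmxA. Qed.

Lemma row_of_fun (y' : 'I_n -> R) : exists y : 'rV[R]_n, y' = y 0.
Proof. by exists (\row_i y' i); apply/funext => k; rewrite mxE. Qed.

Lemma posdef_unitmx A : (forall y, y != 0 -> 0 < qform (fun i j => A i j) (y 0)) ->
  A \in unitmx.
Proof.
move=> Apos; rewrite -row_free_unit -kermx_eq0; apply/rowV0P => v /sub_kermxP vA.
apply/eqP/negPn/negP => /Apos; rewrite -qform_mx vA mul0mx mxE.
by rewrite ltxx.
Qed.

(** Two linear equations in more than two unknowns: the kernel of an n by 2 matrix has dimension at
    least n - 2. *)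
Lemma common_zero (u v : 'rV[R]_n) : (2 < n)%N ->
  exists y : 'rV[R]_n, [/\ y != 0, pr u y^T = 0 & pr v y^T = 0].
Proof.
move=> n2; pose B : 'M[R]_(n, 1 + 1) := row_mx u^T v^T.
have : kermx B != 0.
  rewrite -mxrank_eq0 mxrank_ker subn_eq0 -ltnNge.
  exact: leq_ltn_trans (rank_leq_col B) n2.
case/rowV0Pn => y /sub_kermxP; rewrite mul_mx_row -[0]row_mx0 => /eq_row_mx[yu yv] y0.
exists y; split=> //.
  by rewrite pr_tr trmxK /pr yu mxE.
by rewrite pr_tr trmxK /pr yv mxE.
Qed.

End PositiveDefinite.

(** * Both implications in a single chart *)

Section Chart.
Context {R : realType} {n : nat}.
Notation dv j f := (@partial R n R j f).
Notation ev j := (delta_mx 0 j : 'rV[R]_n).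
Variables (U : set 'rV[R]_n) (g gb : 'rV[R]_n -> 'M[R]_n) (b : 'rV[R]_n -> 'rV[R]_n).
Hypotheses (oU : open U)
  (gC : forall i j, Ck_on 2 U (fun z => g z i j : R))
  (gsym : forall x i j, U x -> g x i j = g x j i)
  (gpos : forall x (y : 'rV[R]_n), U x -> y != 0 -> 0 < qform (fun i j => g x i j) (y 0))
  (bC : forall i, Ck_on 2 U (fun z => b z 0 i : R))
  (bK : forall x i j, U x -> cov g b i j x + cov g b j i x = 0).
Implicit Types (x y z : 'rV[R]_n) (i j k l m : 'I_n).

Let gunit x : U x -> g x \in unitmx.
Proof. by move=> Ux; apply: posdef_unitmx => y; exact: gpos. Qed.

Lemma alpha_sq x y : U x -> alpha g x y ^+ 2 = qform (fun i j => g x i j) (y 0).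
Proof.
move=> Ux; rewrite sqr_sqrtr //; have [->|y0] := eqVneq y 0; last exact/ltW/gpos.
by rewrite big1 // => i _; rewrite big1 // => j _; rewrite !mxE mulr0.
Qed.

Lemma bup_qform x : U x -> norm2 g b x = qform (fun i j => g x i j) ((\row_i bup g b i x : 'rV[R]_n) 0).
Proof.
move=> Ux; apply: eq_bigr => i _; rewrite -(bup_lower b gunit i Ux) big_distrr /=.
by apply: eq_bigr => j _; rewrite !mxE; ring.
Qed.

Lemma norm2_ge0 x : U x -> 0 <= norm2 g b x.
Proof.
move=> Ux; rewrite bup_qform //; set v := \row_i _; have [->|v0] := eqVneq v 0.
  by rewrite /qform big1 // => i _; rewrite big1 // => j _; rewrite !mxE mulr0.
exact/ltW/gpos.
Qed.

Lemma norm2_eq0 x : U x -> norm2 g b x = 0 -> b x = 0.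
Proof.
move=> Ux t0; have v0 : \row_i bup g b i x == 0 :> 'rV[R]_n.
  by apply/negPn/negP => /(gpos Ux); rewrite -bup_qform // t0 ltxx.
apply/matrixP => o i; rewrite ord1 mxE -(bup_lower b gunit i Ux) big1 // => q _.
have /matrixP/(_ 0 q) := eqP v0; rewrite !mxE => ->; exact: mulr0.
Qed.

Lemma blen_sq x : U x -> blen g b x ^+ 2 = norm2 g b x.
Proof. by move=> Ux; rewrite sqr_sqrtr //; exact: norm2_ge0. Qed.

Lemma continuous_norm2 x : U x -> {for x, continuous (norm2 g b)}.
Proof.
move=> Ux; have bc i := Ck_continuous (bC i) Ux.
apply: continuous_bigsum => i; apply: continuous_mul => //.
apply: continuous_bigsum => j; apply: continuous_mul => //.
by apply: (@continuous_ginv R n U g).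
Qed.

Lemma s0_pr x y : s0 g b x y = pr (s_row g b x) y^T.
Proof. by rewrite /s0 /pr mxE; apply: eq_bigr => i _; rewrite !mxE. Qed.

Lemma beta_pr x y : beta b x y = pr (b x) y^T.
Proof. by rewrite /beta /pr mxE; apply: eq_bigr => i _; rewrite !mxE. Qed.

Lemma t_ijE x i j : U x -> t_ij g b i j x = (cov_mx g b x *m ginv g x *m cov_mx g b x) i j.
Proof.
move=> Ux; rewrite -mulmxA mxE; apply: eq_bigr => m _.
rewrite mxE (s_ijE bK) //; congr (_ * _); rewrite mxE; apply: eq_bigr => k _.
by rewrite (s_ijE bK) // mxE.
Qed.

Lemma t00_qform x y : t00 g b x y = qform (fun i j => t_ij g b i j x) (y 0).
Proof. by []. Qed.

Variables (a mu mubar : R).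
Let t := norm2 g b.
Let w z := a ^+ 2 - mu * t z.
Hypotheses
  (hEin : forall x y, U x -> ricci g x y = (n%:R - 1) * mu * alpha g x y ^+ 2)
  (hT : forall x y, U x -> exists2 L : R, s0_term g b a mu x y L &
       t00 g b x y + (a ^+ 2 - mu * blen g b x ^+ 2) * alpha g x y ^+ 2
       + mu * (blen g b x ^+ 2 * alpha g x y ^+ 2 - beta b x y ^+ 2) - mu * L = 0)
  (hRb : forall x y, U x -> Rbb g b x y
     = mu * (blen g b x ^+ 2 * alpha g x y ^+ 2 - beta b x y ^+ 2)).

(** The condition on t_00, polarised: where w is nonzero the limit in [s0_term] is an actual
    quotient, and both sides are symmetric matrices with the same quadratic form. The left side is
    symmetric because the antisymmetric matrix of b_{i|j} occurs in it twice. *)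
Lemma shift_identity x : U x -> w x != 0 ->
  cov_mx g b x *m ginv g x *m cov_mx g b x = - a ^+ 2 *: g x
     + mu *: ((b x)^T *m b x) + (mu / w x) *: ((s_row g b x)^T *m s_row g b x).
Proof.
move=> Ux w0; apply/matrixP => i j; rewrite -t_ijE //.
pose Tm := - a ^+ 2 *: g x + mu *: ((b x)^T *m b x) + (mu / w x) *: ((s_row g b x)^T *m s_row g b x).
have outer (v : 'rV[R]_n) i' j' : (v^T *m v) i' j' = v 0 i' * v 0 j'.
  by rewrite mxE big_ord1 mxE.
have TE i' j' : Tm i' j' = - a ^+ 2 * g x i' j' + mu * (b x 0 i' * b x 0 j')
    + mu / w x * (s_row g b x 0 i' * s_row g b x 0 j').
  by rewrite /Tm -!outer !mxE.
apply: (@qform_polar_sym R n (fun i j => t_ij g b i j x) (fun i j => Tm i j)).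
- move=> y'; have [y ->] := row_of_fun y'.
  have [L] := hT y Ux; rewrite /s0_term blen_sq // alpha_sq // -/(t x) -/(w x) w0 => ->.
  rewrite -t00_qform s0_pr beta_pr => H.
  have -> : qform (fun i j => Tm i j) (y 0) = - a ^+ 2 * qform (fun i j => g x i j) (y 0)
      + mu * pr (b x) y^T ^+ 2 + mu / w x * pr (s_row g b x) y^T ^+ 2.
    have sq (v : 'rV[R]_n) : pr v y^T ^+ 2 = \sum_i \sum_j v 0 i * v 0 j * y 0 i * y 0 j.
      rewrite expr2 /pr mxE big_distrlr; apply: eq_bigr => i' _; apply: eq_bigr => j' _ /=.
      by rewrite mxE [y^T j' 0]mxE; ring.
    rewrite !sq /qform !big_distrr -!big_split; apply: eq_bigr => i' _ /=.
    rewrite !big_distrr -!big_split; apply: eq_bigr => j' _ /=; rewrite TE; ring.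
  move: H; move: (qform _ _) (pr _ _) (pr _ _) (t00 _ _ _ _) => q p1 p2 q0 H.
  apply/eqP; rewrite -subr_eq0; apply/eqP; rewrite -[RHS]H /w; field.
  by rewrite -/(w x).
- have E : (cov_mx g b x *m ginv g x *m cov_mx g b x)^T = cov_mx g b x *m ginv g x *m cov_mx g b x.
    by rewrite !trmx_mul (cov_mx_tr bK Ux) (ginv_tr gsym Ux) !(mulNmx, mulmxN) opprK mulmxA.
  by move=> i' j'; rewrite !t_ijE // -[in LHS]E mxE.
- by move=> i' j'; rewrite !TE (gsym _ _ Ux); ring.
Qed.

Lemma curvature_identity x (y' : 'I_n -> R) : U x -> qform (fun j l => bcurv g b j l x) y' =
  mu * (t x * qform (fun i j => g x i j) y' - (\sum_i b x 0 i * y' i) ^+ 2).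
Proof.
move=> Ux; have [y ->] := row_of_fun y'.
by rewrite -RbbE hRb // blen_sq // alpha_sq.
Qed.

Lemma ricci_tensorE x j l : U x -> ricci_tensor g j l x = (n%:R - 1) * mu * g x j l.
Proof.
move=> Ux; move: j l; apply: qform_polar_sym => [y'|j l|j l].
- have [y ->] := row_of_fun y'.
  rewrite -ricci_qform hEin // alpha_sq // /qform big_distrr; apply: eq_bigr => i _ /=.
  by rewrite big_distrr; apply: eq_bigr => j _ /=; rewrite !mulrA.
- exact: (ricci_tensor_sym oU gC gsym gunit).
- by rewrite (gsym j l Ux).
Qed.

Variables (D : set R) (rho kappa : R -> R).
Hypotheses
  (gbC : forall i j, Ck_on 2 U (fun z => gb z i j : R))
  (gbsym : forall x i j, U x -> gb x i j = gb x j i)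
  (gbpos : forall x y, U x -> y != 0 -> 0 < qform (fun i j => gb x i j) (y 0))
  (oD : open D) (hD : forall x, U x -> D (blen g b x ^+ 2))
  (rhoS : smooth1_on D rho) (kappaS : smooth1_on D kappa)
  (hDelta : forall x, U x -> 0 < Delta kappa (blen g b x ^+ 2))
  (halpha : forall x y, U x -> alpha gb x y = expR (rho (blen g b x ^+ 2))
       * Num.sqrt (alpha g x y ^+ 2 - kappa (blen g b x ^+ 2) * beta b x y ^+ 2)).

Let gbunit x : U x -> gb x \in unitmx.
Proof. by move=> Ux; apply: posdef_unitmx => y; exact: gbpos. Qed.

Let Dt x : U x -> D (t x).
Proof. by move=> Ux; rewrite /t -blen_sq //; exact: hD. Qed.

Let D0 x : U x -> 1 - t x * kappa (t x) != 0.
Proof. by move=> Ux; rewrite /t -blen_sq // gt_eqF //; exact: hDelta. Qed.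

Lemma alpha_gb_sq x y : U x -> alpha gb x y ^+ 2 = qform (fun i j => gb x i j) (y 0).
Proof.
move=> Ux; rewrite sqr_sqrtr //; have [->|y0] := eqVneq y 0; last exact/ltW/gbpos.
by rewrite big1 // => i _; rewrite big1 // => j _; rewrite !mxE mulr0.
Qed.

Lemma qform_gb x y : U x -> qform (fun i j => gb x i j) (y 0) =
  expR (2 * rho (t x)) * (qform (fun i j => g x i j) (y 0) - kappa (t x) * pr (b x) y^T ^+ 2).
Proof.
move=> Ux; rewrite -alpha_gb_sq // halpha // blen_sq // -/(t x) alpha_sq // beta_pr.
rewrite exprMn -expRM_natl [2 * _]mulr_natl.
have [->|y0] := eqVneq y 0.
  have -> : qform (fun i j => g x i j) ((0 : 'rV[R]_n) 0) = 0.
    by rewrite /qform big1 // => i _; rewrite big1 // => j _; rewrite !mxE mulr0.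
  by rewrite trmx0 pr0r expr0n mulr0 subrr sqrtr0 expr0n.
congr (_ * _); rewrite sqr_sqrtr // ltW //.
(* [Num.sqrt] is 0 at nonpositive arguments; a nonpositive radicand at y <> 0 would make the
   deformed norm of y vanish, against the positivity of [gb]. *)
have := gbpos Ux y0; rewrite -alpha_gb_sq // halpha // blen_sq // -/(t x) alpha_sq // beta_pr.
rewrite ltNge; apply: contraNlt => /ler0_sqrtr ->.
by rewrite mulr0 expr0n.
Qed.

Lemma gbE x i j : U x -> gb x i j =
  expR (2 * rho (t x)) * (g x i j - kappa (t x) * b x 0 i * b x 0 j).
Proof.
move=> Ux; move: i j.
apply: (@qform_polar_sym R n (fun i j => gb x i j) (fun i j =>
  expR (2 * rho (t x)) * (g x i j - kappa (t x) * b x 0 i * b x 0 j))) => [y'|i j|i j].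
- have [y ->] := row_of_fun y'.
  rewrite qform_gb // expr2 /pr mxE big_distrlr /= /qform.
  rewrite [X in _ * (_ - X)]big_distrr -sumrB big_distrr; apply: eq_bigr => i _ /=.
  rewrite [X in _ * (_ - X)]big_distrr -sumrB big_distrr; apply: eq_bigr => j _ /=.
  by rewrite mxE [y^T j 0]mxE; ring.
- exact: gbsym.
- by rewrite (gsym i j Ux); ring.
Qed.

Lemma einstein_defect_at x y : U x -> t x != 0 -> w x != 0 ->
  ricci gb x y - (n%:R - 1) * mubar * alpha gb x y ^+ 2 =
  X_fun n a mu mubar rho kappa (t x) * qform (fun i j => g x i j) (y 0)
  + Y_fun n a mu mubar rho kappa (t x) * pr (b x) y^T ^+ 2
  + Z_fun n a mu rho kappa (t x) * pr (s_row g b x) y^T ^+ 2.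
Proof.
move=> Ux t0 w0.
have u0 := D0 Ux; have Du := Dt Ux.
have rD := smooth_is_derive 0 rhoS Du; have rD1 := smooth_is_derive 1 rhoS Du.
have kD := smooth_is_derive 0 kappaS; have kD1 := smooth_is_derive 1 kappaS Du.
pose P u := 2 * derive1 rho u.
have idD : is_derive (t x) 1 (fun v : R => v) (1 : R) by exact: is_derive_id.
have PD : is_derive (t x) 1 P (2 * derive1n 2 rho (t x)).
  apply: (is_derive_eq (is_derive_mul (is_derive_const (2 : R) (t x) 1) rD1)).
  by rewrite mul0r add0r.
have QD : is_derive (t x) 1 (fun u => derive1 kappa u + P u * kappa u)
    (derive1n 2 kappa (t x) + (2 * derive1n 2 rho (t x) * kappa (t x)
       + P (t x) * derive1 kappa (t x))).
  exact: (is_derive_add kD1 (is_derive_mul PD (kD _ Du))).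
have RD : is_derive (t x) 1 (fun u => - (derive1 kappa u + kappa u ^+ 2) / (1 - u * kappa u))
    (- (derive1n 2 kappa (t x) + 2 * kappa (t x) * derive1 kappa (t x)) / (1 - t x * kappa (t x))
     + (derive1 kappa (t x) + kappa (t x) ^+ 2)
       * (- kappa (t x) - t x * derive1 kappa (t x)) / (1 - t x * kappa (t x)) ^+ 2).
  have H := is_derive_mul (is_derive_opp (is_derive_add kD1 (is_derive_mul (kD _ Du) (kD _ Du))))
    (is_derive_inv (f := Delta kappa) u0 (is_derive_Delta kappaS Du)).
  apply: (is_derive_eq H); rewrite derive1n1 /Delta /=; field.
  exact: u0.
have ED z : U z -> is_derive (t z) 1 (fun u => expR (2 * rho u)) (P (t z) * expR (2 * rho (t z))).
  by move=> Uz; exact: (is_derive_exp_rho rhoS (Dt Uz)).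
have kaD z : U z -> is_derive (t z) 1 kappa (derive1 kappa (t z)).
  by move=> Uz; exact: (kD _ (Dt Uz)).
have SS := shift_identity Ux w0.
have RIC := ricci_deformed oU gC gsym gunit bC bK gbsym gbunit gbE ED kaD D0 y Ux
  (erefl : w x = a ^+ 2 - mu * norm2 g b x) w0 SS (fun f => curvature_identity f Ux)
  (fun j l => ricci_tensorE j l Ux) PD QD RD.
have ID := @einstein_defect R n%:R a mu mubar (t x) (expR (2 * rho (t x))) (kappa (t x))
  (derive1 kappa (t x)) (derive1n 2 kappa (t x)) (derive1 rho (t x)) (derive1n 2 rho (t x))
  (qform (fun i j => g x i j) (y 0)) (pr (b x) y^T ^+ 2) (pr (s_row g b x) y^T ^+ 2) t0 u0 w0.
apply: etrans (etrans _ ID) _.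
  rewrite RIC (tr_difference_sq y (ginv_mul gunit Ux).1 (ginv_mul gunit Ux).2 (ginv_tr gsym Ux)
    (cov_mx_tr bK Ux) (s_rowE gsym bK Ux) (norm2E g b x) erefl w0 SS).
  rewrite alpha_gb_sq // qform_gb // hEin // alpha_sq // -qform_pr /div_deformation -qform_pr.
  rewrite -/(t x) /w /P.
  by [].
rewrite /X_fun /Y_fun /Z_fun (derive1_Delta kappaS Du) (derive2_Delta oD kappaS Du).
rewrite (derive1_P_fun rhoS Du) /P_fun.
by rewrite !mulNr.
Qed.

Hypotheses (n2 : (2 < n)%N) (a0 : a != 0).

Let good z := [/\ U z, t z != 0 & w z != 0].

Let continuous_w x : U x -> {for x, continuous w}.
Proof.
move=> Ux; apply: continuous_add; first exact: continuous_const.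
apply: continuous_opp; apply: continuous_mul; first exact: continuous_const.
exact: continuous_norm2.
Qed.

Lemma continuous_neq0 (f : 'rV[R]_n -> R) x : {for x, continuous f} -> f x != 0 ->
  \forall z \near x, f z != 0.
Proof.
move=> fc fx0; have fx : 0 < `|f x| by rewrite normr_gt0.
have /cvgrPdist_lt/(_ _ fx) := fc; apply: filterS => z.
by apply: contraTneq => ->; rewrite subr0 ltxx.
Qed.

(* The zero set of [b] has empty interior: where [b] vanishes identically, so do
   [s_ij] and [s_i], and the shift identity reads [0 = - a^2 g]. *)
Lemma b_not_near0 x : U x -> w x != 0 -> ~ (\forall z \near x, b z = 0).
Proof.
move=> Ux w0 b0; have bx := nbhs_singleton b0.
have S0 : cov_mx g b x = 0.
  apply/matrixP => i j; rewrite !mxE covE bx big1 => [|k _]; last by rewrite mxE mulr0.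
  rewrite subr0; have -> : dv j (fun z => b z 0 i) x = dv j (fun _ => 0) x.
    by apply: near_eq_derive; apply: filterS b0 => z ->; rewrite mxE.
  exact: partialE (is_derive_const 0 x (ev j)).
have := shift_identity Ux w0.
rewrite (s_rowE gsym bK Ux) S0 bx !mulmx0 !scaler0 !addr0 => /esym/eqP.
rewrite scaler_eq0 oppr_eq0 expf_eq0 /= (negPf a0) /= => /eqP gx0.
have [y [y0 _ _]] := common_zero (0 : 'rV[R]_n) 0 n2.
by have := gpos Ux y0; rewrite gx0 -qform_mx mulmx0 mul0mx mxE ltxx.
Qed.

(** Where w = 0, the closure clause of [s0_term] supplies points with w <> 0 arbitrarily near; the
    clause is the same for every y, and y = 0 is taken. Around such a point w stays nonzero, and b
    is not identically zero by [b_not_near0]. *)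
Lemma good_dense x : U x -> closure good x.
Proof.
move=> Ux B nB; apply: contrapT => nogood.
have [x1 [Ux1 nB1 w1]] : exists x1, [/\ U x1, nbhs x1 B & w x1 != 0].
  have [w0|w0] := eqVneq (w x) 0; last by exists x.
  have [L] := hT 0 Ux; rewrite /s0_term blen_sq // -/(t x) -/(w x) w0 eqxx /=.
  move=> [cl _] _.
  have nBU : nbhs x (B^° `&` U).
    by apply: filterI; [exact: nbhs_interior|exact: open_nbhs_nbhs].
  have [z [/= dz [Bz Uz]]] := cl _ nBU; exists z; split => //.
  by rewrite /w /t -blen_sq.
apply: (b_not_near0 Ux1 w1).
have nU : nbhs x1 U by exact: open_nbhs_nbhs.
have nw := continuous_neq0 (continuous_w Ux1) w1.
apply: filterS (filterI nB1 (filterI nU nw)) => z [Bz [Uz wz]].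
apply: norm2_eq0 => //; apply/eqP/negPn/negP => tz; apply: nogood.
by exists z.
Qed.

(** Three test vectors isolate the coefficients. A nonzero y annihilated by b and s leaves X times a
    positive number; b with raised index, on which s vanishes, leaves Y t^2; s with raised index
    leaves Z (w t)^2. *)
Lemma einstein_XYZ_good x : good x ->
  (forall y, ricci gb x y = (n%:R - 1) * mubar * alpha gb x y ^+ 2) ->
  [/\ X_fun n a mu mubar rho kappa (t x) = 0, Y_fun n a mu mubar rho kappa (t x) = 0
    & Z_fun n a mu rho kappa (t x) = 0].
Proof.
move=> [Ux t0 w0] Ein.
have H y : X_fun n a mu mubar rho kappa (t x) * qform (fun i j => g x i j) (y 0)
  + Y_fun n a mu mubar rho kappa (t x) * pr (b x) y^T ^+ 2
  + Z_fun n a mu rho kappa (t x) * pr (s_row g b x) y^T ^+ 2 = 0.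
  by rewrite -einstein_defect_at // Ein subrr.
have SS := shift_identity Ux w0.
have X0 : X_fun n a mu mubar rho kappa (t x) = 0.
  have [y [y0 by0 sy0]] := common_zero (b x) (s_row g b x) n2.
  have /eqP := H y; rewrite by0 sy0 expr0n !mulr0 !addr0 mulf_eq0.
  by rewrite (gt_eqF (gpos Ux y0)) orbF => /eqP.
have Y0 : Y_fun n a mu mubar rho kappa (t x) = 0.
  have /eqP := H (b x *m ginv g x).
  rewrite X0 mul0r add0r trmx_mul (ginv_tr gsym Ux) (pr_s_u2 (ginv_tr gsym Ux) (cov_mx_tr bK Ux) (s_rowE gsym bK Ux)).
  rewrite expr0n mulr0 addr0 -norm2E mulf_eq0 expf_eq0 /=.
  by rewrite -/(t x) (negPf t0) orbF => /eqP.
split=> //.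
have /eqP := H (s_row g b x *m ginv g x).
rewrite X0 Y0 !mul0r !add0r trmx_mul (ginv_tr gsym Ux).
rewrite (pr_s_u1 (ginv_mul gunit Ux).2 (ginv_tr gsym Ux) (cov_mx_tr bK Ux) (s_rowE gsym bK Ux)
  (norm2E g b x) (erefl : w x = a ^+ 2 - mu * norm2 g b x) SS).
move: (Z_fun _ _ _ _ _ _) => Zx.
rewrite mulf_eq0 expf_eq0 /= mulf_eq0 -/(t x) (negPf t0) (negPf w0) !orbF.
by move/eqP.
Qed.

(** X and Y have no w in the denominator, so they are continuous wherever t <> 0 and vanish at
    points with w = 0 as limits from the dense set. Z is asserted only where w <> 0, that is, at
    points of the dense set itself. *)
Lemma einstein_XYZ x :
  (forall x y, U x -> ricci gb x y = (n%:R - 1) * mubar * alpha gb x y ^+ 2) ->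
  U x -> t x != 0 ->
  X_fun n a mu mubar rho kappa (t x) = 0 /\ Y_fun n a mu mubar rho kappa (t x) = 0 /\
  (w x != 0 -> Z_fun n a mu rho kappa (t x) = 0).
Proof.
move=> Ein Ux t0.
have d0 : Delta kappa (t x) != 0 by exact: D0.
have cl := good_dense Ux; have ct := continuous_norm2 Ux.
split; [|split].
- apply: (closure_zero (f := fun z => X_fun n a mu mubar rho kappa (t z)) _ cl).
    apply: (@continuous_comp _ _ _ t (X_fun n a mu mubar rho kappa) x ct).
    by apply: (@continuous_X_fun R D) => //; exact: Dt.
  by move=> z gz; have [] := einstein_XYZ_good gz (fun y => Ein z y (let: And3 Uz _ _ := gz in Uz)).
- apply: (closure_zero (f := fun z => Y_fun n a mu mubar rho kappa (t z)) _ cl).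
    apply: (@continuous_comp _ _ _ t (Y_fun n a mu mubar rho kappa) x ct).
    by apply: (@continuous_Y_fun R D) => //; exact: Dt.
  by move=> z gz; have [] := einstein_XYZ_good gz (fun y => Ein z y (let: And3 Uz _ _ := gz in Uz)).
- by move=> w0; have [] // := @einstein_XYZ_good x (And3 Ux t0 w0) (fun y => Ein x y Ux).
Qed.

(** The squared deformed norm is replaced by its quadratic form, so that the Einstein defect is
    visibly continuous; it is zero on the dense set by [einstein_defect_at]. *)
Lemma XYZ_einstein x y :
  (forall x, U x -> t x != 0 ->
    X_fun n a mu mubar rho kappa (t x) = 0 /\ Y_fun n a mu mubar rho kappa (t x) = 0 /\
    (w x != 0 -> Z_fun n a mu rho kappa (t x) = 0)) ->
  U x -> ricci gb x y = (n%:R - 1) * mubar * alpha gb x y ^+ 2.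
Proof.
move=> XYZ Ux; apply/eqP; rewrite -subr_eq0 alpha_gb_sq //; apply/eqP.
apply: (closure_zero (f := fun z => ricci gb z y
  - (n%:R - 1) * mubar * qform (fun i j => gb z i j) (y 0)) _ (good_dense Ux)).
  apply: continuous_add; first exact: (@continuous_ricci R n U gb).
  apply: continuous_opp; apply: continuous_mul; first exact: continuous_const.
  apply: continuous_bigsum => i; apply: continuous_bigsum => j.
  apply: continuous_mul; last exact: continuous_const.
  apply: continuous_mul; last exact: continuous_const.
  exact: Ck_continuous (gbC i j) Ux.
move=> z [Uz tz wz]; rewrite -alpha_gb_sq // einstein_defect_at //.
have [-> [-> Z0]] := XYZ z Uz tz.
by rewrite (Z0 wz) !mul0r !addr0.
Qed.

End Chart.

Theorem theorem5p1 (R : realType) (n : nat) (M : manifold R n)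
  (al : metric M) (be : oneform M) (a mu : R)
  (rho kappa : R -> R) (D : set R) (albar : metric M) (mubar : R) :
  (2 < n)%N ->
  connected [set: M] ->
  einstein al mu ->
  killing al be ->
  ~ constant_length al be ->
  a != 0 ->
  (forall i x y, img i x ->
     exists2 L : R, s0_term (al i) (be i) a mu x y L &
       t00 (al i) (be i) x y
       + (a ^+ 2 - mu * blen (al i) (be i) x ^+ 2) * alpha (al i) x y ^+ 2
       + mu * (blen (al i) (be i) x ^+ 2 * alpha (al i) x y ^+ 2
               - beta (be i) x y ^+ 2)
       - mu * L = 0) ->
  (forall i x y, img i x ->
     Rbb (al i) (be i) x y
     = mu * (blen (al i) (be i) x ^+ 2 * alpha (al i) x y ^+ 2
             - beta (be i) x y ^+ 2)) ->
  open D ->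
  (forall i x, img i x -> D (blen (al i) (be i) x ^+ 2)) ->
  smooth1_on D rho ->
  smooth1_on D kappa ->
  (forall i x, img i x -> 0 < Delta kappa (blen (al i) (be i) x ^+ 2)) ->
  (forall i x y, img i x ->
     alpha (albar i) x y
     = expR (rho (blen (al i) (be i) x ^+ 2))
       * Num.sqrt (alpha (al i) x y ^+ 2
                   - kappa (blen (al i) (be i) x ^+ 2) * beta (be i) x y ^+ 2)) ->
  einstein albar mubar <->
  (forall i x, img i x ->
     let t := blen (al i) (be i) x ^+ 2 in
     t != 0 ->
     X_fun n a mu mubar rho kappa t = 0 /\
     Y_fun n a mu mubar rho kappa t = 0 /\
     (a ^+ 2 - mu * t != 0 -> Z_fun n a mu rho kappa t = 0)).
Proof.
move=> n2 _ Ein K _ a0 hT hR oD hD rhoS kappaS hDelta halpha.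
(* Both sides of the equivalence quantify over charts and the points of their images, so it is
   settled chart by chart; what follows extracts the chart data in components. *)
have oU c : open (img (M := M) c) by exact: image_open.
have mpos (m : metric M) c x (y : 'rV[R]_n) : img c x -> y != 0 ->
    0 < qform (fun i j => m c x i j) (y 0).
  by move=> cx y0; rewrite -qform_mx; exact: metric_pos.
have msym (m : metric M) c x i j : img c x -> m c x i j = m c x j i.
  by move=> cx; rewrite -[in RHS](Defs.metric_sym m cx) mxE.
have mC (m : metric M) c i j : Ck_on 2 (img c) (fun z => m c z i j : R).
  exact: Ck_entry (oU c) (metric_smooth m c 2).
have bC c i : Ck_on 2 (img c) (fun z => be c z 0 i : R).
  exact: Ck_entry (oU c) (oneform_smooth be c 2).
have blenE c x : img c x -> norm2 (al c) (be c) x = blen (al c) (be c) x ^+ 2.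
  by move=> cx; rewrite (blen_sq (be c) (mpos al c)).
split=> [Einb c x cx /= t0|XYZ c x y cx].
  rewrite -blenE // in t0 *.
  exact: (@einstein_XYZ R n (img c) (al c) (albar c) (be c) (oU c) (mC al c)
    (msym al c) (mpos al c) (bC c) (K c) a mu mubar (Ein c) (hT c) (hR c) D rho kappa
    (msym albar c) (mpos albar c) oD (hD c) rhoS kappaS (hDelta c) (halpha c) n2 a0 x
    (Einb c) cx t0).
apply: (@XYZ_einstein R n (img c) (al c) (albar c) (be c) (oU c) (mC al c)
    (msym al c) (mpos al c) (bC c) (K c) a mu mubar (Ein c) (hT c) (hR c) D rho kappa
    (mC albar c) (msym albar c) (mpos albar c) oD (hD c) rhoS kappaS (hDelta c) (halpha c) n2 a0 x y
    _ cx).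
by move=> z cz; rewrite blenE //; exact: XYZ.
Qed.
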